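(* Let $(M^\circ,\omega)$ be a symplectic 6-manifold and $\varphi_0$ an $F$-harmonic primitive 3-form belonging to the orbit $\mathcal{O}_0^+$ at every point, with associated Lagrangian foliation $\mathcal{L}$, metric $g_{\mathcal{L}}$ and partial connection $D$. Then the Bott connection $\nabla^B$ of $\mathcal{L}$ is dual to $D$ in the sense of Hessian structures: on each leaf $L$ of $\mathcal{L}$, $\nabla^B=D'$, where $D'=2\nabla-D$ and $\nabla$ is the Levi-Civita connection of the induced metric $g_L$ on $L$. In particular, with respect to the affine structure determined by $\nabla^B$, the metric $g_L$ on each leaf $L$ is Hessian and its local potential functions all solve a real Monge–Ampère equation with constant right-hand side (i.e. the determinant of the Hessian of the potential in affine coordinates is constant).
   Context: A 3-form $\varphi$ on a symplectic 6-manifold $(M,\omega)$ is primitive if $\omega\wedge\varphi=0$. For such $\varphi$: $K(\varphi)\in\mathrm{End}(TM)$ is defined by $\iota_{K(\varphi)X}\frac{\omega^3}{3!}=-\iota_X\varphi\wedge\varphi$, and the 3-form $F(\varphi)$ by $F(\varphi)(X,Y,Z)=-2\varphi(K(\varphi)X,Y,Z)$. $\varphi$ is $F$-harmonic if $d\varphi=0$ and $dF(\varphi)=0$. A primitive $\varphi$ belongs to $\mathcal{O}_0^+$ at $p$ if there is a basis $e^1,\dots,e^6$ of $T_p^*M$ with $\omega=e^{12}+e^{34}+e^{56}$ and $\varphi=e^{146}+e^{236}+e^{245}$. For $(M^\circ,\omega,\varphi_0)$ as in the claim, write $K=K(\varphi_0)$. Known: $K^2=0$, the Nijenhuis tensor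 of $K$ vanishes, and $\mathcal{L}:=\ker K=\mathrm{Im}\,K$ is a Lagrangian foliation carrying the Riemannian metric $g_{\mathcal{L}}(X,Y)=\omega(K^{-1}X,Y)$, where $K^{-1}X$ is any vector field with $K(K^{-1}X)=X$; $g_L$ denotes the induced metric on a leaf $L$. The partial connection $D$ on $\mathcal{L}$ is $D_XY=K[X,K^{-1}Y]$ for $X,Y$ tangent to $\mathcal{L}$; on each leaf it is a torsion-free flat connection for which $g_L$ is Hessian with parallel volume form. The dual Hessian structure of $(g_L,D)$ is $(g_L,D')$ with $D+D'=2\nabla$. The Bott (partial) connection $\nabla^B$ on $\mathcal{L}$ is the torsion-free flat partial connection characterized by $$\omega(\nabla^B_XY,Z)=X\omega(Y,Z)+\omega([X,Z],Y)$$ for all $X,Y$ tangent to $\mathcal{L}$ and arbitrary vector fields $Z$. A metric is Hessian with respect to a torsion-free flat connection if in local affine coordinates it is the Hessian matrix of a function, called a local potential. *)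

(* Defs.v *)
From HB Require Import structures.
From mathcomp Require Import all_boot all_order all_fingroup all_algebra.
From mathcomp Require Import all_classical all_reals.
From mathcomp Require Import topology normedtype derive.
From mathcomp Require Import ring.

Set Implicit Arguments.
Unset Strict Implicit.
Unset Printing Implicit Defensive.
Import Order.TTheory GRing.Theory Num.Theory.
Import numFieldNormedType.Exports.
Local Open Scope classical_set_scope.
Local Open Scope ring_scope.

Definition evec (R : realType) (n : nat) (i : 'I_n) : 'rV[R]_n := delta_mx 0 i.

Fixpoint Ck (R : realType) (n k : nat) (U : set 'rV[R]_n) (f : 'rV[R]_n -> R)
    : Prop :=
  (forall x, U x -> {for x, continuous f}) /\
  if k is k'.+1 then
    forall i : 'I_n, (forall x, U x -> derivable f x (evec R i)) /\
                     Ck k' U ('D_(evec R i) f)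
  else True.

Definition smooth_on (R : realType) (n : nat) (U : set 'rV[R]_n)
    (f : 'rV[R]_n -> R) : Prop := forall k, Ck k U f.

Lemma Ck_continuous (R : realType) (n k : nat) (U : set 'rV[R]_n) f x :
  Ck k U f -> U x -> {for x, continuous f}.
Proof. by case: k => [|k] [cf _]; exact: cf. Qed.

Lemma CkW (R : realType) (n k : nat) (U : set 'rV[R]_n) f :
  Ck k.+1 U f -> Ck k U f.
Proof.
elim: k f => [|k IH] f; first by move=> [cf _]; split.
move=> [cf df]; split => // i; have [di Ci] := df i.
by split => //; exact: IH.
Qed.

Lemma Ck_eq (R : realType) (n k : nat) (U : set 'rV[R]_n) f g :
  open U -> (forall x, U x -> f x = g x) -> Ck k U f -> Ck k U g.
Proof.
move=> oU.
have nfg f' g' : (forall x, U x -> f' x = g' x :> R) ->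
    forall x, U x -> \forall y \near x, f' y = g' y.
  by move=> fg x Ux; apply: (filterS fg); exact: open_nbhs_nbhs.
have cfg f' g' : (forall x, U x -> f' x = g' x :> R) ->
    (forall x, U x -> {for x, continuous f'}) ->
    forall x, U x -> {for x, continuous g'}.
  move=> fg cf x Ux; rewrite /prop_for /continuous_at -(fg _ Ux).
  exact: (cvg_trans (near_eq_cvg (nfg _ _ fg x Ux)) (cf x Ux)).
elim: k f g => [|k IH] f g fg.
  by move=> [cf _]; split => //; exact: cfg cf.
move=> [cf df]; split; first exact: cfg cf.
move=> i; have [di Ci] := df i; split.
  by move=> x Ux; exact: (near_eq_derivable (nfg _ _ fg x Ux) (di x Ux)).
by apply: IH Ci => x Ux; exact: (near_eq_derive _ (nfg _ _ fg x Ux)).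
Qed.

Lemma Ck_cst (R : realType) (n k : nat) (U : set 'rV[R]_n) (r : R) :
  Ck k U (cst r).
Proof.
elim: k r => [|k IH] r; first by split => // x _; exact: cst_continuous.
split; first by move=> x _; exact: cst_continuous.
move=> i; split; first by move=> x _; exact: derivable_cst.
have -> : 'D_(evec R i) (cst r) = cst 0 by apply/funext => x; exact: derive_cst.
exact: IH.
Qed.

Lemma CkD (R : realType) (n k : nat) (U : set 'rV[R]_n) f g :
  open U -> Ck k U f -> Ck k U g -> Ck k U (f + g).
Proof.
move=> oU; elim: k f g => [|k IH] f g.
  by move=> [cf _] [cg _]; split => // x Ux; exact: (cvgD (cf x Ux) (cg x Ux)).
move=> [cf df] [cg dg]; split.
  by move=> x Ux; exact: (cvgD (cf x Ux) (cg x Ux)).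
move=> i; have [[di Ci] [di' Ci']] := (df i, dg i); split.
  by move=> x Ux; apply: derivableD; [exact: di|exact: di'].
apply: (Ck_eq oU _ (IH _ _ Ci Ci')) => x Ux.
by rewrite deriveD //; [exact: di|exact: di'].
Qed.

Lemma CkM (R : realType) (n k : nat) (U : set 'rV[R]_n) f g :
  open U -> Ck k U f -> Ck k U g -> Ck k U (f * g).
Proof.
move=> oU; elim: k f g => [|k IH] f g.
  by move=> [cf _] [cg _]; split => // x Ux; exact: (cvgM (cf x Ux) (cg x Ux)).
move=> Cf Cg; have [[cf df] [cg dg]] := (Cf, Cg); split.
  by move=> x Ux; exact: (cvgM (cf x Ux) (cg x Ux)).
move=> i; have [[di Ci] [di' Ci']] := (df i, dg i); split.
  by move=> x Ux; apply: derivableM; [exact: di|exact: di'].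
apply: (Ck_eq oU _ (CkD oU (IH _ _ (CkW Cf) Ci') (IH _ _ (CkW Cg) Ci))) => x Ux.
by rewrite deriveM //; [exact: di|exact: di'].
Qed.

(* [ch_to] and [ch_from] are total; only their restrictions to [ch_dom] and
   to its image matter. *)
Record chart (R : realType) (n : nat) (M : topologicalType) := Chart {
  ch_dom : set M;
  ch_to : M -> 'rV[R]_n;
  ch_from : 'rV[R]_n -> M }.

Definition ch_img (R : realType) n (M : topologicalType) (c : chart R n M) :
  set 'rV[R]_n := ch_to c @` ch_dom c.

Definition is_chart (R : realType) n (M : topologicalType) (c : chart R n M) :=
  [/\ open (ch_dom c), open (ch_img c),
      forall p, ch_dom c p -> ch_from c (ch_to c p) = p,
      forall p, ch_dom c p -> {for p, continuous (ch_to c)} &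
      forall y, ch_img c y -> {for y, continuous (ch_from c)}].

Definition smooth_transition (R : realType) n (M : topologicalType)
    (c c' : chart R n M) :=
  forall k : 'I_n, smooth_on (ch_to c @` (ch_dom c `&` ch_dom c'))
                             (fun y => ch_to c' (ch_from c y) 0 k).

Record manifold (R : realType) (n : nat) := Manifold {
  mf_top :> topologicalType;
  mf_atlas : set (chart R n mf_top);
  mf_hausdorff : hausdorff_space mf_top;
  mf_second_countable : @second_countable mf_top;
  mf_cover : forall p : mf_top, exists2 c, mf_atlas c & ch_dom c p;
  mf_charts : forall c, mf_atlas c -> is_chart c;
  mf_compat : forall c c', mf_atlas c -> mf_atlas c' -> smooth_transition c c' }.

(* Membership in the maximal atlas. *)
Definition smooth_chart (R : realType) n (M : manifold R n) (c : chart R n M) :=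
  is_chart c /\
  forall c', mf_atlas c' -> smooth_transition c c' /\ smooth_transition c' c.

Definition smooth (R : realType) n (M : manifold R n) (f : M -> R) : Prop :=
  forall c, mf_atlas c -> smooth_on (ch_img c) (f \o ch_from c).

Definition smooth_pred (R : realType) n (M : manifold R n) : {pred (M -> R)} :=
  fun f => `[< smooth f >].

Lemma smooth_subring (R : realType) n (M : manifold R n) :
  subring_closed (@smooth_pred R n M).
Proof.
have oI c : mf_atlas c -> open (@ch_img R n M c).
  by move=> /mf_charts[].
have sc (r : R) : smooth (cst r : M -> R) by move=> c _ k; exact: Ck_cst.
have sM (f g : M -> R) : smooth f -> smooth g -> smooth (f * g).
  by move=> sf sg c Ac k; apply: CkM; [exact: oI|exact: sf|exact: sg].
have sD (f g : M -> R) : smooth f -> smooth g -> smooth (f + g).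
  by move=> sf sg c Ac k; apply: CkD; [exact: oI|exact: sf|exact: sg].
split; first by apply/asboolP; exact: sc.
  move=> f g /asboolP sf /asboolP sg; apply/asboolP.
  have -> : f - g = f + cst (-1) * g.
    by apply/funext => p; rewrite !fctE /= mulN1r.
  by apply: sD => //; exact: sM.
by move=> f g /asboolP sf /asboolP sg; apply/asboolP; exact: sM.
Qed.

Lemma smooth_scaler (R : realType) n (M : manifold R n) :
  scaler_closed (@smooth_pred R n M).
Proof.
move=> r f /asboolP sf; apply/asboolP => c Ac k.
have -> : (r *: f) \o ch_from c = cst r * (f \o ch_from c) by [].
by apply: CkM; [have [] := mf_charts Ac|exact: Ck_cst|exact: sf].
Qed.

HB.instance Definition _ (R : realType) n (M : manifold R n) :=
  GRing.isSubringClosed.Build (M -> R) (@smooth_pred R n M)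
    (@smooth_subring R n M).
HB.instance Definition _ (R : realType) n (M : manifold R n) :=
  GRing.isScaleClosed.Build R (M -> R) (@smooth_pred R n M)
    (@smooth_scaler R n M).

Record Cinf (R : realType) n (M : manifold R n) := MkCinf {
  Cinf_val :> M -> R;
  CinfP : Cinf_val \in @smooth_pred R n M }.

HB.instance Definition _ (R : realType) n (M : manifold R n) :=
  [isSub for @Cinf_val R n M].
HB.instance Definition _ (R : realType) n (M : manifold R n) :=
  [Choice of @Cinf R n M by <:].
HB.instance Definition _ (R : realType) n (M : manifold R n) :=
  GRing.SubChoice_isSubComPzRing.Build (M -> R) (@smooth_pred R n M) (Cinf M)
    (@smooth_subring R n M).
HB.instance Definition _ (R : realType) n (M : manifold R n) :=
  [SubZmodule_isSubLmodule of @Cinf R n M by <:].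

(* Vector fields are the derivations of C^oo(M). *)
Definition derivation (R : realType) n (M : manifold R n)
    (X : Cinf M -> Cinf M) : Prop :=
  (forall (a : R) f g, X (a *: f + g) = a *: X f + X g) /\
  (forall f g, X (f * g) = f * X g + g * X f).

Definition deriv_pred (R : realType) n (M : manifold R n) :
  {pred (Cinf M -> Cinf M)} := fun X => `[< derivation X >].

Lemma deriv_zmod (R : realType) n (M : manifold R n) :
  zmod_closed (@deriv_pred R n M).
Proof.
split.
  have E f : (0 : Cinf M -> Cinf M) f = 0 by [].
  apply/asboolP; split => [a f g|f g]; rewrite !E.
    by rewrite scaler0 addr0.
  by rewrite !mulr0 addr0.
move=> X Y /asboolP[lX mX] /asboolP[lY mY]; apply/asboolP.
have E f : (X - Y) f = X f - Y f by [].
split => [a f g|f g]; rewrite !E.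
  by rewrite lX lY scalerBr opprD addrACA.
by rewrite mX mY !mulrBr opprD addrACA.
Qed.

HB.instance Definition _ (R : realType) n (M : manifold R n) :=
  GRing.isZmodClosed.Build (Cinf M -> Cinf M) (@deriv_pred R n M)
    (@deriv_zmod R n M).

Record vfield (R : realType) n (M : manifold R n) := MkVfield {
  vf_val :> Cinf M -> Cinf M;
  vfP : vf_val \in @deriv_pred R n M }.

HB.instance Definition _ (R : realType) n (M : manifold R n) :=
  [isSub for @vf_val R n M].
HB.instance Definition _ (R : realType) n (M : manifold R n) :=
  [Choice of @vfield R n M by <:].
HB.instance Definition _ (R : realType) n (M : manifold R n) :=
  [SubChoice_isSubZmodule of @vfield R n M by <:].

Lemma vf_scale_subproof (R : realType) n (M : manifold R n)
    (h : Cinf M) (X : vfield M) :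
  (fun f => h * X f) \in @deriv_pred R n M.
Proof.
have /asboolP[lX mX] := vfP X; apply/asboolP; split => [a f g|f g].
  rewrite lX mulrDr; congr (_ + _).
  by apply/val_inj/funext => p; rewrite /= !fctE /= /GRing.scale /= mulrCA.
by rewrite mX mulrDr !(mulrCA h).
Qed.

Definition vf_scale (R : realType) n (M : manifold R n)
  (h : Cinf M) (X : vfield M) : vfield M := MkVfield (vf_scale_subproof h X).

Lemma vf_scaleA (R : realType) n (M : manifold R n) (a b : Cinf M)
  (X : vfield M) : vf_scale a (vf_scale b X) = vf_scale (a * b) X.
Proof. by apply/val_inj/funext => f /=; rewrite mulrA. Qed.

Lemma vf_scale1 (R : realType) n (M : manifold R n) :
  left_id 1 (@vf_scale R n M).
Proof. by move=> X; apply/val_inj/funext => f /=; rewrite mul1r. Qed.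

Lemma vf_scaleDr (R : realType) n (M : manifold R n) :
  right_distributive (@vf_scale R n M) +%R.
Proof. by move=> a X Y; apply/val_inj/funext => f /=; exact: mulrDr. Qed.

Lemma vf_scaleDl (R : realType) n (M : manifold R n) (X : vfield M) :
  {morph (@vf_scale R n M)^~ X : a b / a + b}.
Proof. by move=> a b; apply/val_inj/funext => f /=; exact: mulrDl. Qed.

HB.instance Definition _ (R : realType) n (M : manifold R n) :=
  GRing.Zmodule_isLmodule.Build (Cinf M) (vfield M)
    (@vf_scaleA R n M) (@vf_scale1 R n M) (@vf_scaleDr R n M)
    (@vf_scaleDl R n M).

Lemma lie_subproof (R : realType) n (M : manifold R n) (X Y : vfield M) :
  (fun f => X (Y f) - Y (X f)) \in @deriv_pred R n M.
Proof.
have /asboolP[lX mX] := vfP X; have /asboolP[lY mY] := vfP Y.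
have aX f g : X (f + g) = X f + X g by rewrite -[f]scale1r lX !scale1r.
have aY f g : Y (f + g) = Y f + Y g by rewrite -[f]scale1r lY !scale1r.
apply/asboolP; split => [a f g|f g].
  by rewrite lY lX lX lY scalerBr opprD addrACA.
by rewrite mY mX aX aY !mX !mY; ring.
Qed.

Definition lie (R : realType) n (M : manifold R n) (X Y : vfield M) :
  vfield M := MkVfield (lie_subproof X Y).

Definition vat (R : realType) n (M : manifold R n) (X : vfield M) (p : M) :
  Cinf M -> R := fun f => X f p.

(* T_pM, as the set of point derivations of C^oo(M) at p. *)
Definition tangent (R : realType) n (M : manifold R n) (p : M) :
    set (Cinf M -> R) :=
  [set v | (forall (a : R) (f g : Cinf M), v (a *: f + g) = a * v f + v g) /\
           (forall f g : Cinf M, v (f * g) = f p * v g + g p * v f)].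

Definition covector (R : realType) n (M : manifold R n) (p : M)
    (l : (Cinf M -> R) -> R) : Prop :=
  forall (a : R) v w, tangent p v -> tangent p w ->
    l (fun f => a * v f + w f) = a * l v + l w.

Definition cotangent_basis (R : realType) n (M : manifold R n) (p : M)
    (e : 'I_n -> (Cinf M -> R) -> R) : Prop :=
  (forall i, covector p (e i)) /\
  (forall l, covector p l ->
     exists! a : 'rV[R]_n,
       forall v, tangent p v -> l v = \sum_(i < n) a 0 i * e i v).

(* A k-form is an alternating C^oo(M)-multilinear map on vector fields; see
   [is_form]. *)
Definition dform (R : realType) n (M : manifold R n) (k : nat) : Type :=
  ('I_k -> vfield M) -> Cinf M.

Definition upd (T : Type) (k : nat) (Xs : 'I_k -> T) (i : 'I_k) (Y : T) :
  'I_k -> T := fun j => if j == i then Y else Xs j.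

Definition scons (T : Type) (k : nat) (Y : T) (Xs : 'I_k -> T) :
  'I_k.+1 -> T := fun j => if unlift ord0 j is Some j' then Xs j' else Y.

Definition is_form (R : realType) n (M : manifold R n) k (al : dform M k) :=
  (forall Xs i (h : Cinf M) Y Z,
     al (upd Xs i (h *: Y + Z)) = h * al (upd Xs i Y) + al (upd Xs i Z)) /\
  (forall Xs i j, i != j -> Xs i = Xs j -> al Xs = 0).

Definition eval2 (R : realType) n (M : manifold R n) (al : dform M 2)
  (X Y : vfield M) : Cinf M := al (scons X (fun _ => Y)).

Definition contract (R : realType) n (M : manifold R n) k (X : vfield M)
  (al : dform M k.+1) : dform M k := fun Xs => al (scons X Xs).

(* Normalized so that (e^1 /\ ... /\ e^k)(X_1, ..., X_k) = det (e^i(X_j)). *)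
Definition wedge (R : realType) n (M : manifold R n) k l
    (al : dform M k) (be : dform M l) : dform M (k + l) := fun Xs =>
  ((k`! * l`!)%:R^-1 : R) *:
  \sum_(s : 'S_(k + l))
     (-1) ^+ s * (al (fun a => Xs (s (lshift l a))) *
                  be (fun b => Xs (s (rshift k b)))).

(* For i < m = lift i j, the family Xs (lift i (lift j _)) is Xs with
   X_i and X_m removed. *)
Definition extd (R : realType) n (M : manifold R n) k (al : dform M k.+1) :
    dform M k.+2 := fun Xs =>
  \sum_(i < k.+2) (-1) ^+ i * Xs i (al (fun a => Xs (lift i a))) +
  \sum_(i < k.+2) \sum_(j < k.+1 | (i < lift i j)%N)
    (-1) ^+ (i + lift i j) *
    al (scons (lie (Xs i) (Xs (lift i j))) (fun a => Xs (lift i (lift j a)))).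

Definition symplectic (R : realType) n (M : manifold R n) (om : dform M 2) :=
  [/\ is_form om, extd om = (fun=> 0) &
      forall (p : M) (X : vfield M),
        (forall Y, eval2 om X Y p = 0) -> vat X p = (fun=> 0)].

Definition primitive_form (R : realType) n (M : manifold R n) (om : dform M 2)
  (phi : dform M 3) : Prop := wedge om phi = (fun=> 0).

(* The covector monomial e^{i_1 ... i_k} at p, with indices counted from 1. *)
Definition emono (R : realType) n (M : manifold R n.+1) (p : M)
    (e : 'I_n.+1 -> (Cinf M -> R) -> R) k (s : k.-tuple nat)
    (Xs : 'I_k -> vfield M) : R :=
  \det (\matrix_(a < k, b < k) e (inord (tnth s a).-1) (vat (Xs b) p)).

Definition orbit_O0p (R : realType) (M : manifold R 6) (om : dform M 2)
    (phi : dform M 3) (p : M) : Prop :=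
  exists e : 'I_6 -> (Cinf M -> R) -> R,
  [/\ cotangent_basis p e,
      forall Xs, om Xs p = emono p e [tuple 1; 2]%N Xs
                         + emono p e [tuple 3; 4]%N Xs
                         + emono p e [tuple 5; 6]%N Xs &
      forall Xs, phi Xs p = emono p e [tuple 1; 4; 6]%N Xs
                          + emono p e [tuple 2; 3; 6]%N Xs
                          + emono p e [tuple 2; 4; 5]%N Xs].

(* Characterizes K = K(phi). *)
Definition is_K (R : realType) (M : manifold R 6) (om : dform M 2)
    (phi : dform M 3) (K : vfield M -> vfield M) : Prop :=
  forall X,
    contract (K X) ((3`!%:R^-1 : R) *: (wedge (wedge om om) om : dform M 6))
    = - (wedge (contract X phi) phi : dform M 5).

Definition Fform (R : realType) (M : manifold R 6) (K : vfield M -> vfield M)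
    (phi : dform M 3) : dform M 3 := fun Xs =>
  - 2%:R * phi (upd Xs ord0 (K (Xs ord0))).

Definition F_harmonic (R : realType) (M : manifold R 6)
    (K : vfield M -> vfield M) (phi : dform M 3) : Prop :=
  extd phi = (fun=> 0) /\ extd (Fform K phi) = (fun=> 0).

Definition tangent_to (R : realType) (M : manifold R 6)
  (K : vfield M -> vfield M) : set (vfield M) := [set X | K X = 0].

Definition leafdist (R : realType) (M : manifold R 6)
    (K : vfield M -> vfield M) (p : M) : set (Cinf M -> R) :=
  [set v | exists2 X, v = vat X p & vat (K X) p = (fun=> 0)].

(* D_X Y = K [X, K^-1 Y]. Since K^-1 Y is only asked to exist near each point
   and D is local, W = K^-1 Y is here any field with K W = Y near p. *)
Definition is_D (R : realType) (M : manifold R 6) (K : vfield M -> vfield M)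
    (D : vfield M -> vfield M -> vfield M) : Prop :=
  forall X Y W p, tangent_to K X -> tangent_to K Y ->
    (\forall r \near p, vat (K W) r = vat Y r) ->
    vat (D X Y) p = vat (K (lie X W)) p.

Definition is_Bott (R : realType) (M : manifold R 6) (om : dform M 2)
    (K : vfield M -> vfield M) (nB : vfield M -> vfield M -> vfield M) :=
  forall X Y Z, tangent_to K X -> tangent_to K Y ->
    eval2 om (nB X Y) Z = X (eval2 om Y Z) + eval2 om (lie X Z) Y.

(* For continuous maps, smoothness in charts is equivalent to pulling smooth
   functions back to smooth functions. *)
Record smap (R : realType) m n (L : manifold R m) (M : manifold R n) := Smap {
  sm_val :> L -> M;
  sm_continuous : continuous sm_val;
  sm_pull : forall f : Cinf M, (fun q => f (sm_val q)) \in @smooth_pred R m L }.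

Definition pull (R : realType) m n (L : manifold R m) (M : manifold R n)
  (io : smap L M) (f : Cinf M) : Cinf L := MkCinf (sm_pull io f).

Definition pushv (R : realType) m n (L : manifold R m) (M : manifold R n)
  (io : smap L M) (v : Cinf L -> R) : Cinf M -> R := fun f => v (pull io f).

Definition related (R : realType) m n (L : manifold R m) (M : manifold R n)
    (io : smap L M) (X' : vfield L) (X : vfield M) : Prop :=
  forall q, pushv io (vat X' q) = vat X (io q).

Definition integral_leaf (R : realType) (M : manifold R 6)
    (K : vfield M -> vfield M) (L : manifold R 3) (io : smap L M) : Prop :=
  [/\ [set: L] !=set0, connected [set: L], injective io,
      forall q, {in tangent q &, injective (pushv io)} &
      forall q, pushv io @` tangent q = leafdist K (io q)].

Definition is_leaf (R : realType) (M : manifold R 6)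
    (K : vfield M -> vfield M) (L : manifold R 3) (io : smap L M) : Prop :=
  integral_leaf K io /\
  forall (L' : manifold R 3) (io' : smap L' M), integral_leaf K io' ->
    range io' `&` range io !=set0 -> range io' `<=` range io.

(* The metric on the leaf induced by (X, Y) |-> omega (K^-1 X, Y). *)
Definition is_leaf_metric (R : realType) (M : manifold R 6) (om : dform M 2)
    (K : vfield M -> vfield M) (L : manifold R 3) (io : smap L M)
    (g : vfield L -> vfield L -> Cinf L) : Prop :=
  forall X Y q (W Z : vfield M),
    vat (K W) (io q) = pushv io (vat X q) ->
    vat Z (io q) = pushv io (vat Y q) ->
    g X Y q = eval2 om W Z (io q).

Definition is_connection (R : realType) n (M : manifold R n)
    (C : vfield M -> vfield M -> vfield M) : Prop :=
  [/\ forall (h : Cinf M) X X' Y, C (h *: X + X') Y = h *: C X Y + C X' Y,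
      forall X Y Y', C X (Y + Y') = C X Y + C X Y' &
      forall (h : Cinf M) (X Y : vfield M), C X (h *: Y) = X h *: Y + h *: C X Y].

Definition torsion_free (R : realType) n (M : manifold R n)
    (C : vfield M -> vfield M -> vfield M) : Prop :=
  forall X Y, C X Y - C Y X = lie X Y.

Definition flat (R : realType) n (M : manifold R n)
    (C : vfield M -> vfield M -> vfield M) : Prop :=
  forall X Y Z, C X (C Y Z) - C Y (C X Z) = C (lie X Y) Z.

Definition is_LeviCivita (R : realType) n (M : manifold R n)
    (g : vfield M -> vfield M -> Cinf M)
    (C : vfield M -> vfield M -> vfield M) : Prop :=
  [/\ is_connection C, torsion_free C &
      forall X Y Z : vfield M, X (g Y Z) = g (C X Y) Z + g Y (C X Z)].

(* The connection on a leaf induced by a partial connection P along ker K;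
   sections of ker K restrict to the vector fields on the leaf related to
   them, and these generate all vector fields on the leaf locally. *)
Definition induced_connection (R : realType) (M : manifold R 6)
    (K : vfield M -> vfield M) (L : manifold R 3) (io : smap L M)
    (P : vfield M -> vfield M -> vfield M)
    (C : vfield L -> vfield L -> vfield L) : Prop :=
  is_connection C /\
  forall X Y X' Y', tangent_to K X -> tangent_to K Y ->
    related io X' X -> related io Y' Y -> related io (C X' Y') (P X Y).

(* X agrees at q with the i-th coordinate vector field of c. *)
Definition coord_at (R : realType) n (M : manifold R n) (c : chart R n M)
    (i : 'I_n) (X : vfield M) (q : M) : Prop :=
  forall f : Cinf M, X f q = 'D_(evec R i) (f \o ch_from c) (ch_to c q).

(* The Christoffel symbols of C vanish in the coordinates c. *)
Definition affine_chart (R : realType) n (M : manifold R n)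
    (C : vfield M -> vfield M -> vfield M) (c : chart R n M) : Prop :=
  smooth_chart c /\
  forall i j (X Y : vfield M) q, ch_dom c q ->
    (\forall r \near q, coord_at c i X r) ->
    (\forall r \near q, coord_at c j Y r) ->
    vat (C X Y) q = (fun=> 0).

Definition hess (R : realType) n (u : 'rV[R]_n -> R) (y : 'rV[R]_n) :
  'M[R]_n := \matrix_(i, j) 'D_(evec R i) ('D_(evec R j) u) y.

(* u, a function of the coordinates c, is a potential of g on V. *)
Definition potential_on (R : realType) n (M : manifold R n)
    (g : vfield M -> vfield M -> Cinf M) (c : chart R n M) (V : set M)
    (u : 'rV[R]_n -> R) : Prop :=
  [/\ open V, V `<=` ch_dom c, smooth_on (ch_to c @` V) u &
      forall q, V q -> forall i j (X Y : vfield M),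
        coord_at c i X q -> coord_at c j Y q ->
        g X Y q = hess u (ch_to c q) i j].

Definition hessian_metric (R : realType) n (M : manifold R n)
    (g : vfield M -> vfield M -> Cinf M)
    (C : vfield M -> vfield M -> vfield M) : Prop :=
  [/\ is_connection C, torsion_free C, flat C &
      forall c, affine_chart C c -> forall q, ch_dom c q ->
        exists V u, V q /\ potential_on g c V u].

(* Every local potential over a connected open set in affine coordinates
   satisfies det Hess u = constant. *)
Definition monge_ampere (R : realType) n (M : manifold R n)
    (g : vfield M -> vfield M -> Cinf M)
    (C : vfield M -> vfield M -> vfield M) : Prop :=
  forall c V u, affine_chart C c -> connected V -> potential_on g c V u ->
    exists a : R, forall q, V q -> \det (hess u (ch_to c q)) = a.

(* Main.v *)
Require Import Defs.
From HB Require Import structures.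
From mathcomp Require Import all_boot all_order all_fingroup all_algebra.
From mathcomp Require Import all_classical all_reals.
From mathcomp Require Import topology normedtype landau sequences derive realfun exp.
From mathcomp Require Import measure lebesgue_measure lebesgue_integral ftc.
From mathcomp Require Import ring lra.

(* Everything is reduced to the fields [K A]: by the normal form, every vector
   tangent to the foliation is the value of some [K A], and every [K A] restricts
   to each leaf. On such fields
     D_{KA} KB = K [KA, B],    omega (nabla^B_{KA} KB, Z) = KA omega (KB, Z) + omega ([KA, Z], KB),
   so [nabla^B] and [D] are conjugate for the metric omega (A, K B), which gives
   duality once [D] is known to be torsion-free; this is the vanishing of the
   Nijenhuis tensor of [K], read off from [d phi = d F = 0] in the normal form.
   Closedness of omega makes [nabla^B] torsion-free and flat. In affine
   coordinates the derivative of the metric is the cubic form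
   omega ([KA, W], KV) - omega (V, nabla^B_{KA} KW), which is totally symmetric,
   so the metric is a Hessian by the Poincare lemma, and trace-free, because
   phi (K A, B, C), whose square is the determinant of the metric, is parallel;
   hence that determinant is locally constant. *)

Set Implicit Arguments.
Unset Strict Implicit.
Unset Printing Implicit Defensive.
Import Order.TTheory GRing.Theory Num.Theory.
Import numFieldNormedType.Exports.
Local Open Scope classical_set_scope.
Local Open Scope ring_scope.

(** * Calculus in coordinate space *)

(** Three features of the definitions shape the work. Smoothness ([Ck]) is expressed by partial
    derivatives along the axes only, so Frechet differentiability, cut-off functions and the
    Poincare lemma have to be built first. Fields are derivations of the ring of global functions
    and tangent vectors are point derivations, so locality and the spanning of tangent spaces by
    partial derivatives need arguments; the covectors of the orbit condition supply the latter.
    Finally, [K] is known only through an identity of 5-forms involving sums over permutations: it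
    is evaluated on a basis, where the coefficients become a table of integers, and the normalizing
    constants stay symbolic. The fields [K A] are convenient because they are globally defined
    sections of [ker K], on which the specifications of [D] and [nB] apply directly. *)

Lemma line_derive (R : realType) n (f : 'rV[R]_n -> R) (z e : 'rV[R]_n) (s : R) :
  derivable f (s *: e + z) e ->
  is_derive s 1 (fun t => f (t *: e + z)) ('D_e f (s *: e + z)).
Proof.
have E : (fun h : R => h^-1 *: (((fun t => f (t *: e + z)) \o shift s) (h *: (1 : R))
             - f (s *: e + z)))
       = (fun h => h^-1 *: ((f \o shift (s *: e + z)) (h *: e) - f (s *: e + z))).
  by apply/funext => h /=; rewrite [h *: 1]mulr1 scalerDl addrA.
by move=> d; split; rewrite /derivable /derive E.
Qed.

Lemma MVT_line (R : realType) n (f : 'rV[R]_n -> R) (z e : 'rV[R]_n) (c : R) :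
  (forall s : R, `|s| <= `|c| -> derivable f (s *: e + z) e) ->
  exists2 s, `|s| <= `|c| & f (c *: e + z) - f z = 'D_e f (s *: e + z) * c.
Proof.
move=> df; have z0 : f z = f (0 *: e + z) by rewrite scale0r add0r.
have dl (s : R) : `|s| <= `|c| ->
    is_derive s 1 (fun t => f (t *: e + z)) ('D_e f (s *: e + z)).
  by move=> sc; exact/line_derive/df.
have cl (a b : R) : (forall s : R, a <= s <= b -> `|s| <= `|c|) ->
    {within `[a, b], continuous (fun t => f (t *: e + z))}.
  move=> abc; apply: derivable_within_continuous => s.
  by rewrite in_itv /= => /abc /dl [].
have [c0|c0] := leP 0 c.
  have sc (s : R) : 0 <= s <= c -> `|s| <= `|c|.
    by move=> /andP[s0 sc]; rewrite !ger0_norm.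
  have [|s sI E] := @MVT_segment R _ (fun s => 'D_e f (s *: e + z)) 0 c c0 _ (cl _ _ sc).
    by move=> s /[!in_itv] /= /andP[s0 s1]; apply/dl/sc; rewrite !ltW.
  exists s; first by apply: sc; rewrite in_itv in sI.
  by rewrite z0 E subr0.
have sc (s : R) : c <= s <= 0 -> `|s| <= `|c|.
  by move=> /andP[s0 sc]; rewrite (ltr0_norm c0) ler0_norm// lerN2.
have [|s sI E] := @MVT_segment R _ (fun s => 'D_e f (s *: e + z)) c 0 (ltW c0) _ (cl _ _ sc).
  by move=> s /[!in_itv] /= /andP[s0 s1]; apply/dl/sc; rewrite !ltW.
exists s; first by apply: sc; rewrite in_itv in sI.
by rewrite z0 -opprB E sub0r mulrN opprK.
Qed.

Lemma rowE (R : realType) n (k : 'rV[R]_n) : k = \sum_(j < n) k 0 j *: evec R j.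
Proof. by rewrite {1}[k]row_sum_delta. Qed.

Lemma coord_le_norm (R : realType) n (k : 'rV[R]_n) j : `|k 0 j| <= `|k|.
Proof.
rewrite [leRHS]/Num.Def.normr /= mx_normrE.
exact: (le_bigmax _ (fun ij : 'I_1 * 'I_n => `|k ij.1 ij.2|) (0, j)).
Qed.

Lemma norm_rV_le (R : realType) n (k : 'rV[R]_n) (r : R) : 0 <= r ->
  (forall j, `|k 0 j| <= r) -> `|k| <= r.
Proof.
move=> r0 kr; rewrite [leLHS]/Num.Def.normr /= mx_normrE.
by apply: bigmax_le => // -[i j] _ /=; rewrite ord1.
Qed.

(* [trunc m k] keeps the first [m] coordinates of [k]; the segments joining
   [trunc m k] to [trunc m.+1 k] form a path from [0] to [k] along the axes. *)
Definition trunc (R : realType) n m (k : 'rV[R]_n) : 'rV[R]_n :=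
  \row_(j < n) (if (j < m)%N then k 0 j else 0).

Lemma truncS (R : realType) n m (k : 'rV[R]_n) (mn : (m < n)%N) :
  trunc m.+1 k = k 0 (Ordinal mn) *: evec R (Ordinal mn) + trunc m k.
Proof.
apply/rowP => j; rewrite !mxE /=.
have [/eqP|jm] := eqVneq j (Ordinal mn).
  by rewrite -val_eqE /= => /eqP E; rewrite E leqnn ltnn mulr1 addr0; congr (k 0 _); apply: val_inj.
rewrite mulr0 add0r ltnS leq_eqVlt.
by move: jm; rewrite -val_eqE /= => /negPf->.
Qed.

Lemma norm_trunc_step (R : realType) n m (k : 'rV[R]_n) (mn : (m < n)%N) (s : R) :
  `|s| <= `|k 0 (Ordinal mn)| -> `|s *: evec R (Ordinal mn) + trunc m k| <= `|k|.
Proof.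
move=> sk; apply: norm_rV_le => // j; rewrite !mxE /=.
have [->/=|jm] := eqVneq j (Ordinal mn).
  by rewrite ltnn mulr1 addr0 (le_trans sk)// coord_le_norm.
rewrite mulr0 add0r; case: ifP => _; last by rewrite normr0.
exact: coord_le_norm.
Qed.

(** By the mean value theorem, each of the [n] axis steps differs from its linear part by at most
    [e * |k|]. The case [e = 0] is allowed and yields local constancy in [zero_partials_const]. *)
Lemma C1_increment (R : realType) n (f : 'rV[R]_n -> R) (x : 'rV[R]_n) (d e : R) k :
  (forall y, `|y - x| <= d -> forall j, derivable f y (evec R j) /\
     `|'D_(evec R j) f y - 'D_(evec R j) f x| <= e) ->
  `|k| <= d ->
  `|f (k + x) - f x - \sum_(j < n) k 0 j * 'D_(evec R j) f x| <= n%:R * e * `|k|.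
Proof.
move=> H kd.
suff S m : (m <= n)%N -> `|f (trunc m k + x) - f x -
    \sum_(j < n | (j < m)%N) k 0 j * 'D_(evec R j) f x| <= m%:R * e * `|k|.
  have := S n (leqnn n).
  have -> : trunc n k = k by apply/rowP => j; rewrite mxE ltn_ord.
  by under eq_bigl do rewrite ltn_ord.
elim: m => [_|m IH mn].
  rewrite big_pred0// mul0r mul0r subr0.
  have -> : trunc 0 k = 0 by apply/rowP => j; rewrite !mxE.
  by rewrite add0r subrr normr0.
rewrite truncS -[_ + trunc m k + x]addrA.
have near_x s : `|s| <= `|k 0 (Ordinal mn)| ->
    `|s *: evec R (Ordinal mn) + (trunc m k + x) - x| <= d.
  move=> sk; rewrite addrA addrK; exact: le_trans (norm_trunc_step sk) kd.
have [s /near_x/H/(_ (Ordinal mn))[_ es] E] :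
    exists2 s, `|s| <= `|k 0 (Ordinal mn)| &
    f (k 0 (Ordinal mn) *: evec R (Ordinal mn) + (trunc m k + x)) - f (trunc m k + x)
    = 'D_(evec R (Ordinal mn)) f (s *: evec R (Ordinal mn) + (trunc m k + x))
      * k 0 (Ordinal mn).
  by apply: MVT_line => s /near_x/H/(_ (Ordinal mn))[].
rewrite (bigD1 (Ordinal mn))//=.
under eq_bigl => j do rewrite ltnS -(inj_eq val_inj) /= andbC -ltn_neqAle.
set A := f (_ + (_ + _)) in E *; set S := \sum_(_ < _ | _) _ in IH *.
rewrite [X in `|X|](_ : _ = (f (trunc m k + x) - f x - S) + ((A - f (trunc m k + x))
      - k 0 (Ordinal mn) * 'D_(evec R (Ordinal mn)) f x)); last by ring.
apply: (le_trans (ler_normD _ _)).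
rewrite -natr1 !mulrDl mul1r lerD// ?IH// 1?ltnW//.
rewrite E [_ * k 0 _]mulrC -mulrBr normrM mulrC ler_pM//.
exact: coord_le_norm.
Qed.

Definition rowdot (R : realType) n (c : 'I_n -> R) (k : 'rV[R]_n) : R :=
  \sum_(j < n) k 0 j * c j.

Lemma rowdot_linear (R : realType) n (c : 'I_n -> R) : linear (rowdot c).
Proof.
move=> a u v; rewrite /rowdot /GRing.scale /= mulr_sumr -big_split /=.
by apply: eq_bigr => j _; rewrite !mxE mulrDl mulrA.
Qed.

HB.instance Definition _ (R : realType) n (c : 'I_n -> R) :=
  GRing.isLinear.Build R 'rV[R]_n R *:%R (rowdot c) (rowdot_linear c).

Lemma Ck_sum (R : realType) n k (U : set 'rV[R]_n) m (F : 'I_m -> 'rV[R]_n -> R) :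
  open U -> (forall j, Ck k U (F j)) -> Ck k U (fun x => \sum_(j < m) F j x).
Proof.
move=> oU; elim: m F => [|m IH] F CF.
  by under eq_fun do rewrite big_ord0; exact: Ck_cst.
under eq_fun do rewrite big_ord_recl.
by apply: CkD => //; exact: IH.
Qed.

Lemma rowdot_continuous (R : realType) n (c : 'I_n -> R) : continuous (rowdot c).
Proof.
move=> x; have [|c0 _] := @Ck_sum R n 0 setT n (fun j k => k 0 j * c j) openT; last exact: c0.
move=> j; apply: (@CkM R n 0 setT (fun k : 'rV[R]_n => k 0 j) (cst (c j)) openT); last exact: Ck_cst.
by split=> // y _; exact: coord_continuous.
Qed.

Lemma differentiable_increment (R : realType) (V W : normedModType R) (f : V -> W)
    (df : {linear V -> W}) x : continuous df ->
  (forall e : R, 0 < e -> \forall h \near 0, `|f (h + x) - f x - df h| <= e * `|h|) ->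
  differentiable f x.
Proof.
move=> cdf H.
have E : f \o shift x = cst (f x) + df +o_ 0 id.
  apply/eqaddoP => e e0; apply: filterS (H e e0) => h.
  by rewrite /= !fctE /cst /= opprD addrA.
have df' := diff_unique cdf E.
by apply/diff_locallyP; rewrite df'.
Qed.

(** The chain rule needs a Frechet derivative; continuity of the partial derivatives provides it
    through [C1_increment]. The hypotheses concern only the partials, so that [Ck_partials] can
    deduce continuity of [f] itself. *)
Lemma partials_differentiable (R : realType) n (U : set 'rV[R]_n) f x : open U ->
  (forall i, (forall x, U x -> derivable f x (evec R i)) /\ Ck 0 U ('D_(evec R i) f)) ->
  U x -> differentiable f x.
Proof.
move=> oU df Ux.
pose c j := 'D_(evec R j) f x.
apply: (differentiable_increment (df := rowdot c)); first exact: rowdot_continuous.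
(* This absorbs the factor [n] of [C1_increment]; [n.+1] also covers [n = 0]. *)
move=> e e0; pose e' := e / n.+1%:R.
have e'0 : 0 < e' by rewrite divr_gt0.
have N : \forall y \near x, forall j, U y /\
    `|'D_(evec R j) f y - 'D_(evec R j) f x| <= e'.
  apply: (@filter_forall 'rV[R]_n 'I_n _ _ (nbhs_filter x)) => j.
  have [_ [/(_ _ Ux)/cvgrPdist_le/(_ _ e'0) cj _]] := df j.
  near=> y; split; first by near: y; exact: open_nbhs_nbhs.
  by rewrite distrC; near: y.
have /nbhs_ballP[d /= d0 dN] := N.
apply/nbhs_ballP; exists (d / 2) => [|k]; first by rewrite /= divr_gt0.
rewrite -ball_normE /= sub0r normrN => /ltW kd.
apply: (le_trans (C1_increment (d := d / 2) (e := e') _ kd)) => [y yd j|].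
  have By : ball x d y.
    by rewrite -ball_normE /= distrC (le_lt_trans yd)// gtr_pMr// invf_lt1// ltr1n.
  have [Uy ey] := dN _ By j; split=> //.
  by have [dj _] := df j; exact: dj.
rewrite ler_wpM2r// /e' mulrCA ger_pMr// ler_pdivrMr// mul1r ler_nat.
exact: leqnSn.
Unshelve. all: by end_near. Qed.

Lemma C1_differentiable (R : realType) n (U : set 'rV[R]_n) f x :
  open U -> Ck 1 U f -> U x -> differentiable f x.
Proof. by move=> oU [_ df]; exact: (partials_differentiable oU df). Qed.

Lemma Ck_partials (R : realType) n k (U : set 'rV[R]_n) (u : 'rV[R]_n -> R)
    (h : 'I_n -> 'rV[R]_n -> R) : open U ->
  (forall x i, U x -> is_derive x (evec R i) u (h i x)) ->
  (forall i, Ck k U (h i)) -> Ck k.+1 U u.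
Proof.
move=> oU du Ch.
have Cd k' i : Ck k' U (h i) -> Ck k' U ('D_(evec R i) u).
  by apply: Ck_eq => // x Ux; have [_ ->] := du x i Ux.
have C0 k' i : Ck k' U (h i) -> Ck 0 U (h i) by elim: k' => // l IH /CkW.
have dd i x : U x -> derivable u x (evec R i) by move=> Ux; have [] := du x i Ux.
split.
  move=> x Ux; apply: differentiable_continuous.
  apply: (partials_differentiable oU _ Ux) => i; split; first exact: dd.
  exact/Cd/C0/Ch.
by move=> i; split; [exact: dd|exact/Cd/Ch].
Qed.

Lemma diff_evec (R : realType) n (f : 'rV[R]_n -> R) y w : differentiable f y ->
  'd f y w = \sum_(j < n) w 0 j * 'D_(evec R j) f y.
Proof.
move=> df; rewrite {1}[w]rowE linear_sum; apply: eq_bigr => j _ /=.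
by rewrite linearZ deriveE.
Qed.

Lemma is_derive_path (R : realType) n (f : 'rV[R]_n -> R) (g : R -> 'rV[R]_n)
    (t : R) (dg : 'I_n -> R) :
  differentiable f (g t) -> (forall j, is_derive t 1 (fun s => g s 0 j) (dg j)) ->
  is_derive t 1 (f \o g) (\sum_(j < n) dg j * 'D_(evec R j) f (g t)).
Proof.
move=> df Hg.
have dgt : derivable g t 1.
  by apply/derivable_mxP => i j; rewrite ord1; have [] := Hg j.
have dgd : differentiable g t by exact/derivable1_diffP.
apply: DeriveDef; first by apply/derivable1_diffP/differentiable_comp.
rewrite deriveE; last exact: differentiable_comp.
rewrite diff_comp //= diff_evec//; apply: eq_bigr => j _; congr (_ * _).
by rewrite -deriveE// derive_mx// mxE; have [_ <-] := Hg j.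
Qed.

Lemma is_derive_comp_rV (R : realType) m n (f : 'rV[R]_n -> R)
    (g : 'rV[R]_m -> 'rV[R]_n) x v :
  differentiable f (g x) -> (forall j, differentiable (fun y => g y 0 j) x) ->
  is_derive x v (f \o g) (\sum_(j < n) 'D_v (fun y => g y 0 j) x * 'D_(evec R j) f (g x)).
Proof.
move=> df Hg.
have dl : derivable (f \o g) x v <-> derivable (f \o (fun t : R => g (t *: v + x))) 0 1.
  exact: derivable1P.
have /= := @is_derive_path R n f (fun t : R => g (t *: v + x)) 0
  (fun j => 'D_v (fun y => g y 0 j) x).
rewrite scale0r add0r => /(_ df) [j|d <-].
  have := @line_derive R m (fun y => g y 0 j) x v 0.
  by rewrite scale0r add0r; apply; exact: diff_derivable.
split; first exact/dl.
suff E : (fun h : R => h^-1 *: (((f \o g) \o shift x) (h *: v) - (f \o g) x)) =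
    (fun h : R => h^-1 *: (((f \o (fun t : R => g (t *: v + x))) \o shift 0) (h *: (1 : R))
      - (f \o (fun t : R => g (t *: v + x))) 0)).
  by rewrite /derive E.
by apply/funext => h /=; rewrite [h *: 1]mulr1 addr0 scale0r add0r.
Qed.

Lemma continuous_rV (R : realType) m n (g : 'rV[R]_m -> 'rV[R]_n) (x : 'rV[R]_m) :
  (forall j, {for x, continuous (fun y => g y 0 j)}) -> {for x, continuous g}.
Proof.
move=> cg; apply/(@cvgrPdist_le _ _ _ _ (nbhs_filter x)) => e e0; near=> y.
apply: norm_rV_le => [|j]; first exact: ltW.
rewrite !mxE; move: j; near: y; apply: filter_forall => j.
by move: (cg j) => /cvgrPdist_le/(_ _ e0).
Unshelve. all: by end_near. Qed.


Lemma Ck_comp (R : realType) m n k (V : set 'rV[R]_m) (U : set 'rV[R]_n)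
    (f : 'rV[R]_n -> R) (g : 'rV[R]_m -> 'rV[R]_n) :
  open V -> open U -> (forall x, V x -> U (g x)) ->
  (forall j, Ck k V (fun x => g x 0 j)) -> Ck k U f -> Ck k V (f \o g).
Proof.
move=> oV oU gU.
have cg : forall k', (forall j, Ck k' V (fun x => g x 0 j)) ->
    forall x, V x -> {for x, continuous g}.
  by move=> k' Cg x Vx; apply: continuous_rV => j; exact: (Ck_continuous (Cg j) Vx).
elim: k f => [|k IH] f Cg Cf.
  split=> // x Vx; apply: continuous_comp; first exact: (cg _ Cg).
  by apply: (Ck_continuous Cf); exact: gU.
have W1 h : Ck k.+1 V h -> Ck 1 V h.
  by elim: (k) => // l IHl /CkW.
have W1' h : Ck k.+1 U h -> Ck 1 U h.
  by elim: (k) => // l IHl /CkW.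
have D x v : V x -> is_derive x v (f \o g)
    (\sum_(j < n) 'D_v (fun y => g y 0 j) x * 'D_(evec R j) f (g x)).
  move=> Vx; apply: is_derive_comp_rV => [|j].
    by apply: (C1_differentiable oU (W1' _ Cf)); exact: gU.
  exact: (C1_differentiable oV (W1 _ (Cg j))).
split.
  move=> x Vx; apply: continuous_comp; first exact: (cg _ Cg).
  by apply: (Ck_continuous Cf); exact: gU.
move=> i; split; first by move=> x Vx; have [] := D x (evec R i) Vx.
apply: (Ck_eq oV (f := fun x => \sum_(j < n) 'D_(evec R i) (fun y => g y 0 j) x
                     * 'D_(evec R j) f (g x))).
  by move=> x Vx; have [_ ->] := D x (evec R i) Vx.
apply: Ck_sum => // j; apply: CkM => //.
  by have [_ /(_ i)[]] := Cg j.
apply: (IH ('D_(evec R j) f)); first by move=> l; exact: CkW.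
by have [_ /(_ j)[]] := Cf.
Qed.

Lemma Ck_sub (R : realType) n k (U V : set 'rV[R]_n) f :
  V `<=` U -> Ck k U f -> Ck k V f.
Proof.
move=> VU; elim: k f => [|k IH] f [cf df].
  by split=> // x /VU; exact: cf.
split; first by move=> x /VU; exact: cf.
by move=> i; have [di Ci] := df i; split; [move=> x /VU; exact: di|exact: IH].
Qed.

Lemma Ck_local (R : realType) n k (U : set 'rV[R]_n) f :
  (forall x, U x -> exists2 V, V x & Ck k V f) -> Ck k U f.
Proof.
elim: k f => [|k IH] f H.
  by split=> // x Ux; have [V Vx [cf _]] := H x Ux; exact: cf.
split; first by move=> x Ux; have [V Vx [cf _]] := H x Ux; exact: cf.
move=> i; split.
  by move=> x Ux; have [V Vx [_ /(_ i)[di _]]] := H x Ux; exact: di.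
by apply: IH => x Ux; have [V Vx [_ /(_ i)[_ Ci]]] := H x Ux; exists V.
Qed.

Lemma Ck_inv (R : realType) n k (U : set 'rV[R]_n) (f : _ -> R) :
  open U -> (forall x, U x -> f x != 0) -> Ck k U f -> Ck k U (fun x => (f x)^-1).
Proof.
move=> oU f0; elim: k => [|k IH] Cf.
  by split=> // x Ux; apply: (@continuousV R 'rV[R]_n f x (f0 x Ux)); exact: (Ck_continuous Cf Ux).
split.
  by move=> x Ux; apply: (@continuousV R 'rV[R]_n f x (f0 x Ux)); exact: (Ck_continuous Cf Ux).
move=> i; have [_ /(_ i)[di Ci]] := Cf; split.
  by move=> x Ux; apply: derivableV; [exact: f0|exact: di].
apply: (Ck_eq oU (f := cst (-1) * ('D_(evec R i) f *
    ((fun x => (f x)^-1) * (fun x => (f x)^-1))))).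
  move=> x Ux; rewrite !fctE deriveV//; [|exact: f0|exact: di].
  by rewrite /= /cst /= /GRing.scale /= -invfM -expr2 mulN1r mulNr mulrC.
by do ?[apply: CkM => //]; [exact: Ck_cst|exact/IH/CkW..].
Qed.

Lemma is_derive_coord (R : realType) n (x v : 'rV[R]_n) i :
  is_derive x v (fun y : 'rV[R]_n => y 0 i) (v 0 i).
Proof.
pose c (j : 'I_n) : R := (j == i)%:R.
have E (y : 'rV[R]_n) : y 0 i = rowdot c y.
  rewrite /rowdot (bigD1 i)//= /c eqxx mulr1 big1 ?addr0//.
  by move=> j /negPf->; rewrite mulr0.
have -> : (fun y : 'rV[R]_n => y 0 i) = rowdot c by apply/funext.
have dc : differentiable (rowdot c) x by apply/linear_differentiable/rowdot_continuous.
apply: DeriveDef; first exact: diff_derivable.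
by rewrite deriveE// E diff_lin//; exact: rowdot_continuous.
Qed.

Lemma Ck_coord (R : realType) n k (U : set 'rV[R]_n) i : Ck k U (fun x => x 0 i).
Proof.
case: k => [|k]; split=> //; try by move=> x _; exact: coord_continuous.
move=> j; split; first by move=> x _; have [] := is_derive_coord x (evec R j) i.
have -> : 'D_(evec R j) (fun x : 'rV_n => x 0 i) = cst (evec R j 0 i).
  by apply/funext => x; have [_ ->] := is_derive_coord x (evec R j) i.
exact: Ck_cst.
Qed.

(** With [e = 0], [C1_increment] makes [f] locally constant. The level set through [x0] and its
    complement in [U] are then both open, and connectedness decides. *)
Lemma zero_partials_const (R : realType) n (U : set 'rV[R]_n) f :
  open U -> connected U ->
  (forall x, U x -> forall j, derivable f x (evec R j) /\ 'D_(evec R j) f x = 0 :> R) ->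
  forall x y, U x -> U y -> f x = f y.
Proof.
move=> oU cU df x0 y0 Ux0 Uy0.
have loc x : U x -> \forall y \near x, U y /\ f y = f x.
  move=> Ux; have /nbhs_ballP[d /= d0 dU] := open_nbhs_nbhs (conj oU Ux).
  apply/nbhs_ballP; exists (d / 2); first by rewrite /= divr_gt0.
  move=> y; rewrite -ball_normE /= => yd; split.
    by apply: dU; rewrite -ball_normE /= (lt_trans yd)// gtr_pMr// invf_lt1// ltr1n.
  have := @C1_increment R n f x (d / 2) 0 (y - x) _ _.
  rewrite mulr0 mul0r normr_le0 subrK => H.
  have -> : f y = f y - f x - \sum_(j < n) (y - x) 0 j * 'D_(evec R j) f x + f x.
    rewrite big1 ?subr0 ?subrK// => j _.
    by have [_ ->] := df x Ux j; rewrite mulr0.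
  rewrite (eqP (H _ _)) ?add0r// => [z zd j|]; last by rewrite distrC ltW.
  have Uz : U z.
    by apply: dU; rewrite -ball_normE /= distrC (le_lt_trans zd)// gtr_pMr// invf_lt1// ltr1n.
  by have [? ->] := df z Uz j; have [_ ->] := df x Ux j; rewrite subrr normr0.
pose B := U `&` [set y | f y = f x0].
have oB : open B.
  rewrite openE => y [Uy fy]; rewrite /interior.
  by apply: filterS (loc y Uy) => z [Uz fz]; split=> //=; rewrite fz.
have oC : open (U `&` [set y | f y != f x0]).
  rewrite openE => y [Uy fy]; rewrite /interior.
  by apply: filterS (loc y Uy) => z [Uz fz]; split=> //=; rewrite fz.
have BU : B = U.
  apply: cU; first by exists x0.
    by exists B => //; rewrite /B setIA setIid.
  exists (~` (U `&` [set y | f y != f x0])); first exact: open_closedC.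
  rewrite eqEsubset; split=> y [Uy fy]; split=> //.
    by move=> [_ /=]; rewrite fy eqxx.
  by apply/eqP; apply: contrapT => /negP ne; exact: fy.
by have [_ ->] : B y0 by rewrite BU.
Qed.

(** * Flat functions and bumps *)

(** The polynomial parameter makes the family closed under differentiation ([is_derive_flat]), so
    smoothness is a single induction on the order. *)
Definition flat_fun (R : realType) (P : {poly R}) (t : R) : R :=
  if 0 < t then P.[t^-1] * expR (- t^-1) else 0.

(** [expR s] is the [m.+1]-st power of [expR (s / m.+1)]: [m] factors are at least [s / m.+1], and
    the spare one is at least [1]. *)
Lemma expR_ge_pow (R : realType) (m : nat) (s : R) : 0 <= s ->
  s ^+ m / m.+1%:R ^+ m <= expR s.
Proof.
move=> s0.
have E : expR s = expR (s / m.+1%:R) ^+ m.+1.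
  by rewrite -expRM_natl mulrC divfK// pnatr_eq0.
have h1 : 1 <= expR (s / m.+1%:R).
  by rewrite -[leLHS]expR0 ler_expR divr_ge0.
rewrite E -expr_div_n exprS -[leLHS]mul1r ler_pM// ?exprn_ge0// ?divr_ge0//.
rewrite lerXn2r ?nnegrE ?divr_ge0 ?expR_ge0//.
by apply: le_trans (expR_ge1Dx _); rewrite lerDr.
Qed.

Lemma flat_pow_le (R : realType) m (t : R) :
  `|flat_fun 'X^m t| <= m.+2%:R ^+ m.+1 * `|t|.
Proof.
rewrite /flat_fun; case: ifPn => [t0|_]; last by rewrite normr0 mulr_ge0// exprn_ge0.
have s0 : 0 < t^-1 by rewrite invr_gt0.
rewrite hornerXn gtr0_norm ?mulr_gt0 ?exprn_gt0 ?expR_gt0// gtr0_norm//.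
have := @expR_ge_pow R m.+1 t^-1 (ltW s0).
rewrite ler_pdivrMr ?exprn_gt0// => H.
rewrite expRN ler_pdivrMr ?expR_gt0//.
by rewrite -(ler_pM2r s0) -exprSr mulrAC mulfK ?gt_eqF// (le_trans H)// mulrC.
Qed.

Lemma flat_sum (R : realType) (P : {poly R}) (t : R) :
  flat_fun P t = \sum_(i < size P) P`_i * flat_fun 'X^i t.
Proof.
rewrite /flat_fun; case: ifP => _; last by rewrite big1// => i _; rewrite mulr0.
by rewrite horner_coef big_distrl /=; apply: eq_bigr => i _; rewrite hornerXn mulrA.
Qed.

Lemma flat_le (R : realType) (P : {poly R}) :
  exists2 C : R, 0 <= C & forall t, `|flat_fun P t| <= C * `|t|.
Proof.
exists (\sum_(i < size P) `|P`_i| * i.+2%:R ^+ i.+1).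
  by apply: sumr_ge0 => i _; rewrite mulr_ge0// exprn_ge0.
move=> t; rewrite flat_sum big_distrl /=; apply: (le_trans (ler_norm_sum _ _ _)).
by apply: ler_sum => i _; rewrite normrM -mulrA ler_wpM2l// flat_pow_le.
Qed.

Lemma is_derive_flat (R : realType) (P : {poly R}) (t : R) :
  is_derive t 1 (flat_fun P) (flat_fun ('X^2 * (P - P^`())) t).
Proof.
have [t0|t0|->] := ltgtP t 0.
- rewrite {2}/flat_fun ltNge (ltW t0) /=.
  apply: (near_eq_is_derive (f := cst 0)).
    near=> s; rewrite /flat_fun ltNge.
    have -> // : s <= 0 by apply/ltW; near: s; exact: lt_nbhsl.
- pose g := (fun s : R => P.[s^-1] * expR (- s^-1)).
  rewrite {2}/flat_fun t0.
  apply: (near_eq_is_derive (f := g)).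
    near=> s; rewrite /flat_fun.
    by have -> // : 0 < s by near: s; exact: lt_nbhsr.
  have dV : is_derive t 1 (fun s : R => s^-1) (- t^-1 ^+ 2).
    have := @is_deriveV R id t 1 1 (lt0r_neq0 t0) _.
    by rewrite /= scaler1 exprVn; apply; exact: is_derive_id.
  have dP : is_derive t 1 (fun s : R => P.[s^-1]) (P^`().[t^-1] * - t^-1 ^+ 2).
    have := @is_derive1_comp R (horner P) (fun s : R => s^-1) t P^`().[t^-1] (- t^-1 ^+ 2) _ dV.
    by apply; exact: is_derive_poly.
  have dE : is_derive t 1 (fun s : R => expR (- s^-1)) (expR (- t^-1) * t^-1 ^+ 2).
    have := @is_derive1_comp R expR (fun s : R => - s^-1) t (expR (- t^-1)) (t^-1 ^+ 2) _ _.
    apply; have := @is_deriveN R R R (fun s : R => s^-1) t 1 _ dV.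
    by rewrite opprK.
  have := @is_deriveM R R (fun s : R => P.[s^-1]) (fun s : R => expR (- s^-1)) t 1 _ _ dP dE.
  move=> H; apply: (is_derive_eq H).
  rewrite /GRing.scale /= !hornerE /=; ring.
(* At [0] the difference quotient of [flat_fun P] is [flat_fun ('X * P)], which is bounded by a
   multiple of [|h|]. *)
- have [C C0 HC] := flat_le ('X * P).
  have E0 Q : flat_fun Q (0 : R) = 0 by rewrite /flat_fun ltxx.
  rewrite E0.
  have H : (fun h => h^-1 *: ((flat_fun P \o shift 0) (h *: (1 : R)) - flat_fun P 0)) @ 0^' --> (0 : R).
    apply/cvgr0Pnorm_le => e e0; near=> h.
    rewrite /= E0 subr0 addr0 [h *: 1]mulr1 /GRing.scale /=.
    have -> : h^-1 * flat_fun P h = flat_fun ('X * P) h.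
      rewrite /flat_fun; case: ifP => _; last by rewrite mulr0.
      by rewrite hornerM hornerX mulrA.
    apply: (le_trans (HC _)).
    have hh : `|h| <= e / (C + 1).
      by near: h; apply: dnbhs0_le; rewrite divr_gt0// ltr_wpDl.
    apply: (le_trans (ler_wpM2l C0 hh)).
    rewrite mulrCA ger_pMr// ler_pdivrMr ?ltr_wpDl// mul1r lerDl//.
  by split; [apply/cvg_ex; exists 0|exact/cvg_lim].
Unshelve. all: by end_near. Qed.

Lemma Ck_flat_comp (R : realType) n k (U : set 'rV[R]_n) f (P : {poly R}) :
  open U -> Ck k U f -> Ck k U (flat_fun P \o f).
Proof.
move=> oU; elim: k P => [|k IH] P Cf.
  split=> // x Ux; apply: continuous_comp; first exact: (Ck_continuous Cf).
  have [d _] := is_derive_flat P (f x).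
  exact/differentiable_continuous/derivable1_diffP.
have W1 : Ck 1 U f by elim: (k) Cf => // l IHl /CkW.
have D x v : U x -> is_derive x v (flat_fun P \o f)
    ('D_v f x * flat_fun ('X^2 * (P - P^`())) (f x)).
  move=> Ux; have df := C1_differentiable oU W1 Ux.
  have [d dE] := is_derive_flat P (f x).
  have dd : differentiable (flat_fun P) (f x) by exact/derivable1_diffP.
  apply: DeriveDef; first by apply: diff_derivable; exact: differentiable_comp.
  rewrite deriveE; last exact: differentiable_comp.
  by rewrite diff_comp//= diff1E//= derive1E dE deriveE.
split.
  move=> x Ux; apply: continuous_comp; first exact: (Ck_continuous Cf).
  have [d _] := is_derive_flat P (f x).
  exact/differentiable_continuous/derivable1_diffP.
move=> i; split; first by move=> x Ux; have [] := D x (evec R i) Ux.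
apply: (Ck_eq oU (f := 'D_(evec R i) f * (flat_fun ('X^2 * (P - P^`())) \o f))).
  by move=> x Ux; have [_ ->] := D x (evec R i) Ux.
apply: CkM => //; first by have [_ /(_ i)[]] := Cf.
by apply: IH; exact: CkW.
Qed.

Lemma flat1_gt0 (R : realType) (t : R) : 0 < t -> 0 < flat_fun 1 t.
Proof. by move=> t0; rewrite /flat_fun t0 hornerE mul1r expR_gt0. Qed.

Lemma flat1_ge0 (R : realType) (t : R) : 0 <= flat_fun 1 t.
Proof. by rewrite /flat_fun; case: ifP => // _; rewrite hornerE mul1r expR_ge0. Qed.

Lemma flat_le0 (R : realType) (t : R) P : t <= 0 -> flat_fun P t = 0.
Proof. by move=> t0; rewrite /flat_fun ltNge t0. Qed.

(** Equal to [1] for [t <= 1/4] and to [0] for [t >= 1]. It is applied to squares of rescaled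
    coordinates, so [1/4] corresponds to half the radius. *)
Definition plateau (R : realType) (t : R) : R :=
  flat_fun 1 (1 - t) / (flat_fun 1 (1 - t) + flat_fun 1 (t - 4^-1)).

Lemma plateau_den (R : realType) (t : R) :
  0 < flat_fun 1 (1 - t) + flat_fun 1 (t - 4^-1).
Proof.
have [t1|t1] := ltP t 1.
  by rewrite ltr_pwDl ?flat1_ge0// flat1_gt0// subr_gt0.
by rewrite ltr_wpDl ?flat1_ge0// flat1_gt0// subr_gt0 (lt_le_trans _ t1)// invf_lt1// ltr1n.
Qed.

Lemma Ck_prod (R : realType) n k (U : set 'rV[R]_n) m (F : 'I_m -> 'rV[R]_n -> R) :
  open U -> (forall j, Ck k U (F j)) -> Ck k U (fun x => \prod_(j < m) F j x).
Proof.
move=> oU; elim: m F => [|m IH] F CF.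
  by under eq_fun do rewrite big_ord0; exact: Ck_cst.
under eq_fun do rewrite big_ord_recl.
by apply: CkM => //; exact: IH.
Qed.

(** The norm is the maximum of the coordinates, so a product of one-variable plateaus suffices; the
    squares avoid the non-smooth absolute value. *)
Lemma bump_rV (R : realType) n (a : 'rV[R]_n) (e : R) : 0 < e ->
  exists b : 'rV[R]_n -> R, [/\ forall k, Ck k setT b,
    forall x, `|x - a| <= e / 2 -> b x = 1 & forall x, e <= `|x - a| -> b x = 0].
Proof.
move=> e0; pose q i (x : 'rV[R]_n) := (e^-1 * (x 0 i - a 0 i)) ^+ 2.
exists (fun x => \prod_(i < n) plateau (q i x)); split.
- move=> k; apply: Ck_prod; first exact: openT.
  move=> i.
  have Cq : Ck k setT (q i).
    have C1 : Ck k setT (fun x : 'rV[R]_n => e^-1 * (x 0 i - a 0 i)).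
      apply: (@CkM R n k setT (cst e^-1) (fun x => x 0 i - a 0 i) openT); first exact: Ck_cst.
      apply: (@CkD R n k setT (fun x => x 0 i) (cst (- a 0 i)) openT); first exact: Ck_coord.
      exact: Ck_cst.
    exact: (CkM openT C1 C1).
  have Cf1 : Ck k setT (fun x => flat_fun 1 (1 - q i x)).
    apply: (@Ck_flat_comp R n k setT (fun x => 1 - q i x) 1 openT).
    apply: (@Ck_eq R n k setT (cst 1 + cst (-1) * q i) _ openT).
      by move=> x _; rewrite !fctE /= /cst mulN1r.
    by apply: CkD; [exact: openT|exact: Ck_cst|apply: CkM => //; [exact: openT|exact: Ck_cst]].
  have Cf2 : Ck k setT (fun x => flat_fun 1 (q i x - 4^-1)).
    apply: (@Ck_flat_comp R n k setT (fun x => q i x - 4^-1) 1 openT).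
    by apply: (@CkD R n k setT (q i) (cst (- 4^-1)) openT) => //; exact: Ck_cst.
  apply: (CkM openT Cf1); apply: (Ck_inv openT); last exact: (CkD openT Cf1 Cf2).
  by move=> x _; rewrite gt_eqF// plateau_den.
- move=> x xa; apply: big1 => i _.
  have qi : q i x <= 4^-1.
    have -> : 4^-1 = (2^-1) ^+ 2 :> R by rewrite exprVn -natrX.
    rewrite -[q i x]/((_) ^+ 2) -real_normK ?num_real// lerXn2r ?nnegrE ?invr_ge0//.
    rewrite normrM gtr0_norm ?invr_gt0// ler_pdivrMl// (le_trans _ xa)//.
    by have := coord_le_norm (x - a) i; rewrite !mxE.
  rewrite /plateau [flat_fun _ (q i x - _)]flat_le0 ?subr_le0// addr0 divff//.
  by rewrite gt_eqF// flat1_gt0// subr_gt0 (le_lt_trans qi)// invf_lt1// ltr1n.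
- move=> x xa.
  have [i xi] : exists i, e <= `|x 0 i - a 0 i|.
    apply: contrapT => /forallNP H.
    have : `|x - a| < e.
      rewrite [ltLHS]/Num.Def.normr /= mx_normrE.
      apply: bigmax_lt => // -[i j] _ /=; rewrite ord1 !mxE.
      by have /negP := H j; rewrite -ltNge.
    by rewrite ltNge xa.
  rewrite (bigD1 i)//= /plateau flat_le0 ?mul0r// subr_le0 /q.
  rewrite -real_normK ?num_real// exprn_ege1//.
  by rewrite normrM gtr0_norm ?invr_gt0// ler_pdivlMl// mulr1.
Qed.

(** * The Poincare lemma on a ball *)

Lemma ball_seg (R : realType) n (a x : 'rV[R]_n) (t r : R) : 0 <= t <= 1 ->
  `|x - a| <= r -> `|a + t *: (x - a) - a| <= r.
Proof.
move=> /andP[t0 t1] xr; rewrite addrAC subrr add0r normrZ ger0_norm//.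
by apply: le_trans xr; rewrite ler_piMl.
Qed.

Lemma continuous_dist (R : realType) n (a : 'rV[R]_n) :
  continuous (fun x : 'rV[R]_n => `|x - a|).
Proof.
move=> x; apply: (@cvg_norm _ _ _ _ (nbhs_filter x) (fun x => x - a)).
by apply: (@cvgB _ _ _ _ (nbhs_filter x)); [exact: cvg_id|exact: cvg_cst].
Qed.

Lemma open_norm_ball (R : realType) n (a : 'rV[R]_n) (r : R) :
  open [set x : 'rV[R]_n | `|x - a| < r].
Proof.
have -> : [set x : 'rV[R]_n | `|x - a| < r] = (fun x : 'rV[R]_n => `|x - a|) @^-1` [set y | y < r] by [].
by apply: open_comp; [move=> x _; exact: continuous_dist|exact: open_lt].
Qed.

Lemma closed_ball_rV_compact (R : realType) n (a : 'rV[R]_n) (r : R) :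
  compact [set x | `|x - a| <= r].
Proof.
apply: bounded_closed_compact.
  exists (r + `|a|); split; first exact: num_real.
  move=> M HM x /= xr; rewrite (le_trans _ (ltW HM))// -[x in `|x|](subrK a).
  by rewrite (le_trans (ler_normD _ _))// lerD2r.
have -> : [set x : 'rV[R]_n | `|x - a| <= r] = (fun x : 'rV[R]_n => `|x - a|) @^-1` [set y | y <= r] by [].
by apply: closed_comp; [move=> x _; exact: continuous_dist|exact: closed_le].
Qed.

Lemma bounded_on_ball (R : realType) n (a : 'rV[R]_n) (r : R) (f : 'rV[R]_n -> R) :
  (forall x, `|x - a| <= r -> {for x, continuous f}) ->
  exists2 C, 0 <= C & forall x, `|x - a| <= r -> `|f x| <= C.
Proof.
move=> cf; have cK := @closed_ball_rV_compact R n a r.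
have : compact (f @` [set x | `|x - a| <= r]).
  apply: continuous_compact => //; apply: continuous_in_subspaceT => x.
  by rewrite inE; exact: cf.
move=> /compact_bounded[M [_ HM]]; exists (`|M| + 1); first by rewrite addr_ge0.
move=> x xr; apply: (HM (`|M| + 1)) => //=; last by exists x.
by rewrite (le_lt_trans (ler_norm M))// ltrDl.
Qed.

Local Notation mu := lebesgue_measure.

(** The potential is the integral of the 1-form [h] along the segment from [a] to [x]. After
    differentiation under the integral, symmetry turns the integrand into the [t]-derivative of
    [t * h i (a + t *: (x - a))], which integrates to [h i x]. *)
Lemma poincare_ball (R : realType) n (a : 'rV[R]_n) (r : R)
    (h : 'I_n -> 'rV[R]_n -> R) :
  let B := [set x : 'rV[R]_n | `|x - a| < r] in
  (forall j, Ck 1 B (h j)) ->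
  (forall x i j, B x -> 'D_(evec R i) (h j) x = 'D_(evec R j) (h i) x) ->
  exists u, forall x, B x -> forall i, is_derive x (evec R i) u (h i x).
Proof.
move=> B Ch sym.
have oB : open B by exact: open_norm_ball.
pose F (x : 'rV[R]_n) (t : R) := \sum_(j < n) (x - a) 0 j * h j (a + t *: (x - a)).
exists (fun x => \int[mu]_(t in `[0, 1]) F x t) => x Bx i.
pose e := evec R i.
(* Moving [x] by less than [r'] along [e] keeps it, and its segment to [a], in the closed ball whose
   radius [rho] is halfway between [|x - a|] and [r]. Compactness of that ball gives the dominating
   constant. *)
have [r' [r'0 xr' r'r]] : exists r' : R, [/\ 0 < r', `|x - a| + r' <= (r + `|x-a|)/2 &
    (r + `|x-a|)/2 < r].
  by exists ((r - `|x - a|) / 2); split; move: Bx; rewrite /B /=; lra.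
pose rho := (r + `|x - a|) / 2.
pose X (s : R) := s *: e + x.
have Xrho (s : R) : `|s| < r' -> `|X s - a| <= rho.
  move=> sr; rewrite /X -addrA (le_trans (ler_normD _ _))// (le_trans _ xr')//.
  rewrite [leLHS]addrC lerD2l normrZ (le_trans _ (ltW sr))// ler_piMr//.
  apply: norm_rV_le => // j; rewrite mxE eqxx /=.
  by case: (_ == _); rewrite ?normr1 ?normr0.
have rhoB y : `|y - a| <= rho -> B y by move=> yr; exact: le_lt_trans r'r.
have Xt (s t : R) : `|s| < r' -> 0 <= t <= 1 -> `|a + t *: (X s - a) - a| <= rho.
  by move=> sr t01; apply: ball_seg => //; exact: Xrho.
have dh j y : B y -> differentiable (h j) y by move=> By; exact: (C1_differentiable oB (Ch j)).
have inI (s : R) : `]- r', r'[%classic s -> `|s| < r' by rewrite /= in_itv /= ltr_norml.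
(* The derivative of the integrand, already rewritten by symmetry: ['D_(evec R j) (h i)] stands
   where the product rule produces ['D_(evec R i) (h j)]. *)
pose G (y : 'rV[R]_n) (t : R) (z : 'rV[R]_n) := h i y + \sum_(j < n) t * (z - a) 0 j * 'D_(evec R j) (h i) y.
have gpath (y w : 'rV[R]_n) (s : R) j : is_derive s 1 (fun s : R => (y + s *: w) 0 j) (w 0 j).
  have -> : (fun s : R => (y + s *: w) 0 j) = cst (y 0 j) + (fun s => s * w 0 j).
    by apply/funext => z; rewrite !mxE.
  rewrite -[X in is_derive _ _ _ X]add0r; apply: is_deriveD.
  have -> : (fun s : R => s * w 0 j) = (fun s : R => s *: w 0 j) by [].
  apply: DeriveDef; first by apply/derivable1_diffP.
  by rewrite deriveE// diff_val /= scale1r.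
have dF (s t : R) : `|s| < r' -> 0 <= t <= 1 ->
    is_derive s 1 (fun s => F (X s) t) (G (a + t *: (X s - a)) t (X s)).
  move=> sr t01; have By := rhoB _ (Xt _ _ sr t01).
  set y := a + _ in By *.
  have path j : is_derive s 1 (fun s : R => (a + t *: (X s - a)) 0 j) (t * e 0 j).
    have -> : (fun s : R => (a + t *: (X s - a)) 0 j) =
        (fun s : R => ((a + t *: (x - a)) + s *: (t *: e)) 0 j).
      by apply/funext => z; rewrite /X !mxE; ring.
    by have := gpath (a + t *: (x - a)) (t *: e) s j; rewrite [X in is_derive _ _ _ X]mxE.
  have dhj j : is_derive s 1 (fun s : R => h j (a + t *: (X s - a)))
      (t * 'D_e (h j) y).
    have := is_derive_path (g := fun s : R => a + t *: (X s - a)) (dh j y By) path.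
    move=> H; apply: (is_derive_eq H).
    rewrite (bigD1 i)//= big1 => [|l li]; last by rewrite !mxE (negPf li) mulr0 mul0r.
    by rewrite addr0 mxE !eqxx mulr1.
  have dx j : is_derive s 1 (fun s : R => (X s - a) 0 j) (e 0 j).
    have -> : (fun s : R => (X s - a) 0 j) = (fun s : R => ((x - a) + s *: e) 0 j).
      by apply/funext => z; rewrite /X !mxE; ring.
    exact: gpath.
  have dj j : is_derive s 1 (fun s : R => (X s - a) 0 j * h j (a + t *: (X s - a)))
     ((X s - a) 0 j * (t * 'D_e (h j) y) + h j y * e 0 j).
    exact: (@is_deriveM R R _ _ s 1 _ _ (dx j) (dhj j)).
  have -> : (fun s => F (X s) t) = \sum_(j < n) (fun s : R => (X s - a) 0 j * h j (a + t *: (X s - a))).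
    by apply/funext => z; rewrite /F fct_sumE.
  apply: (is_derive_eq (is_derive_sum dj)).
  rewrite big_split /= addrC /G; congr (_ + _).
    rewrite (bigD1 i)//= big1 => [|l li]; last by rewrite !mxE (negPf li) mulr0.
    by rewrite addr0 !mxE !eqxx mulr1.
  by apply: eq_bigr => j _; rewrite (sym _ _ _ By); ring.
have cseg z (f : 'rV[R]_n -> R) : (forall y, B y -> {for y, continuous f}) -> `|z - a| <= rho ->
    {within `[0, 1], continuous (fun t : R => f (a + t *: (z - a)))}.
  move=> cf zr; apply: continuous_in_subspaceT => t; rewrite inE /= in_itv /= => t01.
  apply: (@continuous_comp _ _ _ (fun t : R => a + t *: (z - a)) f).
    by apply: cvgD; [exact: cvg_cst|apply: cvgZr_tmp; exact: cvg_id].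
  exact/cf/rhoB/ball_seg.
have ch j y : B y -> {for y, continuous (h j)} by exact: Ck_continuous.
have cdh j l y : B y -> {for y, continuous ('D_(evec R l) (h j))}.
  by move=> By; have [_ /(_ l)[_ [c _]]] := Ch j; exact: c.
have cF z : `|z - a| <= rho -> {within `[0, 1], continuous (F z)}.
  move=> zr; pose Phi y := \sum_(j < n) (z - a) 0 j * h j y.
  suff cP : Ck 0 B Phi by apply: (cseg z Phi) => // y By; exact: (Ck_continuous cP).
  apply: Ck_sum => // j; apply: (@CkM R n 0 B (cst _) (h j)) => //; first exact: Ck_cst.
  exact: CkW.
have cG : {within `[0, 1], continuous (fun t => G (a + t *: (x - a)) t x)}.
  pose Psi y := \sum_(j < n) (x - a) 0 j * 'D_(evec R j) (h i) y.
  have cP : Ck 0 B Psi.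
    apply: Ck_sum => // j; apply: (@CkM R n 0 B (cst _) ('D_(evec R j) (h i))) => //.
      exact: Ck_cst.
    by have [_ /(_ j)[]] := Ch i.
  have xrho : `|x - a| <= rho by move: Bx; rewrite /rho /B /=; lra.
  have c1 := cseg x (h i) (ch i) xrho.
  have c2 := cseg x Psi (fun y By => Ck_continuous cP By) xrho.
  have -> : (fun t => G (a + t *: (x - a)) t x) =
      (fun t : R => h i (a + t *: (x - a))) + (fun t => t) * (fun t => Psi (a + t *: (x - a))).
    apply/funext => t; rewrite !fctE /G /Psi mulr_sumr; congr (_ + _).
    by apply: eq_bigr => j _; rewrite mulrA.
  move=> t; apply: continuousD; first exact: c1.
  apply: continuousM; last exact: c2.
  by apply: continuous_subspaceT => ?; exact: cvg_id.
have mI : measurable (`[0, 1]%classic : set (measurableTypeR R)) by exact: measurable_itv.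
have [C C0 HC] : exists2 C, 0 <= C & forall s t : R, `|s| < r' -> 0 <= t <= 1 ->
    `|G (a + t *: (X s - a)) t (X s)| <= C.
  have [C1 C10 H1] : exists2 C, 0 <= C & forall y, `|y - a| <= rho -> `|h i y| <= C.
    by apply: bounded_on_ball => y /rhoB; exact: ch.
  have /choice[C2 H2] : forall j, exists C, 0 <= C /\
      forall y, `|y - a| <= rho -> `|'D_(evec R j) (h i) y| <= C.
    move=> j; have [|C C0 H] := @bounded_on_ball R n a rho ('D_(evec R j) (h i)).
      by move=> y /rhoB; exact: cdh.
    by exists C.
  exists (C1 + \sum_(j < n) rho * C2 j).
    rewrite addr_ge0// sumr_ge0// => j _; rewrite mulr_ge0//; last by have [] := H2 j.
    by rewrite (le_trans _ (Xrho 0 _))// ?normr0.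
  move=> s t sr t01; have yr := Xt s t sr t01.
  apply: (le_trans (ler_normD _ _)); apply: lerD; first exact: H1.
  apply: (le_trans (ler_norm_sum _ _ _)); apply: ler_sum => j _.
  rewrite normrM ler_pM//; last by have [_] := H2 j; exact.
  rewrite normrM -[leRHS]mul1r ler_pM//.
    by case/andP: t01 => t0 t1; rewrite ger0_norm.
  exact: le_trans (coord_le_norm _ _) (Xrho _ sr).
pose f s t := F (X s) t.
have Ia : `]- r', r'[%classic (0 : R) by rewrite /= in_itv /= oppr_lt0 r'0.
have intf (s : R) : `]- r', r'[%classic s -> (@lebesgue_measure R).-integrable `[0, 1]%classic (EFin \o f s).
  move=> /inI sr; apply: continuous_compact_integrable; first exact: segment_compact.
  exact/cF/Xrho.
have df1 (s t : R) : `]- r', r'[%classic s -> `[0, 1]%classic t -> derivable (f ^~ t) s 1.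
  by move=> /inI sr /=; rewrite in_itv /= => t01; have [] := dF s t sr t01.
have intC : (@lebesgue_measure R).-integrable `[0, 1]%classic (EFin \o cst C).
  apply: continuous_compact_integrable; first exact: segment_compact.
  by apply: continuous_subspaceT => ?; exact: cvg_cst.
have ub (s t : R) : `]- r', r'[%classic s -> `[0, 1]%classic t -> `|partial1of2 f s t| <= C.
  move=> /inI sr /=; rewrite in_itv /= => t01; rewrite partial1of2E.
  by have [_ ->] := dF s t sr t01; exact: HC.
have dU := @derivable_under_integral R _ _ (@lebesgue_measure R) f _ mI 0 (- r') r' Ia intf df1 (cst C) (fun=> C0) intC ub.
have vU := @differentiation_under_integral R _ _ (@lebesgue_measure R) f _ mI 0 (- r') r' Ia intf df1 (cst C) (fun=> C0) intC ub.
have E0 : X 0 = x by rewrite /X scale0r add0r.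
have valI : \int[mu]_(t in `[0, 1]) (partial1of2 f ^~ t) 0 = h i x.
  have -> : \int[mu]_(t in `[0, 1]) (partial1of2 f ^~ t) 0 =
      \int[mu]_(t in `[0, 1]) G (a + t *: (x - a)) t x.
    apply: eq_Rintegral => t; rewrite inE /= in_itv /= => t01.
    by rewrite partial1of2E; have [|_ ->] := dF 0 t _ t01; rewrite ?normr0 ?E0.
  pose H (t : R) := t * h i (a + t *: (x - a)).
  have dH (t : R) : 0 <= t <= 1 -> is_derive t 1 H (G (a + t *: (x - a)) t x).
    move=> t01; have By : B (a + t *: (x - a)).
      by apply/rhoB/ball_seg => //; rewrite -E0; apply: Xrho; rewrite normr0.
    have dp := is_derive_path (g := fun s : R => a + s *: (x - a)) (dh i _ By) (fun j => gpath a (x - a) t j).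
    have dI : is_derive t 1 (fun s : R => s) (1 : R) by exact: is_derive_id.
    apply: (is_derive_eq (@is_deriveM R R (fun s : R => s) _ t 1 _ _ dI dp)).
    rewrite /G /GRing.scale /= mulr1 addrC; congr (_ + _).
    by rewrite mulr_sumr; apply: eq_bigr => j _; rewrite mulrA.
  have cH (t : R) : 0 <= t <= 1 -> {for t, continuous H}.
    by move=> /dH[d _]; exact/differentiable_continuous/derivable1_diffP.
  have := @continuous_FTC2 R (fun t => G (a + t *: (x - a)) t x) H 0 1 ltr01 cG _ _.
  rewrite /Rintegral => ->.
  - by rewrite -EFinB /= /H mul0r mul1r scale1r subr0 addrC subrK.
  - split.
    + by move=> t; rewrite in_itv /= => /andP[t0 t1]; have [|] := dH t; rewrite ?(ltW t0) ?(ltW t1).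
    + by apply: cvg_at_right_filter; apply: cH; rewrite lexx ler01.
    + by apply: cvg_at_left_filter; apply: cH; rewrite lexx ler01.
  - move=> t; rewrite in_itv /= => /andP[t0 t1]; rewrite derive1E.
    by have [|_ ->] := dH t; rewrite ?(ltW t0) ?(ltW t1).
split; first exact/derivable1P.
rewrite -valI -vU derive1E /derive; apply: congr1; apply: congr2 => //.
by apply/funext => z /=; rewrite /f /X [z *: 1]mulr1 addr0 scale0r add0r.
Qed.

(** * Charts, cut-offs and tangent spaces *)

Section CinfEval.
Variables (R : realType) (n : nat) (M : manifold R n).
Implicit Types (f g : Cinf M) (p : M).

Lemma CinfD f g p : (f + g) p = f p + g p. Proof. by []. Qed.
Lemma CinfM f g p : (f * g) p = f p * g p. Proof. by []. Qed.
Lemma CinfN f p : (- f) p = - f p. Proof. by []. Qed.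
Lemma CinfZ (a : R) f p : (a *: f) p = a * f p. Proof. by []. Qed.
Lemma Cinf0 p : (0 : Cinf M) p = 0. Proof. by []. Qed.
Lemma Cinf1 p : (1 : Cinf M) p = 1. Proof. by []. Qed.

Definition CinfE := (CinfD, CinfM, CinfN, CinfZ, Cinf0, Cinf1).

Lemma Cinf_sum I (r : seq I) (P : pred I) (F : I -> Cinf M) p :
  (\sum_(i <- r | P i) F i) p = \sum_(i <- r | P i) F i p.
Proof. by elim/big_rec2: _ => // i x y _ <-. Qed.

Lemma Cinf_prod I (r : seq I) (P : pred I) (F : I -> Cinf M) p :
  (\prod_(i <- r | P i) F i) p = \prod_(i <- r | P i) F i p.
Proof. by elim/big_rec2: _ => // i x y _ <-. Qed.

Lemma Cinf_eqP f g : (forall p, f p = g p) -> f = g.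
Proof. by move=> fg; apply/val_inj/funext. Qed.

End CinfEval.

Section Charts.
Variables (R : realType) (n : nat) (M : manifold R n).

Lemma atlas_smooth_chart (c : chart R n M) : mf_atlas c -> smooth_chart c.
Proof.
by move=> Ac; split=> [|c' Ac']; [exact: mf_charts|split; exact: mf_compat].
Qed.

Lemma ch_fromK (c : chart R n M) y : is_chart c -> ch_img c y ->
  ch_dom c (ch_from c y) /\ ch_to c (ch_from c y) = y.
Proof. by move=> [_ _ K _ _] [p dp <-]; rewrite K. Qed.

Lemma ch_img_to (c : chart R n M) p : ch_dom c p -> ch_img c (ch_to c p).
Proof. by move=> dp; exists p. Qed.

Lemma open_chart_image (c : chart R n M) (D : set M) : is_chart c -> open D ->
  open (ch_to c @` (ch_dom c `&` D)).
Proof.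
move=> Cc oD; have [od oi K _ cf] := Cc.
rewrite openE => y [p [dp Dp] <-]; rewrite /interior.
have Iy := ch_img_to dp.
have nD : nbhs (ch_from c (ch_to c p)) (ch_dom c `&` D).
  by rewrite K//; apply: open_nbhs_nbhs; split=> //; exact: openI.
have := cf _ Iy _ nD; rewrite /= nbhs_filterE.
have nI : nbhs (ch_to c p) (ch_img c) by exact: open_nbhs_nbhs.
move=> nF; apply: filterS (filterI nI nF) => z [Iz /= Fz].
by exists (ch_from c z) => //; have [_ ->] := ch_fromK Cc Iz.
Qed.

Lemma chart_image_from (c : chart R n M) (D : set M) y : is_chart c ->
  (ch_to c @` (ch_dom c `&` D)) y ->
  [/\ ch_img c y, ch_dom c (ch_from c y) & D (ch_from c y)].
Proof.
move=> Cc [p [dp Dp] <-]; have [_ _ K _ _] := Cc; rewrite K//.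
by split=> //; exact: ch_img_to.
Qed.

Lemma smooth_in_chart (c : chart R n M) (f : Cinf M) k : smooth_chart c ->
  Ck k (ch_img c) (f \o ch_from c).
Proof.
move=> [Cc Sc]; apply: Ck_local => y Iy.
have [dy toK] := ch_fromK Cc Iy.
have [c' Ac' dc'] := mf_cover (ch_from c y).
have Cc' := mf_charts Ac'; have [od' oi' K' _ _] := Cc'.
exists (ch_to c @` (ch_dom c `&` ch_dom c')).
  by exists (ch_from c y).
have oV := open_chart_image Cc od'.
apply: (Ck_eq (f := (f \o ch_from c') \o (fun z => ch_to c' (ch_from c z)))) => //.
  by move=> z /(chart_image_from Cc)[_ _ d'z] /=; rewrite K'.
apply: (Ck_comp (U := ch_img c')) => //.
- by move=> z /(chart_image_from Cc)[_ _ d'z]; exact: ch_img_to.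
- by move=> j; have [T _] := Sc _ Ac'; exact: T.
- have /asboolP := CinfP f; exact.
Qed.

Definition extend0 (c : chart R n M) (h : 'rV[R]_n -> R) (p : M) : R :=
  if `[< ch_dom c p >] then h (ch_to c p) else 0.

(** On the domain of [c] this is a change of charts; at a point outside it, the open complement of
    [K] is a neighbourhood where the extension is zero. Hence [K] has to be closed in [M], not
    merely in the chart domain. *)
Lemma extend0_smooth (c : chart R n M) (h : 'rV[R]_n -> R) (K : set M) :
  smooth_chart c -> (forall k, Ck k (ch_img c) h) -> closed K -> K `<=` ch_dom c ->
  (forall p, ch_dom c p -> ~ K p -> h (ch_to c p) = 0) ->
  extend0 c h \in @smooth_pred R n M.
Proof.
move=> [Cc Sc] Ch clK Kd hK; apply/asboolP => c' Ac' k; apply: Ck_local => y Iy.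
have Cc' := mf_charts Ac'; have [od' oi' _ _ _] := Cc'.
have [od oi Kc _ _] := Cc.
have [dy toK] := ch_fromK Cc' Iy.
have [dc|dc] := pselect (ch_dom c (ch_from c' y)).
  exists (ch_to c' @` (ch_dom c' `&` ch_dom c)); first by exists (ch_from c' y).
  apply: (Ck_eq (f := h \o (fun z => ch_to c (ch_from c' z)))).
  - exact: open_chart_image.
  - move=> z /(chart_image_from Cc')[_ _ dz] /=.
    by rewrite /extend0; case: asboolP.
  apply: (Ck_comp (U := ch_img c)) => //; first exact: open_chart_image.
    by move=> z /(chart_image_from Cc')[_ _ d'z]; exact: ch_img_to.
  by move=> j; have [_ T] := Sc _ Ac'; exact: T.
exists (ch_to c' @` (ch_dom c' `&` ~` K)).
  by exists (ch_from c' y) => //; split=> // /Kd.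
apply: (Ck_eq (f := cst 0)); last exact: Ck_cst.
  by apply: open_chart_image => //; exact: closed_openC.
move=> z /(chart_image_from Cc')[_ _ Kz] /=.
by rewrite /extend0; case: asboolP => // dz; rewrite hK.
Qed.

(** [K] is the image of a compact coordinate ball, hence closed because [M] is Hausdorff. *)
Lemma chart_bump (c : chart R n M) (p : M) (N : set M) :
  smooth_chart c -> ch_dom c p -> nbhs p N ->
  exists b : 'rV[R]_n -> R, exists K : set M,
  [/\ forall k, Ck k setT b, closed K, K `<=` ch_dom c `&` N,
      forall r, ch_dom c r -> ~ K r -> b (ch_to c r) = 0 &
      \forall r \near p, ch_dom c r /\ b (ch_to c r) = 1].
Proof.
move=> [Cc _] dp nN; have [od oi Kc ct cf] := Cc.
have Ip := ch_img_to dp.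
have nF : \forall z \near ch_to c p, ch_img c z /\ N (ch_from c z).
  have nI : nbhs (ch_to c p) (ch_img c) by exact: open_nbhs_nbhs.
  have nN' : nbhs (ch_from c (ch_to c p)) N by rewrite Kc.
  exact: filterI nI (cf _ Ip _ nN').
have /nbhs_ballP[d /= d0 dF] := nF.
have e0 : 0 < d / 2 by rewrite divr_gt0.
have [b [Cb b1 b0]] := bump_rV (ch_to c p) e0.
have dF' x : `|x - ch_to c p| <= d / 2 -> ch_img c x /\ N (ch_from c x).
  move=> xd; apply: dF; rewrite -ball_normE /= distrC (le_lt_trans xd)//.
  by rewrite gtr_pMr// invf_lt1// ltr1n.
exists b; exists (ch_from c @` [set x | `|x - ch_to c p| <= d / 2]); split=> //.
- apply: compact_closed; first exact: mf_hausdorff.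
  apply: continuous_compact; last exact: closed_ball_rV_compact.
  by apply: continuous_in_subspaceT => x; rewrite inE /= => /dF'[Ix _]; exact: cf.
- move=> _ [x /= /dF'[Ix Nx] <-]; split=> //.
  by have [] := ch_fromK Cc Ix.
- move=> r dr Kr; apply: b0; rewrite leNgt; apply/negP => lt.
  by apply: Kr; exists (ch_to c r); [rewrite /= ltW|exact: Kc].
- have nd : nbhs p (ch_dom c) by exact: open_nbhs_nbhs.
  have nb : \forall z \near ch_to c p, `|z - ch_to c p| <= d / 2 / 2.
    apply/nbhs_ballP; exists (d / 2 / 2) => [|z]; first by rewrite /= divr_gt0.
    by rewrite -ball_normE /= distrC => /ltW.
  have := ct _ dp _ nb; rewrite /= nbhs_filterE => nb'.
  by apply: filterS (filterI nd nb') => r [dr /= br]; split=> //; exact: b1.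
Qed.

Lemma chart_extension (c : chart R n M) (p : M) (h : 'rV[R]_n -> R) :
  smooth_chart c -> ch_dom c p -> (forall k, Ck k (ch_img c) h) ->
  exists f : Cinf M, \forall r \near p, f r = h (ch_to c r).
Proof.
move=> Sc dp Ch.
have [b [K [Cb clK KN bK b1]]] := chart_bump Sc dp (@filterT _ (nbhs p) _).
have oi : open (ch_img c) by have [[]] := Sc.
have sm : extend0 c (b * h) \in @smooth_pred R n M.
  apply: (extend0_smooth (K := K)) => //.
  - by move=> k; apply: CkM => //; apply: Ck_sub (Cb k).
  - by move=> r /KN[].
  - by move=> r dr Kr; rewrite fctE bK// mul0r.
exists (MkCinf sm); apply: filterS b1 => r [dr br] /=.
by rewrite /extend0; case: asboolP => // _; rewrite fctE br mul1r.
Qed.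

Lemma bump_function (p : M) (N : set M) : nbhs p N ->
  exists f : Cinf M, (\forall r \near p, f r = 1) /\ forall r, ~ N r -> f r = 0.
Proof.
move=> nN; have [c Ac dp] := mf_cover p.
have Sc := atlas_smooth_chart Ac.
have [b [K [Cb clK KN bK b1]]] := chart_bump Sc dp nN.
have sm : extend0 c b \in @smooth_pred R n M.
  apply: (extend0_smooth (K := K)) => //.
  - by move=> k; apply: Ck_sub (Cb k).
  - by move=> r /KN[].
exists (MkCinf sm); split.
  by apply: filterS b1 => r [dr br] /=; rewrite /extend0; case: asboolP.
move=> r Nr /=; rewrite /extend0; case: asboolP => // dr; apply: bK => // /KN[_].
exact: Nr.
Qed.

(** A field has to act on global functions, so the partial derivative is multiplied by a bump and
    extended by zero. *)
Lemma coordinate_field (c : chart R n M) (p : M) (i : 'I_n) :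
  smooth_chart c -> ch_dom c p ->
  exists E : vfield M, \forall r \near p, ch_dom c r /\ coord_at c i E r.
Proof.
move=> Sc dp.
have [b [K [Cb clK KN bK b1]]] := chart_bump Sc dp (@filterT _ (nbhs p) _).
have oi : open (ch_img c) by have [[]] := Sc.
pose D (f : Cinf M) := b * 'D_(evec R i) (f \o ch_from c).
have DE f y : D f y = b y * 'D_(evec R i) (f \o ch_from c) y by [].
have sm f : extend0 c (D f) \in @smooth_pred R n M.
  apply: (extend0_smooth (K := K)) => //.
  - move=> k; apply: CkM => //; first by apply: Ck_sub (Cb k).
    by have [_ /(_ i)[]] := smooth_in_chart f k.+1 Sc.
  - by move=> r /KN[].
  - by move=> r dr Kr; rewrite /D fctE bK// mul0r.
have df (f : Cinf M) y : ch_img c y -> derivable (f \o ch_from c : 'rV[R]_n -> R) y (evec R i).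
  by move=> Iy; have [_ /(_ i)[d _]] := smooth_in_chart f 1 Sc; exact: d.
have dE : (fun f => MkCinf (sm f)) \in @deriv_pred R n M.
  apply/asboolP; split=> [a f g|f g]; apply: Cinf_eqP => r;
      rewrite !CinfE /= /extend0; case: asboolP => dr; rewrite ?mulr0 ?addr0//;
      have Ir := ch_img_to dr; rewrite !DE.
    have -> : (a *: f + g) \o ch_from c =
        a *: (f \o ch_from c : 'rV[R]_n -> R) + (g \o ch_from c : 'rV[R]_n -> R) by [].
    rewrite deriveD ?deriveZ; [|exact: df|exact/derivableZ/df|exact: df].
    by rewrite /GRing.scale /=; ring.
  have -> : (f * g) \o ch_from c =
      (f \o ch_from c : 'rV[R]_n -> R) * (g \o ch_from c : 'rV[R]_n -> R) by [].
  rewrite deriveM; [|exact: df|exact: df].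
  have [[_ _ Kc _ _] _] := Sc.
  by rewrite /GRing.scale /= Kc//; ring.
exists (MkVfield dE); apply: filterS b1 => r [dr br]; split=> // f /=.
by rewrite /extend0; case: asboolP => // _; rewrite /D fctE br mul1r.
Qed.

End Charts.

Section Tangent.
Variables (R : realType) (n : nat) (M : manifold R n).
Implicit Types (p : M) (v w : Cinf M -> R).

Lemma tangent0 p : tangent p (fun=> 0).
Proof. by split=> [a f g|f g]; rewrite ?mulr0 addr0. Qed.

Lemma tangent_lin p (a : R) v w : tangent p v -> tangent p w ->
  tangent p (fun f => a * v f + w f).
Proof.
move=> [lv mv] [lw mw]; split=> [b f g|f g]; first by rewrite lv lw; ring.
by rewrite mv mw; ring.
Qed.

Lemma tangent_sum p m (a : 'I_m -> R) (v : 'I_m -> Cinf M -> R) :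
  (forall i, tangent p (v i)) -> tangent p (fun f => \sum_(i < m) a i * v i f).
Proof.
elim: m a v => [|m IH] a v tv.
  by under eq_fun do rewrite big_ord0; exact: tangent0.
under eq_fun do rewrite big_ord_recl.
by apply: tangent_lin => //; exact: IH.
Qed.

Lemma vat_tangent (X : vfield M) p : tangent p (vat X p).
Proof.
have /asboolP[lX mX] := vfP X; split=> [a f g|f g]; rewrite /vat.
  by rewrite lX !CinfE.
by rewrite mX !CinfE.
Qed.

Lemma tangentD p v f g : tangent p v -> v (f + g) = v f + v g.
Proof. by move=> [l _]; rewrite -[f]scale1r l mul1r scale1r. Qed.

Lemma tangentN0 p v : tangent p v -> v 0 = 0.
Proof. by move=> tv; have := tangentD 0 0 tv; rewrite addr0; lra. Qed.

Lemma tangentZ p v (a : R) f : tangent p v -> v (a *: f) = a * v f.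
Proof.
by move=> tv; have [l _] := tv; rewrite -[a *: f]addr0 l (tangentN0 tv) addr0.
Qed.

Lemma tangent_fsum p v m (F : 'I_m -> Cinf M) : tangent p v ->
  v (\sum_(i < m) F i) = \sum_(i < m) v (F i).
Proof.
move=> tv; elim: m F => [|m IH] F; first by rewrite !big_ord0 (tangentN0 tv).
by rewrite !big_ord_recl (tangentD _ _ tv) IH.
Qed.

Definition partial_at (c : chart R n M) (i : 'I_n) p : Cinf M -> R :=
  fun f => 'D_(evec R i) (f \o ch_from c) (ch_to c p).

Lemma partial_tangent (c : chart R n M) i p : smooth_chart c -> ch_dom c p ->
  tangent p (partial_at c i p).
Proof.
move=> Sc dp; have [E nE] := coordinate_field i Sc dp.
have [_ cE] := nbhs_singleton nE.
have -> : partial_at c i p = vat E p by apply/funext => f; rewrite /vat cE.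
exact: vat_tangent.
Qed.

Lemma coordinate_functions (c : chart R n M) p : smooth_chart c -> ch_dom c p ->
  exists y : 'I_n -> Cinf M, \forall r \near p,
    ch_dom c r /\ forall i j, partial_at c i r (y j) = (i == j)%:R.
Proof.
move=> Sc dp.
have /choice[y hy] : forall j : 'I_n, exists f : Cinf M,
    \forall r \near p, f r = ch_to c r 0 j.
  move=> j; apply: (@chart_extension _ _ _ c p (fun x => x 0 j)) => // k; exact: Ck_coord.
exists y.
have [[od oi Kc ct cf] _] := Sc.
have nd : nbhs p (ch_dom c) by exact: open_nbhs_nbhs.
have ny : \forall r \near p, forall j, y j r = ch_to c r 0 j by exact: filter_forall.
have nny := near_join ny.
apply: filterS (filterI nd nny) => r [dr ny']; split=> // i j; rewrite /partial_at.
have Ir := ch_img_to dr.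
have E : \forall z \near ch_to c r, (y j \o ch_from c) z = z 0 j.
  have nI : nbhs (ch_to c r) (ch_img c) by exact: open_nbhs_nbhs.
  have ny2 : nbhs (ch_from c (ch_to c r)) (fun s => forall j, y j s = ch_to c s 0 j).
    by rewrite Kc.
  have nF := cf _ Ir _ ny2; apply: filterS (filterI nI nF) => z [Iz /= ->].
  by have [_ ->] := ch_fromK (proj1 Sc) Iz.
rewrite (near_eq_derive _ E).
by have [_ ->] := is_derive_coord (ch_to c r) (evec R i) j; rewrite mxE /= eq_sym.
Qed.

Lemma covector0 p l : covector p l -> l (fun=> 0) = 0.
Proof.
move=> cl; have := cl (-1) _ _ (tangent0 p) (tangent0 p).
have -> : (fun f : Cinf M => -1 * 0 + 0) = (fun=> 0 : R).
  by apply/funext => f; rewrite mulr0 addr0.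
by move=> ->; rewrite mulN1r addNr.
Qed.

Lemma covector_sum p l m (b : 'I_m -> R) (w : 'I_m -> Cinf M -> R) :
  covector p l -> (forall i, tangent p (w i)) ->
  l (fun f => \sum_(i < m) b i * w i f) = \sum_(i < m) b i * l (w i).
Proof.
move=> cl; elim: m b w => [|m IH] b w tw.
  by under eq_fun do rewrite big_ord0; rewrite big_ord0 (covector0 cl).
under eq_fun do rewrite big_ord_recl.
rewrite big_ord_recl cl//; last exact: tangent_sum.
by rewrite IH.
Qed.

(* A separating family of [n] covectors at [p] forces [dim T_pM <= n], so the
   [n] independent coordinate derivations span: Hadamard's lemma is not needed. *)
Section Separating.
Variables (c : chart R n M) (p : M) (e : 'I_n -> (Cinf M -> R) -> R).
Hypotheses (Sc : smooth_chart c) (dp : ch_dom c p) (ce : forall i, covector p (e i)).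
Hypothesis e0 : forall v, tangent p v -> (forall i, e i v = 0) -> v = (fun=> 0).

Let A := \matrix_(i < n, j < n) e j (partial_at c i p).
Let tp i : tangent p (partial_at c i p) := partial_tangent i Sc dp.

(** A row in the kernel of [A] combines the partial derivatives into a vector killed by every [e j],
    hence zero; evaluation on coordinate functions then kills the row. *)
Lemma partials_unitmx : A \in unitmx.
Proof.
have [y /nbhs_singleton[_ hy]] := coordinate_functions Sc dp.
rewrite -row_free_unit -kermx_eq0; apply/eqP/row_matrixP => l; rewrite row0.
set b := row l _.
have bA : b *m A = 0 by rewrite -row_mul mulmx_ker row0.
have : (fun f => \sum_(i < n) b 0 i * partial_at c i p f) = (fun=> 0).
  apply: e0; first exact: tangent_sum.
  move=> j; rewrite (covector_sum _ (ce j))//; have /matrixP/(_ 0 j) := bA; rewrite !mxE => E.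
  by rewrite -[RHS]E; apply: eq_bigr => i _; rewrite [A _ _]mxE.
move=> H; apply/rowP => j; rewrite [RHS]mxE.
have := congr1 (@^~ (y j)) H; rewrite /= (bigD1 j)//= hy eqxx mulr1 big1 ?addr0//.
by move=> i /negPf ij; rewrite hy ij mulr0.
Qed.

Lemma covectors_onto (x : 'I_n -> R) : exists2 v, tangent p v & forall i, e i v = x i.
Proof.
pose b := (\row_j x j) *m invmx A.
exists (fun f => \sum_(i < n) b 0 i * partial_at c i p f); first exact: tangent_sum.
move=> j; rewrite (covector_sum _ (ce j))//.
have : b *m A = \row_j x j by rewrite /b mulmxKV// partials_unitmx.
move=> /matrixP/(_ 0 j); rewrite [RHS]mxE => <-.
by rewrite mxE; apply: eq_bigr => i _; rewrite [A _ _]mxE.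
Qed.

Lemma partials_span v : tangent p v ->
  exists b : 'I_n -> R, v = (fun f => \sum_(i < n) b i * partial_at c i p f).
Proof.
move=> tv; pose b := (\row_j e j v) *m invmx A.
exists (fun i => b 0 i).
have td : tangent p (fun f => -1 * (\sum_(i < n) b 0 i * partial_at c i p f) + v f).
  by apply: tangent_lin => //; exact: tangent_sum.
have H := e0 td; apply/funext => f.
have := congr1 (@^~ f) (H _) => /=; rewrite mulN1r addrC => E; apply/subr0_eq/E => j.
rewrite ce//; last exact: tangent_sum.
rewrite (covector_sum _ (ce j))//.
have : b *m A = \row_j e j v by rewrite /b mulmxKV// partials_unitmx.
move=> /matrixP/(_ 0 j); rewrite [RHS]mxE mxE => <-.
by rewrite mulN1r addrC; apply/eqP; rewrite subr_eq0; apply/eqP/eq_bigr => i _; rewrite [A _ _]mxE.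
Qed.

End Separating.

(** Isolated as a property because it has two sources: a cotangent basis on [M] ([basis_spanned])
    and pulled-back covectors on a leaf ([leaf_spanned]). *)
Definition spanned p := forall c : chart R n M, smooth_chart c -> ch_dom c p ->
  forall v, tangent p v ->
  exists b : 'I_n -> R, v = (fun f => \sum_(i < n) b i * partial_at c i p f).

(** Evaluation of a tangent vector at a fixed [f] is itself a covector, hence a combination of the
    [e i]. *)
Lemma cotangent_basis_separates p (e : 'I_n -> (Cinf M -> R) -> R) v :
  cotangent_basis p e -> tangent p v -> (forall i, e i v = 0) -> v = (fun=> 0).
Proof.
move=> [ce be] tv ev; apply/funext => f.
have [|a [/(_ v tv) E _]] := be (fun w => w f).
  by move=> a w w' _ _.
by rewrite E big1// => i _; rewrite ev mulr0.
Qed.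

Hypothesis span : forall p, spanned p.

Lemma local_frame (c : chart R n M) p : smooth_chart c -> ch_dom c p ->
  exists (E : 'I_n -> vfield M) (y : 'I_n -> Cinf M), \forall r \near p,
  [/\ ch_dom c r, forall i, coord_at c i (E i) r,
      forall i j, E i (y j) r = (i == j)%:R &
      forall v, tangent r v -> forall f, v f = \sum_(i < n) v (y i) * E i f r].
Proof.
move=> Sc dp.
have /choice[E hE] : forall i : 'I_n, exists E : vfield M,
    \forall r \near p, ch_dom c r /\ coord_at c i E r.
  by move=> i; exact: coordinate_field.
have [y hy] := coordinate_functions Sc dp.
have hE' : \forall r \near p, forall i, ch_dom c r /\ coord_at c i (E i) r.
  exact: filter_forall.
exists E, y; apply: filterS (filterI hy hE') => r [[dr yr] Er].
have Eij i j : E i (y j) r = (i == j)%:R by have [_ ->] := Er i; exact: yr.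
split=> //; first by move=> i; have [] := Er i.
move=> v tv f; have [b ->] := span Sc dr tv; apply: eq_bigr => i _.
have [_ ->] := Er i; congr (_ * _).
rewrite (bigD1 i)//= yr eqxx mulr1 big1 ?addr0// => j /negPf ji.
by rewrite yr ji mulr0.
Qed.

(** Subtracting from [X] its components in a local frame leaves a field that vanishes near [p],
    which a bump annihilates globally; the components themselves vanish at [p]. *)
Lemma tensor_eq0 (T : vfield M -> Cinf M) p (X : vfield M) :
  (forall (h : Cinf M) X Y, T (h *: X + Y) = h * T X + T Y) ->
  vat X p = (fun=> 0) -> T X p = 0.
Proof.
move=> linT X0.
have T0 : T 0 = 0.
  by have := linT (-1) 0 0; rewrite scaler0 addr0 mulN1r addNr.
have TZ (h : Cinf M) Y : T (h *: Y) = h * T Y.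
  by have := linT h Y 0; rewrite addr0 T0 addr0.
have TD Y Z : T (Y + Z) = T Y + T Z.
  by have := linT 1 Y Z; rewrite scale1r mul1r.
have Tsum m (F : 'I_m -> vfield M) : T (\sum_(i < m) F i) = \sum_(i < m) T (F i).
  elim: m F => [|m IH] F; first by rewrite !big_ord0.
  by rewrite !big_ord_recl TD IH.
have [c Ac dp] := mf_cover p.
have Sc := atlas_smooth_chart Ac.
have [E [y nE]] := local_frame Sc dp.
pose Y := X - \sum_(i < n) X (y i) *: E i.
have [x [x1 x0]] := bump_function nE.
have vsum m (F : 'I_m -> vfield M) f : (\sum_(i < m) F i) f = \sum_(i < m) F i f.
  elim: m F => [|m IH] F; first by rewrite !big_ord0.
  by rewrite !big_ord_recl -IH.
have xY : x *: Y = 0.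
  apply/val_inj/funext => f; apply: Cinf_eqP => r.
  have -> : val (x *: Y) f = x * (X f - (\sum_(i < n) X (y i) *: E i) f) by [].
  rewrite vsum !CinfE Cinf_sum.
  have [[_ _ _ sp]|/x0 ->] := pselect ([/\ ch_dom c r, forall i, coord_at c i (E i) r,
      forall i j, E i (y j) r = (i == j)%:R &
      forall v, tangent r v -> forall f, v f = \sum_(i < n) v (y i) * E i f r]); last first.
    by rewrite mul0r.
  have := sp _ (vat_tangent X r) f; rewrite /vat => ->.
  by rewrite subrr mulr0.
have : (x * T Y) p = 0 by rewrite -TZ xY T0.
rewrite CinfM (nbhs_singleton x1) mul1r.
have -> : T Y = T X - \sum_(i < n) X (y i) * T (E i).
  rewrite /Y TD -scaleN1r TZ mulN1r Tsum; congr (_ - _).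
  by apply: eq_bigr => i _; rewrite TZ.
rewrite !CinfE Cinf_sum big1 ?subr0// => i _.
have -> : (X (y i) * T (E i)) p = vat X p (y i) * T (E i) p by [].
by rewrite X0 mul0r.
Qed.

Lemma tensor_eq (T : vfield M -> Cinf M) p (X Y : vfield M) :
  (forall (h : Cinf M) X Y, T (h *: X + Y) = h * T X + T Y) ->
  vat X p = vat Y p -> T X p = T Y p.
Proof.
move=> linT XY; apply/subr0_eq.
have -> : T X p - T Y p = T (X - Y) p.
  have := linT (-1) Y X; rewrite scaleN1r mulN1r addrC [- T Y + _]addrC => ->.
  by rewrite !CinfE.
apply: tensor_eq0 => //; apply/funext => f.
have := congr1 (@^~ f) XY; rewrite /vat => E.
by have -> : (X - Y) f p = X f p - Y f p by []; rewrite E subrr.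
Qed.

Lemma tangent_vfield p v : tangent p v -> exists X : vfield M, vat X p = v.
Proof.
move=> tv; have [c Ac dp] := mf_cover p; have Sc := atlas_smooth_chart Ac.
have [E [y /nbhs_singleton[_ _ _ sp]]] := local_frame Sc dp.
exists (\sum_(i < n) (v (y i) *: (1 : Cinf M)) *: E i); apply/funext => f.
rewrite (sp v tv f) /vat.
have vsum m (F : 'I_m -> vfield M) : (\sum_(i < m) F i) f = \sum_(i < m) F i f.
  elim: m F => [|m IH] F; first by rewrite !big_ord0.
  by rewrite !big_ord_recl -IH.
rewrite vsum Cinf_sum; apply: eq_bigr => i _.
have -> : ((v (y i) *: (1 : Cinf M)) *: E i) f = (v (y i) *: (1 : Cinf M)) * E i f by [].
by rewrite !CinfE mulr1.
Qed.

End Tangent.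

(** * Determinants and sums of covector monomials *)

Section Laplace.
Variable R : realType.

Definition same_block k l (i j : 'I_(k + l)) : bool := (i < k)%N == (j < k)%N.

(** The number of permutations preserving both blocks, that is [k! l!]; what enters below is its
    positivity. *)
Definition block_perms k l : R :=
  \sum_(s : 'S_(k + l)) \prod_i (same_block i (s i))%:R.

Lemma block_perms_gt0 k l : 0 < block_perms k l.
Proof.
rewrite /block_perms (bigD1 1%g)//= big1 => [|i _]; last by rewrite perm1 /same_block eqxx.
rewrite ltr_pwDl// sumr_ge0// => s _; apply: prodr_ge0 => i _; exact: ler0n.
Qed.

(** The product of the two minors is the determinant of the column-permuted [A] with its
    off-diagonal blocks erased. After expansion over [t] and exchange of the sums, every
    block-preserving [t] contributes one [\det A], by reindexing [s]. *)
Lemma laplace_sum k l (A : 'M[R]_(k + l)) :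
  \sum_(s : 'S_(k + l)) (-1) ^+ s *
    (\det (\matrix_(a < k, b < k) A (lshift l a) (s (lshift l b))) *
     \det (\matrix_(a < l, b < l) A (rshift k a) (s (rshift k b)))) =
  block_perms k l * \det A.
Proof.
transitivity (\sum_(s : 'S_(k + l)) (-1) ^+ s * \det (\matrix_(i, j)
    (A i (s j) * (same_block i j)%:R))).
  apply: eq_bigr => s _; congr (_ * _).
  rewrite -(det_ublock _ 0); congr (\det _).
  apply/matrixP => i j; rewrite [RHS]mxE /same_block.
  by case: (split_ordP i) => i' ->; case: (split_ordP j) => j' ->;
    rewrite ?block_mxEul ?block_mxEur ?block_mxEdl ?block_mxEdr mxE /= ?ltn_ord
            ?[(k + _ < k)%N]ltnNge ?leq_addr /= ?mulr1 ?mulr0.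
transitivity (\sum_(s : 'S_(k + l)) \sum_(t : 'S_(k + l))
    (\prod_i (same_block i (t i))%:R) * ((-1) ^+ s * ((-1) ^+ t * \prod_i A i (s (t i))))).
  apply: eq_bigr => s _; rewrite /determinant big_distrr /=; apply: eq_bigr => t _.
  under eq_bigr => i _ do rewrite mxE.
  have H (a b P Q : R) : a * (b * (P * Q)) = Q * (a * (b * P)) by ring.
  by rewrite big_split /= H.
rewrite exchange_big /= /block_perms big_distrl /=; apply: eq_bigr => t _.
rewrite -big_distrr /=; congr (_ * _).
rewrite /determinant (reindex_inj (mulgI t^-1%g)) /=; apply: eq_bigr => s _.
under eq_bigr => i _ do rewrite permM permK.
rewrite mulrA -signr_addb odd_permM odd_permV; congr (_ ^+ _ * _).
by rewrite addbAC addbb.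
Qed.
End Laplace.

Section Cdet.

(** Cofactor expansion over plain naturals: it unfolds to a polynomial that [ring] can treat, and
    over [int] it evaluates under [vm_compute]. *)
Fixpoint cdet (R : pzRingType) n (f : nat -> nat -> R) : R :=
  if n is n'.+1 then
    foldr (fun j acc => (if odd j then - f 0%N j else f 0%N j)
             * cdet n' (fun a b => f a.+1 (bump j b)) + acc) 0 (iota 0 n)
  else 1.

Lemma det_cdet (R : comNzRingType) n (f : nat -> nat -> R) :
  \det (\matrix_(i < n, j < n) f i j) = cdet n f.
Proof.
elim: n f => [|n IH] f; first by rewrite det_mx00.
rewrite (expand_det_row _ ord0).
have -> : cdet n.+1 f = \sum_(j <- iota 0 n.+1)
    (if odd j then - f 0%N j else f 0%N j) * cdet n (fun a b => f a.+1 (bump j b)).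
  by rewrite unlock /= /reducebig; elim: (iota 1 n) => //= a s ->.
rewrite -[iota 0 n.+1]/(index_iota 0 n.+1) big_mkord; apply: eq_bigr => j _.
rewrite mxE /cofactor -IH add0n -signr_odd.
have -> : row' ord0 (col' j (\matrix_(i, j0) f i j0)) = \matrix_(a < n, b < n) f a.+1 (bump j b).
  by apply/matrixP => a b; rewrite !mxE.
by case: (odd j); rewrite ?expr1 ?expr0 ?mul1r// mulN1r mulrN mulNr.
Qed.

Lemma det_intr (R : comNzRingType) n (f : nat -> nat -> int) :
  \det (\matrix_(i < n, j < n) (f i j)%:~R : 'M[R]_n) = (cdet n f)%:~R.
Proof.
rewrite -det_cdet -det_map_mx; congr (\det _).
by apply/matrixP => i j; rewrite !mxE.
Qed.

End Cdet.

Section Monomials.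
Variables (R : realType) (T : Type) (cd : T -> nat -> R).

Definition mono k (s : seq nat) (Xs : 'I_k -> T) : R :=
  \det (\matrix_(a < k, b < k) cd (Xs b) (nth 0%N s a)).

Definition evalf k (A : seq (R * seq nat)) (Xs : 'I_k -> T) : R :=
  \sum_(x <- A) x.1 * mono x.2 Xs.

(** Monomials are concatenated without sorting or merging: the determinant in [mono] accounts for
    signs and for repeated indices. *)
Definition wedgef (A B : seq (R * seq nat)) : seq (R * seq nat) :=
  [seq (x.1 * y.1, x.2 ++ y.2) | x <- A, y <- B].

Definition wedge_cst k l : R := ((k`! * l`!)%:R)^-1 * block_perms R k l.

Lemma wedge_cst_gt0 k l : 0 < wedge_cst k l.
Proof.
by rewrite mulr_gt0 ?block_perms_gt0// invr_gt0 ltr0n muln_gt0 !fact_gt0.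
Qed.

Lemma wedge_mono k l (s t : seq nat) (Xs : 'I_(k + l) -> T) : size s = k ->
  \sum_(p : 'S_(k + l)) (-1) ^+ p * (mono s (fun a => Xs (p (lshift l a))) *
    mono t (fun b => Xs (p (rshift k b)))) = block_perms R k l * mono (s ++ t) Xs.
Proof.
move=> ss; rewrite /mono -laplace_sum; apply: eq_bigr => p _.
congr (_ * _); congr (_ * _); congr (\det _); apply/matrixP => a b; rewrite !mxE nth_cat ss /=.
  by rewrite ltn_ord.
by rewrite ltnNge leq_addr /= addKn.
Qed.

Lemma wedge_evalf k l A B (al : ('I_k -> T) -> R) (be : ('I_l -> T) -> R)
    (Xs : 'I_(k + l) -> T) :
  all (fun x => size x.2 == k) A ->
  (forall Ys, al Ys = evalf A Ys) -> (forall Ys, be Ys = evalf B Ys) ->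
  ((k`! * l`!)%:R)^-1 * \sum_(p : 'S_(k + l)) (-1) ^+ p *
    (al (fun a => Xs (p (lshift l a))) * be (fun b => Xs (p (rshift k b)))) =
  wedge_cst k l * evalf (wedgef A B) Xs.
Proof.
move=> sA alE beE; rewrite /wedge_cst -mulrA; congr (_ * _).
rewrite /evalf /wedgef big_allpairs_dep /= big_distrr /=.
under [LHS]eq_bigr => p _ do rewrite alE beE /evalf big_distrlr big_distrr /=.
rewrite exchange_big /= !big_seq; apply: eq_bigr => x xA.
under [LHS]eq_bigr => p _ do rewrite big_distrr /=.
rewrite exchange_big /= big_distrr /=; apply: eq_bigr => y _.
rewrite mulrCA -wedge_mono; last by apply/eqP; exact: (allP sA).
have H (a b c d e : R) : a * (b * c * (d * e)) = b * d * (a * (c * e)) by ring.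
by rewrite big_distrr /=; apply: eq_bigr => p _; rewrite H.
Qed.

Lemma mono_top n (s : seq nat) (Xs : 'I_n -> T) : all (fun i => i < n)%N s -> size s = n ->
  mono s Xs = (cdet n (fun a b => (nth 0%N s a == b)%:Z))%:~R *
    \det (\matrix_(a < n, b < n) cd (Xs b) a).
Proof.
move=> sn ss; rewrite -det_intr -det_mulmx; congr (\det _).
apply/matrixP => a b; rewrite !mxE.
have an : (nth 0%N s a < n)%N by apply: (allP sn); rewrite mem_nth// ss.
rewrite (bigD1 (Ordinal an))//= !mxE /= eqxx mul1r big1 ?addr0// => j /negPf ja.
rewrite !mxE; have -> : (nth 0%N s a == j) = false.
  by rewrite eq_sym; apply: contraFF ja => /eqP ja; apply/eqP/val_inj.
by rewrite mul0r.
Qed.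

Lemma evalf_top n (A : seq (R * seq nat)) (Xs : 'I_n -> T) :
  all (fun x => all (fun i => i < n)%N x.2 && (size x.2 == n)) A ->
  evalf A Xs = (\sum_(x <- A) x.1 * (cdet n (fun a b => (nth 0%N x.2 a == b)%:Z))%:~R) *
    \det (\matrix_(a < n, b < n) cd (Xs b) a).
Proof.
move=> HA; rewrite /evalf big_distrl /= !big_seq; apply: eq_bigr => x xA.
by have /andP[x1 /eqP x2] := allP HA _ xA; rewrite mono_top// mulrA.
Qed.

Lemma mono_cdet k (s : seq nat) (Xs : 'I_k.+1 -> T) :
  mono s Xs = cdet k.+1 (fun a b => cd (Xs (inord b)) (nth 0%N s a)).
Proof.
rewrite -det_cdet; congr (\det _); apply/matrixP => a b.
by rewrite !mxE inord_val.
Qed.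

End Monomials.

(** A volume form contracted with [z], evaluated on the basis without its [j]-th vector, reads off
    the [j]-th coordinate of [z]. This extracts [K X] from its defining identity. *)
Lemma det_replace_col (R : comNzRingType) n (z : 'I_n.+1 -> R) (j : 'I_n.+1) :
  \det (\matrix_(a < n.+1, b < n.+1)
    (if unlift ord0 b is Some b' then (a == lift j b')%:R else z a)) = (-1) ^+ j * z j.
Proof.
rewrite (expand_det_row _ j) (bigD1 ord0)//= big1 => [|b b0].
  rewrite mxE unlift_none addr0 mulrC /cofactor addn0.
  have -> : row' j (col' ord0 (\matrix_(a < n.+1, b < n.+1)
    (if unlift ord0 b is Some b' then (a == lift j b')%:R else z a))) = 1%:M.
    by apply/matrixP => a b; rewrite !mxE liftK (inj_eq lift_inj).
  by rewrite det1 mulr1.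
rewrite mxE; case: unliftP b0 => [b' ->|->]; last by rewrite eqxx.
by rewrite (negPf (neq_lift _ _)) mul0r.
Qed.

Definition coef_at (L : seq (int * nat * seq nat)) (d : seq nat -> int) (i : nat) : int :=
  foldr (fun t acc => (if t.1.2 == i then t.1.1 * d t.2 else 0) + acc) 0 L.

Lemma sum_coef_at (R : comNzRingType) n (L : seq (int * nat * seq nat))
    (d : seq nat -> int) (x : nat -> R) :
  all (fun t => t.1.2 < n)%N L ->
  \sum_(t <- L) (t.1.1%:~R * x t.1.2) * (d t.2)%:~R =
  \sum_(i < n) x i * (coef_at L d i)%:~R.
Proof.
elim: L => [|t L IH] /=.
  by rewrite big_nil big1// => i _; rewrite mulr0.
move=> /andP[tn /IH E]; rewrite big_cons E.
under [RHS]eq_bigr => i _ do rewrite intrD mulrDr.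
rewrite big_split /=; congr (_ + _).
rewrite (bigD1 (Ordinal tn))//= eqxx big1 ?addr0 ?intrM; last first.
  by move=> i; rewrite -val_eqE /= eq_sym => /negPf ->; rewrite mulr0.
by ring.
Qed.

(** * The pointwise normal form of K *)

Definition fam2 (T : Type) (X Y : T) : 'I_2 -> T := fun i => nth X [:: X; Y] i.
Definition fam3 (T : Type) (X Y Z : T) : 'I_3 -> T := fun i => nth X [:: X; Y; Z] i.
Definition fam4 (T : Type) (X Y Z W : T) : 'I_4 -> T :=
  fun i => nth X [:: X; Y; Z; W] i.

Lemma scons0 (T : Type) k (Y : T) (Xs : 'I_k -> T) (i : 'I_k.+1) :
  val i = 0%N -> scons Y Xs i = Y.
Proof.
by move=> i0; have -> : i = ord0 by [apply: val_inj]; rewrite /scons unlift_none.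
Qed.

Lemma sconsS (T : Type) k (Y : T) (Xs : 'I_k -> T) (i : 'I_k.+1) (j : 'I_k) :
  val i = j.+1 -> scons Y Xs i = Xs j.
Proof.
move=> ij; have -> : i = lift ord0 j by apply: val_inj.
by rewrite /scons liftK.
Qed.

Lemma scons_inord0 (T : Type) k (Y : T) (Xs : 'I_k.+1 -> T) :
  scons Y Xs (inord 0) = Y.
Proof. by apply: scons0; rewrite /= inordK. Qed.

Lemma scons_inordS (T : Type) k (Y : T) (Xs : 'I_k.+1 -> T) j : (j < k.+1)%N ->
  scons Y Xs (inord j.+1) = Xs (inord j).
Proof. by move=> jk; apply: sconsS; rewrite /= !inordK. Qed.

Lemma fam2_scons (T : Type) (X Y : T) : fam2 X Y = scons X (fun _ => Y).
Proof.
apply/funext => i; case: (unliftP ord0 i) => [j ->|->]; last by rewrite /scons unlift_none.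
by rewrite /scons liftK /fam2 lift0; case: j => [[|j] //].
Qed.

Definition omega_terms (R : realType) : seq (R * seq nat) :=
  [:: (1, [:: 0; 1]%N); (1, [:: 2; 3]%N); (1, [:: 4; 5]%N)].

Definition phi_terms (R : realType) : seq (R * seq nat) :=
  [:: (1, [:: 0; 3; 5]%N); (1, [:: 1; 2; 5]%N); (1, [:: 1; 3; 4]%N)].

(* The terms of the contraction of phi with a vector of coordinates [x],
   as triples (sign, index into [x], remaining monomial). *)
Definition contraction_terms : seq (int * nat * seq nat) :=
  [:: (1, 0%N, [:: 3; 5]%N); (-1, 3%N, [:: 0; 5]%N); (1, 5%N, [:: 0; 3]%N);
      (1, 1%N, [:: 2; 5]%N); (-1, 2%N, [:: 1; 5]%N); (1, 5%N, [:: 1; 2]%N);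
      (1, 1%N, [:: 3; 4]%N); (-1, 3%N, [:: 1; 4]%N); (1, 4%N, [:: 1; 3]%N)].

Definition valued (R : realType) (x : nat -> R) (L : seq (int * nat * seq nat)) :
  seq (R * seq nat) := [seq (t.1.1%:~R * x t.1.2, t.2) | t <- L].

Definition contraction_phi_terms : seq (int * nat * seq nat) :=
  [seq (t.1, t.2 ++ s) | t <- contraction_terms,
    s <- [:: [:: 0; 3; 5]; [:: 1; 2; 5]; [:: 1; 3; 4]]%N].

(** The coefficient of [omega^3 / 3!] relative to the determinant of the six coordinates. *)
Definition cube_cst (R : realType) : R :=
  6^-1 * (wedge_cst R 4 2 * \sum_(x <- wedgef [seq (wedge_cst R 2 2 * x.1, x.2) |
      x <- wedgef (omega_terms R) (omega_terms R)] (omega_terms R))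
    x.1 * (cdet 6 (fun a b => (nth 0%N x.2 a == b)%:Z))%:~R).

(** With [wedge_cst] and [cube_cst] both equal to [1] this is [-2]; the argument relies only on
    [kap] being nonzero. *)
Definition kap (R : realType) : R := - (2 * wedge_cst R 2 3 / cube_cst R).

Definition det2 (R : realType) (x y : nat -> R) i j := x i * y j - x j * y i.
Definition det3 (R : realType) (x y z : nat -> R) i j k :=
  x i * det2 y z j k - y i * det2 x z j k + z i * det2 x y j k.

(* The model of (omega, phi, K) at a point, in the coordinates [cd] (indexed
   from 0); [kap] is the constant of the identity K e_2 = kap e_1. *)
Record normal_at (R : realType) (M : manifold R 6) (om : dform M 2) (phi : dform M 3)
    (K : vfield M -> vfield M) (p : M) (cd : vfield M -> nat -> R) : Prop := {
  cd_lin : forall (h : Cinf M) X Y i, cd (h *: X + Y) i = h p * cd X i + cd Y i;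
  cd_inj : forall X, (forall i, (i < 6)%N -> cd X i = 0) -> vat X p = (fun=> 0);
  cd_vat : forall X Y, vat X p = vat Y p -> cd X = cd Y;
  cd_surj : forall x : nat -> R, exists X, forall i, (i < 6)%N -> cd X i = x i;
  cd_om : forall X Y, om (fam2 X Y) p = det2 (cd X) (cd Y) 0 1
    + det2 (cd X) (cd Y) 2 3 + det2 (cd X) (cd Y) 4 5;
  cd_phi : forall X Y Z, phi (fam3 X Y Z) p = det3 (cd X) (cd Y) (cd Z) 0 3 5
    + det3 (cd X) (cd Y) (cd Z) 1 2 5 + det3 (cd X) (cd Y) (cd Z) 1 3 4;
  cd_K : forall X i, (i < 6)%N ->
    cd (K X) i = if odd i then 0 else kap R * cd X i.+1;
  cd_kap : kap R != 0 }.

Section Pointwise.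
Variables (R : realType) (M : manifold R 6) (p : M).
Variable e : 'I_6 -> (Cinf M -> R) -> R.
Hypothesis be : cotangent_basis p e.

Definition cov_coord (X : vfield M) (i : nat) : R := e (inord i) (vat X p).
Local Notation cd := cov_coord.

Lemma cov_coord_lin (h : Cinf M) X Y i : cd (h *: X + Y) i = h p * cd X i + cd Y i.
Proof.
have [ce _] := be; rewrite /cd -(ce (inord i) (h p)) //; exact: vat_tangent.
Qed.

Lemma cov_coord_inj X : (forall i, (i < 6)%N -> cd X i = 0) -> vat X p = (fun=> 0).
Proof.
move=> X0; apply: (cotangent_basis_separates be); first exact: vat_tangent.
by move=> i; have := X0 i (ltn_ord i); rewrite /cd inord_val.
Qed.

Lemma emono_mono k (s : k.-tuple nat) Xs :
  emono p e s Xs = mono cd [seq i.-1 | i <- s] Xs.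
Proof.
rewrite /emono /mono; congr (\det _); apply/matrixP => a b; rewrite !mxE /cd.
by rewrite (nth_map 0%N) ?size_tuple// (tnth_nth 0%N).
Qed.

Lemma wedge_at k l (al : dform M k) (be' : dform M l) Xs :
  wedge al be' Xs p = ((k`! * l`!)%:R)^-1 * \sum_(s : 'S_(k + l)) (-1) ^+ s *
    (al (fun a => Xs (s (lshift l a))) p * be' (fun b => Xs (s (rshift k b))) p).
Proof.
rewrite /wedge CinfZ Cinf_sum; congr (_ * _); apply: eq_bigr => s _.
by rewrite !CinfM; congr (_ * _); case: (odd_perm s); rewrite ?expr1 ?expr0 ?CinfN ?Cinf1.
Qed.

Lemma wedge_terms k l (al : dform M k) (be' : dform M l) A B Xs :
  all (fun x => size x.2 == k) A ->
  (forall Ys, al Ys p = evalf cd A Ys) -> (forall Ys, be' Ys p = evalf cd B Ys) ->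
  wedge al be' Xs p = wedge_cst R k l * evalf cd (wedgef A B) Xs.
Proof.
move=> sA alE beE; rewrite wedge_at.
exact: (wedge_evalf (al := fun Ys => al Ys p) (be := fun Ys => be' Ys p) Xs sA alE beE).
Qed.

Variables (om : dform M 2) (phi : dform M 3) (K : vfield M -> vfield M).
Hypothesis omE : forall Xs, om Xs p = emono p e [tuple 1; 2]%N Xs
                         + emono p e [tuple 3; 4]%N Xs
                         + emono p e [tuple 5; 6]%N Xs.
Hypothesis phiE : forall Xs, phi Xs p = emono p e [tuple 1; 4; 6]%N Xs
                          + emono p e [tuple 2; 3; 6]%N Xs
                          + emono p e [tuple 2; 4; 5]%N Xs.
Hypothesis KP : is_K om phi K.
Hypothesis span : forall q : M, spanned q.

Lemma cov_coord_surj (x : nat -> R) : exists X, forall i, (i < 6)%N -> cd X i = x i.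
Proof.
have [c Ac dp] := mf_cover p; have Sc := atlas_smooth_chart Ac.
have [v tv ev] := covectors_onto Sc dp be.1
  (fun v tv => cotangent_basis_separates be tv) (fun i : 'I_6 => x i).
have [X Xv] := tangent_vfield span tv.
by exists X => i i6; rewrite /cd Xv ev inordK.
Qed.
Let surj := cov_coord_surj.

Lemma om_terms Xs : om Xs p = evalf cd (omega_terms R) Xs.
Proof. by rewrite omE !emono_mono /evalf !big_cons big_nil /=; ring. Qed.

Lemma phi_terms_at Xs : phi Xs p = evalf cd (phi_terms R) Xs.
Proof. by rewrite phiE !emono_mono /evalf !big_cons big_nil /=; ring. Qed.

Lemma contract_terms X Ys :
  Defs.contract X phi Ys p = evalf cd (valued (cd X) contraction_terms) Ys.
Proof.
rewrite /Defs.contract phi_terms_at /evalf /valued big_map !big_cons !big_nil.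
rewrite !mono_cdet /= !scons_inord0 !scons_inordS//.
by rewrite /bump /=; ring.
Qed.

Lemma om2_terms Ys : wedge om om Ys p = evalf cd [seq (wedge_cst R 2 2 * x.1, x.2) |
      x <- wedgef (omega_terms R) (omega_terms R)] Ys.
Proof.
rewrite (wedge_terms (A := omega_terms R) (B := omega_terms R))//; try exact: om_terms.
rewrite /evalf big_map big_distrr /=; apply: eq_bigr => x _.
by rewrite mulrA.
Qed.

Lemma cube_at Xs :
  ((3`!%:R^-1 : R) *: (wedge (wedge om om) om : dform M 6)) Xs p =
  cube_cst R * \det (\matrix_(a < 6, b < 6) cd (Xs b) a).
Proof.
have -> : ((3`!%:R^-1 : R) *: (wedge (wedge om om) om : dform M 6)) Xs p =
  6^-1 * wedge (wedge om om) om Xs p by [].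
rewrite (wedge_terms (A := [seq (wedge_cst R 2 2 * x.1, x.2) |
      x <- wedgef (omega_terms R) (omega_terms R)]) (B := omega_terms R))//;
  [|exact: om2_terms|exact: om_terms].
by rewrite evalf_top// /cube_cst !mulrA.
Qed.

(** The defining identity of [K X] is evaluated on the coordinate basis with its [j]-th vector left
    out. The right side becomes linear in the coordinates of [X], with the integer coefficients of
    [coef_table]. *)
Lemma K_identity (B : 'I_6 -> vfield M) X (j : 'I_6) :
  (forall i a, (a < 6)%N -> cd (B i) a = (a == i)%:R) ->
  cube_cst R * ((-1) ^+ j * cd (K X) j) =
  - (wedge_cst R 2 3 * \sum_(i < 6) cd X i * (coef_at contraction_phi_terms
       (fun s => cdet 5 (fun a b => (nth 0%N s a == bump j b)%:Z)) i)%:~R).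
Proof.
move=> BE; pose Ys b := B (lift j b).
have := congr1 (fun al : dform M 5 => al Ys p) (KP X).
rewrite /Defs.contract cube_at => H.
have L : \det (\matrix_(a < 6, b < 6) cd (scons (K X) Ys b) a) = (-1) ^+ j * cd (K X) j.
  rewrite -(det_replace_col (fun a : 'I_6 => cd (K X) a)); congr (\det _).
  apply/matrixP => a b; rewrite !mxE /scons; case: unliftP => [b' _|//].
  by rewrite /Ys BE.
rewrite -L H.
have -> : (- (wedge (Defs.contract X phi) phi : dform M 5)) Ys p =
  - (wedge (Defs.contract X phi) phi Ys p) by [].
rewrite (wedge_terms (A := valued (cd X) contraction_terms) (B := phi_terms R))//;
  [|exact: contract_terms|exact: phi_terms_at].
congr (- (_ * _)); rewrite -sum_coef_at//.
have -> : evalf cd (wedgef (valued (cd X) contraction_terms) (phi_terms R)) Ys =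
    \sum_(t <- contraction_phi_terms) (t.1.1%:~R * cd X t.1.2) * mono cd t.2 Ys.
  rewrite /evalf /wedgef /valued /contraction_phi_terms !big_allpairs_dep big_map.
  apply: eq_bigr => t _; rewrite !big_cons !big_nil /=.
  by rewrite !mulr1.
rewrite !big_seq; apply: eq_bigr => t tL; congr (_ * _).
rewrite -det_intr /mono; congr (\det _); apply/matrixP => a b; rewrite !mxE /Ys BE.
  by [].
have : all (fun t => all (fun i => i < 6)%N t.2 && (size t.2 == 5%N)) contraction_phi_terms by [].
by move=> /allP/(_ _ tL)/andP[/allP H5 /eqP sz]; apply: H5; rewrite mem_nth// sz.
Qed.

(** Up to constants, the table says that [K] sends the basis vector of index [j.+1] to that of index
    [j] for even [j], and kills those of even index. The entry [2] comes from two equal terms in the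
    wedge of the contraction with [phi]. *)
Lemma coef_table : forall j i : 'I_6, coef_at contraction_phi_terms
       (fun s => cdet 5 (fun a b => (nth 0%N s a == bump j b)%:Z)) i
   = if odd j then 0 else if i == j.+1 :> nat then 2 else 0.
Proof.
have T : all (fun j => all (fun i => coef_at contraction_phi_terms
       (fun s => cdet 5 (fun a b => (nth 0%N s a == bump j b)%:Z)) i
   == if odd j then 0 else if i == j.+1 :> nat then 2 else 0) (iota 0 6)) (iota 0 6).
  by vm_compute.
move=> j i; apply/eqP.
have inI (k : 'I_6) : val k \in iota 0 6 by rewrite mem_iota ltn_ord.
exact: (allP (allP T _ (inI j)) _ (inI i)).
Qed.

Lemma K_coord_cube X j : (j < 6)%N -> cube_cst R * cd (K X) j =
  if odd j then 0 else - (2 * wedge_cst R 2 3) * cd X j.+1.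
Proof.
move=> j6.
have /choice[B BE] : forall i : 'I_6, exists B, forall a, (a < 6)%N -> cd B a = (a == i)%:R.
  by move=> i; exact: (surj (fun a => (a == i)%:R)).
have := @K_identity B X (Ordinal j6) BE.
under eq_bigr => i _ do rewrite coef_table.
rewrite /=; case: ifP => oj.
  rewrite big1 => [|i _]; last by rewrite mulr0.
  by rewrite mulr0 oppr0 -signr_odd oj expr1 mulN1r mulrN => /eqP; rewrite oppr_eq0 => /eqP.
rewrite -signr_odd oj expr0 mul1r => ->.
have j1 : (j.+1 < 6)%N.
  by move: j6 oj; case: (j) => [|[|[|[|[|[|]]]]]].
rewrite (bigD1 (Ordinal j1))//= eqxx big1 => [|i]; last first.
  by rewrite -val_eqE /= => /negPf ->; rewrite mulr0.
by rewrite addr0 (_ : (2 : int)%:~R = 2 :> R)//; ring.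
Qed.

(** The existence of [K] forces this without evaluating the constant: for the basis vector of index
    [1], [K_coord_cube] would equate zero with [- (2 * wedge_cst R 2 3)]. *)
Lemma cube_cst_neq0 : cube_cst R != 0.
Proof.
apply/eqP => c0; have [X hX] := surj (fun a => (a == 1%N)%:R).
have := @K_coord_cube X 0 isT; rewrite c0 mul0r hX//= mulr1 => /esym/eqP.
by rewrite oppr_eq0 mulf_eq0 pnatr_eq0 /= gt_eqF// wedge_cst_gt0.
Qed.

Lemma K_coord X j : (j < 6)%N -> cd (K X) j = if odd j then 0 else kap R * cd X j.+1.
Proof.
move=> j6; have := @K_coord_cube X j j6; have c0 := cube_cst_neq0.
move=> H; apply: (mulfI c0); rewrite H; case: ifP => _; first by rewrite mulr0.
by rewrite /kap; field.
Qed.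

Lemma normal_at_cov_coord : normal_at om phi K p cd.
Proof.
split.
- exact: cov_coord_lin.
- exact: cov_coord_inj.
- by move=> X Y XY; rewrite /cd XY.
- exact: surj.
- move=> X Y; rewrite om_terms /evalf !big_cons big_nil !mono_cdet /= /fam2 !inordK//=.
  by rewrite /bump /det2 /=; ring.
- move=> X Y Z; rewrite phi_terms_at /evalf !big_cons big_nil !mono_cdet /= /fam3 !inordK//=.
  by rewrite /bump /det3 /det2 /=; ring.
- exact: K_coord.
- rewrite /kap oppr_eq0; apply: mulf_neq0; last by rewrite invr_eq0 cube_cst_neq0.
  by apply: mulf_neq0; rewrite ?pnatr_eq0// gt_eqF// wedge_cst_gt0.
Qed.

End Pointwise.

Lemma basis_spanned (R : realType) n (M : manifold R n) (p : M) e :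
  cotangent_basis p e -> spanned p.
Proof.
move=> be c Sc dp v tv; apply: (partials_span Sc dp be.1) => //.
by move=> w tw; exact: (cotangent_basis_separates be tw).
Qed.

(** * Identities along the foliation *)

Section VectorFields.
Variables (R : realType) (n : nat) (M : manifold R n).
Implicit Types (X Y : vfield M) (f g : Cinf M) (p : M).

Lemma vfD X f g : X (f + g) = X f + X g.
Proof. by have /asboolP[l _] := vfP X; rewrite -[f]scale1r l !scale1r. Qed.

Lemma vfZ X (a : R) f : X (a *: f) = a *: X f.
Proof.
have /asboolP[l _] := vfP X.
have X0 : X 0 = 0 by have := vfD X 0 0; rewrite addr0 => /eqP; rewrite addrC -subr_eq subrr => /eqP.
by rewrite -[a *: f]addr0 l X0 addr0.
Qed.

Lemma vfN X f : X (- f) = - X f.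
Proof. by rewrite -scaleN1r vfZ scaleN1r. Qed.

Lemma vfB X f g : X (f - g) = X f - X g.
Proof. by rewrite vfD vfN. Qed.

Lemma vf0 X : X 0 = 0.
Proof. by rewrite -[0 in LHS](scale0r 0) vfZ scale0r. Qed.

Lemma vfM X f g : X (f * g) = f * X g + g * X f.
Proof. by have /asboolP[_ m] := vfP X. Qed.

Lemma vfield_eq X Y : (forall p, vat X p = vat Y p) -> X = Y.
Proof.
move=> XY; apply/val_inj/funext => f; apply: Cinf_eqP => p.
exact: (congr1 (@^~ f) (XY p)).
Qed.

Lemma lieE X Y f : lie X Y f = X (Y f) - Y (X f). Proof. by []. Qed.
Lemma vf_addE X Y f : (X + Y) f = X f + Y f. Proof. by []. Qed.
Lemma vf_oppE X f : (- X) f = - X f. Proof. by []. Qed.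
Lemma vf_scaleE (h : Cinf M) X f : (h *: X) f = h * X f. Proof. by []. Qed.
End VectorFields.

Lemma fam2E (T : Type) (f : 'I_2 -> T) : f = fam2 (f ord0) (f (lift ord0 ord0)).
Proof.
apply/funext => i; case: (unliftP ord0 i) => [j ->|->//].
by rewrite (ord1 j).
Qed.

Lemma fam3E (T : Type) (f : 'I_3 -> T) :
  f = fam3 (f ord0) (f (lift ord0 ord0)) (f (lift ord0 (lift ord0 ord0))).
Proof.
apply/funext => i; case: (unliftP ord0 i) => [j ->|->//].
case: (unliftP ord0 j) => [k ->|->//].
by rewrite (ord1 k).
Qed.

Lemma scons_fam2 (T : Type) (X : T) (f : 'I_1 -> T) : scons X f = fam2 X (f ord0).
Proof.
rewrite [LHS]fam2E; congr (fam2 _ _); first exact: scons0.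
exact: sconsS.
Qed.

Lemma scons_fam3 (T : Type) (X : T) (f : 'I_2 -> T) :
  scons X f = fam3 X (f ord0) (f (lift ord0 ord0)).
Proof.
rewrite [LHS]fam3E; congr (fam3 _ _ _); first exact: scons0.
  exact: sconsS.
exact: sconsS.
Qed.

Lemma extd2 (R : realType) n (M : manifold R n) (al : dform M 2) X Y Z :
  extd al (fam3 X Y Z) = X (al (fam2 Y Z)) - Y (al (fam2 X Z)) + Z (al (fam2 X Y))
   - al (fam2 (lie X Y) Z) + al (fam2 (lie X Z) Y) - al (fam2 (lie Y Z) X).
Proof.
rewrite /extd; under [X in _ + X]eq_bigr => i _ do rewrite big_mkcond /=.
rewrite !big_ord_recl !big_ord0 /= /bump /=.
rewrite !scons_fam2 /=.
rewrite !(congr1 al (fam2E (fun a : 'I_2 => fam3 X Y Z (@lift 3 _ a)))).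
rewrite /fam3 /=.
ring.
Qed.

Lemma extd3 (R : realType) n (M : manifold R n) (al : dform M 3) X Y Z W :
  extd al (fam4 X Y Z W) = X (al (fam3 Y Z W)) - Y (al (fam3 X Z W))
   + Z (al (fam3 X Y W)) - W (al (fam3 X Y Z))
   - al (fam3 (lie X Y) Z W) + al (fam3 (lie X Z) Y W) - al (fam3 (lie X W) Y Z)
   - al (fam3 (lie Y Z) X W) + al (fam3 (lie Y W) X Z) - al (fam3 (lie Z W) X Y).
Proof.
rewrite /extd; under [X in _ + X]eq_bigr => i _ do rewrite big_mkcond /=.
rewrite !big_ord_recl !big_ord0 /= /bump /=.
rewrite !scons_fam3 /=.
rewrite !(congr1 al (fam3E (fun a : 'I_3 => fam4 X Y Z W (@lift 4 _ a)))).
rewrite /fam4 /=.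
ring.
Qed.

Lemma Cinf_at (R : realType) n (M : manifold R n) (p : M) (f g : Cinf M) :
  f = g -> f p = g p.
Proof. by move=> ->. Qed.

Definition rows_det3 (A : pzRingType) (x y z : nat -> A) : A :=
  x 0%N * (y 1%N * z 2%N - y 2%N * z 1%N) - x 1%N * (y 0%N * z 2%N - y 2%N * z 0%N)
  + x 2%N * (y 0%N * z 1%N - y 1%N * z 0%N).

Section NormalForm.
Variables (R : realType) (M : manifold R 6) (om : dform M 2) (phi : dform M 3).
Variable K : vfield M -> vfield M.
Hypothesis nf : forall p, exists cd, normal_at om phi K p cd.
Implicit Types (A B C E W X Y Z : vfield M) (p : M).

Lemma cdD p cd (N : normal_at om phi K p cd) X Y i : cd (X + Y) i = cd X i + cd Y i.
Proof. by rewrite -{1}[X]scale1r (cd_lin N) Cinf1 mul1r. Qed.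

Lemma cd0 p cd (N : normal_at om phi K p cd) i : cd 0 i = 0.
Proof. by have := cdD N 0 0 i; rewrite addr0 => /eqP; rewrite addrC -subr_eq subrr => /eqP. Qed.

Lemma cdN p cd (N : normal_at om phi K p cd) X i : cd (- X) i = - cd X i.
Proof.
by rewrite -[- X]addr0 -scaleN1r (cd_lin N) (cd0 N) addr0 !CinfE mulN1r.
Qed.

Lemma cd_eq p cd (N : normal_at om phi K p cd) X Y :
  (forall i, (i < 6)%N -> cd X i = cd Y i) -> vat X p = vat Y p.
Proof.
move=> XY; have Z : vat (X - Y) p = (fun=> 0).
  by apply: (cd_inj N) => i i6; rewrite (cdD N) (cdN N) XY// subrr.
apply/funext => f; have := congr1 (@^~ f) Z.
by rewrite /vat vf_addE vf_oppE !CinfE => /subr0_eq.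
Qed.

Lemma K_linear (h : Cinf M) X Y : K (h *: X + Y) = h *: K X + K Y.
Proof.
apply: vfield_eq => p; have [cd N] := nf p; apply: (cd_eq N) => i i6.
by rewrite (cd_lin N) !(cd_K N)// (cd_lin N); case: ifP => _; ring.
Qed.

Lemma KD X Y : K (X + Y) = K X + K Y.
Proof. by rewrite -{1}[X]scale1r K_linear scale1r. Qed.

Lemma KN X : K (- X) = - K X.
Proof.
have K0 : K 0 = 0 by have := KD 0 0; rewrite addr0 => /eqP; rewrite addrC -subr_eq subrr => /eqP.
by rewrite -[- X]addr0 -scaleN1r K_linear K0 addr0 !scaleN1r.
Qed.

Lemma KK X : K (K X) = 0.
Proof.
apply: vfield_eq => p; have [cd N] := nf p; apply: (cd_inj N) => i i6.
rewrite (cd_K N)//; case: ifP => // oi.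
have i16 : (i.+1 < 6)%N by move: i6 oi; case: i => [|[|[|[|[|[|]]]]]].
by rewrite (cd_K N)//= oi /= mulr0.
Qed.

Local Notation om2 X Y := (om (fam2 X Y)).
Local Notation phi3 X Y Z := (phi (fam3 X Y Z)).

Lemma omC X Y : om2 X Y = - om2 Y X.
Proof.
by apply: Cinf_eqP => p; have [cd N] := nf p; rewrite CinfE !(cd_om N) /det2; ring.
Qed.

Lemma omDl X Y Z : om2 (X + Y) Z = om2 X Z + om2 Y Z.
Proof.
apply: Cinf_eqP => p; have [cd N] := nf p.
by rewrite CinfE !(cd_om N) /det2 !(cdD N); ring.
Qed.

Lemma omNl X Z : om2 (- X) Z = - om2 X Z.
Proof.
apply: Cinf_eqP => p; have [cd N] := nf p.
by rewrite CinfE !(cd_om N) /det2 !(cdN N); ring.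
Qed.

Lemma omZl (h : Cinf M) X Z : om2 (h *: X) Z = h * om2 X Z.
Proof.
apply: Cinf_eqP => p; have [cd N] := nf p.
rewrite CinfE !(cd_om N) /det2 -[h *: X]addr0 !(cd_lin N).
by rewrite !(cd0 N); ring.
Qed.

Lemma om_K_sym X Y : om2 X (K Y) = om2 Y (K X).
Proof.
apply: Cinf_eqP => p; have [cd N] := nf p.
by rewrite !(cd_om N) /det2 !(cd_K N)//=; ring.
Qed.

Lemma om_KK X Y : om2 (K X) (K Y) = 0.
Proof.
apply: Cinf_eqP => p; have [cd N] := nf p.
by rewrite Cinf0 (cd_om N) /det2 !(cd_K N)//=; ring. Qed.

Lemma om_nondeg X Y : (forall Z, om2 X Z = om2 Y Z) -> X = Y.
Proof.
move=> XY; apply: vfield_eq => p; have [cd N] := nf p.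
have H (x : nat -> R) : det2 (cd X) x 0 1 + det2 (cd X) x 2 3 + det2 (cd X) x 4 5 =
   det2 (cd Y) x 0 1 + det2 (cd Y) x 2 3 + det2 (cd Y) x 4 5.
  have [Z hZ] := cd_surj N x.
  have := congr1 (fun f : Cinf M => f p) (XY Z); rewrite /= !(cd_om N) /det2 !hZ//.
apply: (cd_eq N) => i i6.
pose d (j : nat) := fun a : nat => (a == j)%:R : R.
have := (H (d 0), H (d 1), H (d 2), H (d 3), H (d 4), H (d 5))%N.
rewrite /det2 /d /= !mulr0 !mulr1 => -[[[[[h0 h1] h2] h3] h4] h5].
by move: i6; case: i => [|[|[|[|[|[|]]]]]]//= _; move: h0 h1 h2 h3 h4 h5; lra.
Qed.

(** [Im K = ker K] is Lagrangian at [p], hence equal to its own [om]-orthogonal. *)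
Lemma K_eq0_om_at p U : (forall A, om2 U (K A) p = 0) -> vat (K U) p = (fun=> 0).
Proof.
move=> U0; have [cd N] := nf p.
have H (x : nat -> R) : cd U 1%N * x 1%N + cd U 3%N * x 3%N + cd U 5%N * x 5%N = 0.
  have [A hA] := cd_surj N x; apply: (mulfI (cd_kap N)).
  have := U0 A; rewrite (cd_om N) /det2 !(cd_K N)//= !hA// => E.
  by rewrite mulr0 -[RHS]oppr0 -[in RHS]E; ring.
pose d (j : nat) := fun a : nat => (a == j)%:R : R.
have := (H (d 1), H (d 3), H (d 5))%N.
rewrite /d /= !mulr0 !mulr1 => -[[h1 h3] h5].
apply: (cd_inj N) => i i6; rewrite (cd_K N)//.
by move: i6; case: i => [|[|[|[|[|[|]]]]]]//= _; move: h1 h3 h5;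
  rewrite ?addr0 ?add0r => h1 h3 h5; rewrite ?h1 ?h3 ?h5 mulr0.
Qed.

Lemma K_eq0_om U : (forall A, om2 U (K A) = 0) -> K U = 0.
Proof.
by move=> U0; apply: vfield_eq => p; apply: K_eq0_om_at => A; rewrite U0.
Qed.

Lemma ker_odd_coord p cd (N : normal_at om phi K p cd) X i :
  vat (K X) p = (fun=> 0) -> (i < 6)%N -> odd i -> cd X i = 0.
Proof.
move=> KX0; have KX0' : cd (K X) = cd 0 by apply: (cd_vat N); rewrite KX0.
case: i => // i i6 oi; apply: (mulfI (cd_kap N)).
have := congr1 (@^~ i) KX0'; rewrite /= (cd0 N) (cd_K N) 1?ltnW//.
by rewrite -[odd i]negbK -/(odd i.+1) oi /= => ->; rewrite mulr0.
Qed.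

Lemma tangent_lift p X : vat (K X) p = (fun=> 0) -> exists A, vat (K A) p = vat X p.
Proof.
move=> KX0; have [cd N] := nf p.
(* Each even coordinate of [X], shifted up by one and divided by [kap], undoes [cd_K]; the odd
   coordinates of [X] vanish. *)
have [A hA] := cd_surj N (fun i => (kap R)^-1 * cd X i.-1).
exists A; apply: (cd_eq N) => i i6; rewrite (cd_K N)//.
case: ifPn => oi; first by rewrite (ker_odd_coord N KX0).
have i16 : (i.+1 < 6)%N by move: i6 oi; case: i => [|[|[|[|[|[|]]]]]].
by rewrite hA//= mulrA divff ?mul1r// (cd_kap N).
Qed.

Lemma phi_nondeg U : (forall C E, phi3 U C E = 0) -> U = 0.
Proof.
move=> U0; apply: vfield_eq => p; have [cd N] := nf p.
have H (c e : nat -> R) : det3 (cd U) c e 0 3 5 + det3 (cd U) c e 1 2 5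
    + det3 (cd U) c e 1 3 4 = 0.
  have [[C hC] [E hE]] := (cd_surj N c, cd_surj N e).
  have := congr1 (fun f : Cinf M => f p) (U0 C E).
  by rewrite /= (cd_phi N) /det3 /det2 !hC// !hE.
apply: (cd_inj N) => i i6.
pose d (j : nat) := fun a : nat => (a == j)%:R : R.
have := (H (d 3) (d 5), H (d 0) (d 5), H (d 0) (d 3), H (d 2) (d 5), H (d 1) (d 5),
  H (d 1) (d 3))%N.
rewrite /det3 /det2 /d /= !mulr0 !mulr1 => -[[[[[h0 h1] h2] h3] h4] h5].
by move: i6; case: i => [|[|[|[|[|[|]]]]]]//= _; move: h0 h1 h2 h3 h4 h5; lra.
Qed.

Hypothesis dom : extd om = (fun=> 0).
Hypothesis dphi : extd phi = (fun=> 0).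
Hypothesis dF : extd (Fform K phi) = (fun=> 0).

(** Each monomial of [phi] has exactly one index among the three directions of [ker K]. *)
Lemma phi_KK A B C : phi3 (K A) (K B) C = 0.
Proof.
apply: Cinf_eqP => p; have [cd N] := nf p.
by rewrite Cinf0 (cd_phi N) /det3 /det2 !(cd_K N)//=; ring.
Qed.

Lemma FformE A B C : Fform K phi (fam3 A B C) = - 2%:R * phi3 (K A) B C.
Proof.
rewrite /Fform; congr (_ * phi _); rewrite [LHS]fam3E.
by congr (fam3 _ _ _).
Qed.

Lemma vf_2 X (f : Cinf M) : X (- 2%:R * f) = - 2%:R * X f.
Proof.
have E (g : Cinf M) : - 2%:R * g = (- 2%:R : R) *: g.
  by rewrite scaleNr scaler_nat mulNr mulr_natl.
by rewrite !E vfZ.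
Qed.

(** This is why [Fform] is alternating although it puts [K] in the first slot: [K] may be moved to
    any slot of [phi]. *)
Lemma phi_K_rot A B C : phi3 (K A) B C = phi3 (K B) C A.
Proof.
apply: Cinf_eqP => p; have [cd N] := nf p.
by rewrite !(cd_phi N) /det3 /det2 !(cd_K N)//=; ring.
Qed.

Lemma phi_alt12 A B C : phi3 A B C = - phi3 B A C.
Proof.
by apply: Cinf_eqP => p; have [cd N] := nf p; rewrite CinfE !(cd_phi N) /det3 /det2; ring.
Qed.

Lemma phi_alt23 A B C : phi3 A B C = - phi3 A C B.
Proof.
by apply: Cinf_eqP => p; have [cd N] := nf p; rewrite CinfE !(cd_phi N) /det3 /det2; ring.
Qed.

Lemma phi_alt13 A B C : phi3 A B C = - phi3 C B A.
Proof.
by apply: Cinf_eqP => p; have [cd N] := nf p; rewrite CinfE !(cd_phi N) /det3 /det2; ring.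
Qed.

Lemma phiDl A A' B C : phi3 (A + A') B C = phi3 A B C + phi3 A' B C.
Proof.
apply: Cinf_eqP => p; have [cd N] := nf p.
by rewrite CinfE !(cd_phi N) /det3 /det2 !(cdD N); ring.
Qed.

Lemma phiNl A B C : phi3 (- A) B C = - phi3 A B C.
Proof.
apply: Cinf_eqP => p; have [cd N] := nf p.
by rewrite CinfE !(cd_phi N) /det3 /det2 !(cdN N); ring.
Qed.

Lemma phi3_0 B C : phi3 0 B C = 0.
Proof. by have := phiDl 0 0 B C; rewrite addr0 => /eqP; rewrite addrC -subr_eq subrr => /eqP. Qed.

(* Closedness of F(phi) says that F(phi) is invariant along ker K. *)
Lemma lie_derivative_F A B C E : (K A) (phi3 (K B) C E) =
  phi3 (K (lie (K A) B)) C E + phi3 (K B) (lie (K A) C) E + phi3 (K B) C (lie (K A) E).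
Proof.
have := congr1 (fun al : dform M 4 => al (fam4 (K A) B C E)) dF.
rewrite /= extd3 !FformE !vf_2 KK !phi3_0 !vf0.
have Z U V : phi3 (K U) (K A) V = 0 by exact: phi_KK.
rewrite !Z => H; apply: Cinf_eqP => p.
have := Cinf_at p H.
rewrite (phi_K_rot (lie (K A) C)) (phi_alt23 (K B) E) (phi_K_rot (lie (K A) E)).
by rewrite !CinfE; lra.
Qed.

(** In [extd phi] on [K A, K B, C, E], the terms with [K] in two slots drop out and
    [lie_derivative_F] gives the derivatives; what remains is [phi] of the difference of the two
    sides, with [C] and [E]. Since [K] squares to zero, this is the vanishing of the Nijenhuis
    tensor; it also says that [D] is torsion-free. *)
Lemma nijenhuis A B : lie (K A) (K B) = K (lie (K A) B) - K (lie (K B) A).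
Proof.
suff E : K (lie (K A) B) - K (lie (K B) A) - lie (K A) (K B) = 0.
  by apply/esym/subr0_eq.
apply: phi_nondeg => C E; rewrite !phiDl !phiNl.
have := congr1 (fun al : dform M 4 => al (fam4 (K A) (K B) C E)) dphi.
rewrite /= extd3 !phi_KK !vf0 !lie_derivative_F.
rewrite (phi_alt13 (lie C E)) (phi_alt12 (K B) (K A)) !phi_KK.
rewrite (phi_alt12 (lie (K A) C)) (phi_alt12 (lie (K B) C)).
rewrite (phi_alt12 (lie (K A) E)) (phi_alt12 (lie (K B) E)).
rewrite (phi_alt23 (K B) (lie (K A) E)) (phi_alt23 (K A) (lie (K B) E)).
move=> H; apply: Cinf_eqP => p.
have := Cinf_at p H.
by rewrite !CinfE; lra.
Qed.

(** * The Bott connection along [ker K] and its cubic form *)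

Variable nB : vfield M -> vfield M -> vfield M.
Hypothesis bott : is_Bott om K nB.

Lemma bottE A B Z :
  om2 (nB (K A) (K B)) Z = (K A) (om2 (K B) Z) + om2 (lie (K A) Z) (K B).
Proof. by have := bott Z (KK A) (KK B); rewrite /eval2 -!fam2_scons. Qed.

(** Against [K C], [bottE] leaves only the bracket of [K A] and [K C] paired with [K B]; by
    [nijenhuis] that bracket lies in [Im K], which is isotropic. *)
Lemma bott_tangent A B : K (nB (K A) (K B)) = 0.
Proof.
apply: K_eq0_om => C; rewrite bottE om_KK vf0 add0r nijenhuis.
by rewrite -KN -KD om_KK.
Qed.

Lemma bott_torsion A B : nB (K A) (K B) - nB (K B) (K A) = lie (K A) (K B).
Proof.
apply: om_nondeg => Z; rewrite omDl omNl !bottE.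
have := congr1 (fun al : dform M 3 => al (fam3 (K A) (K B) Z)) dom.
rewrite /= extd2 om_KK vf0 => H.
apply: Cinf_eqP => p; have := Cinf_at p H.
by rewrite !CinfE; lra.
Qed.

Lemma bott_tangentE X Y Z : K X = 0 -> K Y = 0 ->
  om2 (nB X Y) Z = X (om2 Y Z) + om2 (lie X Z) Y.
Proof. by move=> X0 Y0; have := bott Z X0 Y0; rewrite /eval2 -!fam2_scons. Qed.

Lemma lie_tangent A B : K (lie (K A) (K B)) = 0.
Proof. by rewrite nijenhuis KD KN !KK subr0. Qed.

Lemma lie_jacobi X Y Z : lie (lie X Y) Z = lie X (lie Y Z) - lie Y (lie X Z).
Proof.
apply/val_inj/funext => f.
rewrite -[LHS]/(lie (lie X Y) Z f) -[RHS]/((lie X (lie Y Z) - lie Y (lie X Z)) f).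
by rewrite vf_addE vf_oppE !lieE !vfB; ring.
Qed.

(** Under the pairing with [om], [nB] acts as a Lie derivative, so its curvature reduces to the
    Jacobi identity. The formula can be iterated because derivatives and brackets stay in [ker K]
    ([bott_tangent], [lie_tangent]). *)
Lemma bott_flat A B C : nB (K A) (nB (K B) (K C)) - nB (K B) (nB (K A) (K C)) =
  nB (lie (K A) (K B)) (K C).
Proof.
apply: om_nondeg => Z; rewrite omDl omNl.
rewrite !(bott_tangentE _ (KK _) (bott_tangent _ _)) (bott_tangentE _ (lie_tangent _ _) (KK _)).
rewrite !bottE !vfD lieE lie_jacobi omDl omNl.
rewrite ![om2 (lie _ _) (nB _ _)]omC !bottE.
rewrite [om2 (K C) (lie (K A) Z)]omC [om2 (K C) (lie (K B) Z)]omC !vfN.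
by ring.
Qed.

(* Duality of [nB] and [D_(K A)(K W) = K [K A, W]] for [g (K W) (K Z) = om2 W (K Z)]. *)
Lemma bott_duality A W Z : (K A) (om2 W (K Z)) =
  om2 (lie (K A) W) (K Z) + om2 W (nB (K A) (K Z)).
Proof.
rewrite [om2 W (nB _ _)]omC bottE [om2 (K Z) W]omC vfN; ring.
Qed.

(** The [nB]-covariant derivative of the metric, one term of the product rule being cancelled by
    [bott_duality]; equally, the difference of [D] and [nB] with an index lowered. *)
Definition cubic A W V : Cinf M := om2 (lie (K A) W) (K V) - om2 V (nB (K A) (K W)).

(** [D] and [nB] are both torsion-free ([nijenhuis], [bott_torsion]), so their difference is
    symmetric. *)
Lemma cubic_sym A W V : cubic A W V = cubic W A V.
Proof.
have E1 := congr1 (fun U => om2 V U) (nijenhuis A W).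
have E2 := congr1 (fun U => om2 V U) (bott_torsion A W).
have D X Y Z : om2 X (Y - Z) = om2 X Y - om2 X Z.
  by rewrite omC omDl omNl [om2 Y X]omC [om2 Z X]omC; ring.
move: E1 E2; rewrite /= /cubic !D ![om2 V (K _)]om_K_sym => E1 E2.
apply: Cinf_eqP => p; move: (Cinf_at p E1) (Cinf_at p E2).
by rewrite !CinfE; lra.
Qed.

Local Notation vol A B C := (phi3 (K A) B C).

(** [om V (K W)] is [- kap] times the scalar product of the odd coordinates, and [vol] is, up to
    sign, [kap] times their determinant; [(- kap) ^+ 3] against [kap ^+ 2] leaves [- kap]. *)
Lemma gram_det3 V0 V1 V2 (W : nat -> vfield M) :
  rows_det3 (fun j => om2 V0 (K (W j))) (fun j => om2 V1 (K (W j)))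
      (fun j => om2 V2 (K (W j))) =
  (- kap R) *: (vol V0 V1 V2 * vol (W 0%N) (W 1%N) (W 2%N)).
Proof.
apply: Cinf_eqP => p; have [cd N] := nf p.
rewrite /rows_det3 !CinfE !(cd_om N) !(cd_phi N) /det3 /det2 !(cd_K N)//=; ring.
Qed.

(* The volume form is parallel for [D], and its square is the determinant of the
   metric: the cubic form is trace-free. *)
Lemma cubic_trace_free A (W : nat -> vfield M) :
  let r i j := om2 (W i) (K (W j)) in let T i j := cubic A (W i) (W j) in
  rows_det3 (T 0%N) (r 1%N) (r 2%N) + rows_det3 (r 0%N) (T 1%N) (r 2%N)
    + rows_det3 (r 0%N) (r 1%N) (T 2%N) = 0.
Proof.
move=> r T.
pose d i j := om2 (lie (K A) (W i)) (K (W j)).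
pose b i j := om2 (W i) (nB (K A) (K (W j))).
have rE i j : (K A) (r i j) = d i j + b i j by exact: bott_duality.
have TE i j : T i j = d i j - b j i by [].
have rs i j : r i j = r j i by exact: om_K_sym.
(* The derivative of the Gram determinant is computed twice: row by row through duality, and through
   [vol], where each of the two equal factors contributes the same sum. *)
have H : rows_det3 (fun j => d 0%N j + b 0%N j) (r 1%N) (r 2%N)
    + rows_det3 (r 0%N) (fun j => d 1%N j + b 1%N j) (r 2%N)
    + rows_det3 (r 0%N) (r 1%N) (fun j => d 2%N j + b 2%N j)
  = 2%:R * (rows_det3 (d 0%N) (r 1%N) (r 2%N) + rows_det3 (r 0%N) (d 1%N) (r 2%N)
    + rows_det3 (r 0%N) (r 1%N) (d 2%N)).
  transitivity ((K A) (rows_det3 (r 0%N) (r 1%N) (r 2%N))).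
    by rewrite /rows_det3 !(vfD, vfN, vfM) !rE; ring.
  rewrite !gram_det3 vfZ vfM lie_derivative_F.
  by apply: Cinf_eqP => p; rewrite !CinfE; ring.
(* [T] contains [b] transposed. Because [r] is symmetric, so is its adjugate, and transposing [b]
   does not change the sum. *)
have E : rows_det3 (T 0%N) (r 1%N) (r 2%N) + rows_det3 (r 0%N) (T 1%N) (r 2%N)
    + rows_det3 (r 0%N) (r 1%N) (T 2%N) =
  2%:R * (rows_det3 (d 0%N) (r 1%N) (r 2%N) + rows_det3 (r 0%N) (d 1%N) (r 2%N)
    + rows_det3 (r 0%N) (r 1%N) (d 2%N)) -
  (rows_det3 (fun j => d 0%N j + b 0%N j) (r 1%N) (r 2%N)
    + rows_det3 (r 0%N) (fun j => d 1%N j + b 1%N j) (r 2%N)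
    + rows_det3 (r 0%N) (r 1%N) (fun j => d 2%N j + b 2%N j)).
  rewrite /rows_det3 !TE (rs 1%N 0%N) (rs 2%N 0%N) (rs 2%N 1%N); ring.
by rewrite E H subrr.
Qed.

End NormalForm.

(** * Fields related by a smooth map *)

Section LocalSmooth.
Variables (R : realType) (n : nat) (M : manifold R n).

Lemma near_chart (c : chart R n M) (q : M) (P : M -> Prop) : is_chart c -> ch_dom c q ->
  (\forall r \near q, P r) ->
  \forall z \near ch_to c q, ch_img c z /\ P (ch_from c z).
Proof.
move=> Cc dq nP; have [_ oi Kc _ cf] := Cc.
have Iq := ch_img_to dq.
have nI : nbhs (ch_to c q) (ch_img c) by exact: open_nbhs_nbhs.
have nP' : nbhs (ch_from c (ch_to c q)) P by rewrite Kc.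
exact: filterI nI (cf _ Iq _ nP').
Qed.

Lemma near_smooth_pred (f : M -> R) :
  (forall q : M, exists g : Cinf M, \forall r \near q, f r = g r) ->
  f \in @smooth_pred R n M.
Proof.
move=> H; apply/asboolP => c Ac k; apply: Ck_local => y Iy.
have Cc := mf_charts Ac; have [dy toK] := ch_fromK Cc Iy.
have [g fg] := H (ch_from c y).
have := near_chart Cc dy fg; rewrite toK => nz.
exists [set z | ch_img c z /\ f (ch_from c z) = g (ch_from c z)]° => //.
have oV := @open_interior _ [set z | ch_img c z /\ f (ch_from c z) = g (ch_from c z)].
have sub z : [set z | ch_img c z /\ f (ch_from c z) = g (ch_from c z)]° z ->
    ch_img c z /\ f (ch_from c z) = g (ch_from c z) by move=> /interior_subset.
apply: (Ck_eq (f := g \o ch_from c)) => //.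
  by move=> z /sub[_ /= ->].
apply: Ck_sub (smooth_in_chart g k (atlas_smooth_chart Ac)).
by move=> z /sub[].
Qed.

Lemma Cinf_continuous (f : Cinf M) (q : M) : {for q, continuous f}.
Proof.
have [c Ac dq] := mf_cover q; have [od oi Kc ct _] := mf_charts Ac.
have E : \forall r \near q, ((f \o ch_from c) \o ch_to c) r = f r.
  by apply: filterS (open_nbhs_nbhs (conj od dq)) => r dr /=; rewrite Kc.
have := smooth_in_chart f 0 (atlas_smooth_chart Ac) => -[cf _].
have C : {for q, continuous ((f \o ch_from c) \o ch_to c)}.
  by apply: continuous_comp; [exact: ct|apply: cf; exact: ch_img_to].
rewrite /prop_for /continuous_at -(nbhs_singleton E).
exact: (cvg_trans (near_eq_cvg E) C).
Qed.

Lemma Cinf_local_inverse (h : Cinf M) (q : M) : h q != 0 ->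
  exists k : Cinf M, \forall r \near q, h r * k r = 1.
Proof.
move=> hq; pose e := h q ^+ 2 / 2.
have e0 : 0 < e by rewrite divr_gt0// exprn_even_gt0.
(* [den] never vanishes and agrees with [t ^+ 2] once [t ^+ 2 >= e], so [h / den h] is a global
   smooth function equal to the inverse of [h] near [q]. *)
pose den (t : R) := t ^+ 2 + flat_fun 1 (e - t ^+ 2).
have den0 t : den t != 0.
  rewrite gt_eqF// /den; have [te|te] := ltP (t ^+ 2) e.
    by rewrite ltr_wpDl ?sqr_ge0// flat1_gt0// subr_gt0.
  by rewrite ltr_pwDl ?flat1_ge0// (lt_le_trans e0).
have sm : (fun r => h r / den (h r)) \in @smooth_pred R n M.
  apply/asboolP => c Ac k; have oi : open (ch_img c) by have [] := mf_charts Ac.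
  have Ch := smooth_in_chart h k (atlas_smooth_chart Ac).
  have C2 : Ck k (ch_img c) (fun z => h (ch_from c z) ^+ 2) by exact: (CkM oi Ch Ch).
  apply: (CkM oi Ch); apply: (Ck_inv oi) => [x _|]; first exact: den0.
  apply: (CkD oi C2).
  apply: (@Ck_flat_comp R n k _ (fun z => e - h (ch_from c z) ^+ 2) 1 oi).
  apply: (Ck_eq (f := cst e + cst (-1) * (fun z => h (ch_from c z) ^+ 2))) => //.
    by move=> x _; rewrite !fctE /cst mulN1r.
  by apply: CkD => //; [exact: Ck_cst|apply: CkM => //; exact: Ck_cst].
exists (MkCinf sm).
have C2 : {for q, continuous (fun r => h r ^+ 2)}.
  by apply: (@continuousM _ _ h h); exact: Cinf_continuous.
have nh : \forall r \near q, e < h r ^+ 2.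
  have lt : e < h q ^+ 2 by rewrite gtr_pMr ?exprn_even_gt0// invf_lt1// ltr1n.
  exact: (C2 _ (lt_nbhsr lt)).
apply: filterS nh => r hr /=.
have E : den (h r) = h r ^+ 2 by rewrite /den flat_le0 ?addr0// subr_le0 ltW.
have h0 : h r != 0.
  by apply/eqP => h0; move: hr; rewrite h0 expr0n /= ltNge ltW.
by rewrite E; field.
Qed.

Lemma Cinf_det k (P : 'M[Cinf M]_k) (q : M) :
  (\det P) q = \det (\matrix_(i, j) P i j q).
Proof.
rewrite /determinant Cinf_sum; apply: eq_bigr => s _.
transitivity (((-1) ^+ s : Cinf M) q * (\prod_i P i (s i)) q) => //.
congr (_ * _); first by case: (odd_perm s); rewrite ?expr1 ?expr0 ?CinfN ?Cinf1.
by rewrite Cinf_prod; apply: eq_bigr => i _; rewrite mxE.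
Qed.

End LocalSmooth.

Section Pushforward.
Variables (R : realType) (m n : nat) (L : manifold R m) (M : manifold R n) (io : smap L M).

Lemma pushv_tangent q v : tangent q v -> tangent (io q) (pushv io v).
Proof.
move=> [lv mv]; split=> [a f g|f g]; rewrite /pushv.
  by rewrite -lv; congr v; apply/val_inj/funext.
rewrite -[f (io q)]/(pull io f q) -[g (io q)]/(pull io g q) -mv; congr v.
exact/val_inj/funext.
Qed.

Lemma relatedP X' X : related io X' X <->
  forall f : Cinf M, X' (pull io f) = pull io (X f).
Proof.
split=> [rel f|H q]; last by apply/funext => f; rewrite /pushv /vat H.
by apply: Cinf_eqP => q; exact: (congr1 (@^~ f) (rel q)).
Qed.

Lemma related_lie X' X Y' Y : related io X' X -> related io Y' Y ->
  related io (lie X' Y') (lie X Y).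
Proof.
move=> /relatedP rX /relatedP rY; apply/relatedP => f.
rewrite lieE rX rY rX rY lieE; exact/val_inj/funext.
Qed.

Lemma related_add X' X Y' Y : related io X' X -> related io Y' Y ->
  related io (X' + Y') (X + Y).
Proof.
move=> /relatedP rX /relatedP rY; apply/relatedP => f.
rewrite !vf_addE rX rY; exact/val_inj/funext.
Qed.

Lemma related_opp X' X : related io X' X -> related io (- X') (- X).
Proof.
move=> /relatedP rX; apply/relatedP => f.
rewrite !vf_oppE rX; exact/val_inj/funext.
Qed.

Lemma pullD f g : pull io (f + g) = pull io f + pull io g.
Proof. exact/val_inj/funext. Qed.

Lemma pullN f : pull io (- f) = - pull io f.
Proof. exact/val_inj/funext. Qed.

Hypothesis inj : forall q, {in tangent q &, injective (pushv io)}.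

Lemma pushv_inj q v w : tangent q v -> tangent q w -> pushv io v = pushv io w -> v = w.
Proof. by move=> tv tw E; apply: (@inj q v w _ _ E); exact: mem_set. Qed.

Lemma related_eq X' Y' X : related io X' X -> related io Y' X -> X' = Y'.
Proof.
move=> rX rY; apply: vfield_eq => q.
by apply: (@pushv_inj q); [exact: vat_tangent|exact: vat_tangent|rewrite rX rY].
Qed.

Hypothesis spanL : forall q : L, spanned q.
Hypothesis spanM : forall p : M, spanned p.

(* The components of the field to be constructed solve a linear system with smooth
   coefficients, so smoothness follows from Cramer's rule. *)
Lemma related_exists X : (forall q, exists2 v, tangent q v & pushv io v = vat X (io q)) ->
  exists X', related io X' X.
Proof.
move=> HX.
have /choice[v hv] : forall q, exists v, tangent q v /\ pushv io v = vat X (io q).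
  by move=> q; have [v tv pv] := HX q; exists v.
have tv q : tangent q (v q) by have [] := hv q.
have pv q : pushv io (v q) = vat X (io q) by have [] := hv q.
have sm f : (fun q => v q f) \in @smooth_pred R m L.
  apply: near_smooth_pred => q.
  have [c Ac dq] := mf_cover q; have Sc := atlas_smooth_chart Ac.
  have [E [y nE]] := local_frame spanL Sc dq.
  have [c' Ac' dp] := mf_cover (io q); have Sc' := atlas_smooth_chart Ac'.
  have [F [z /nbhs_singleton[_ _ _ zM]]] := local_frame spanM Sc' dp.
  have [_ _ Ey Ev] := nbhs_singleton nE.
  pose B := \matrix_(i < m, a < n) E i (pull io (z a)) q.
  have fB : row_free B.
    rewrite -kermx_eq0; apply/eqP/row_matrixP => l; rewrite row0.
    set b := row l _.
    have bB : b *m B = 0 by rewrite -row_mul mulmx_ker row0.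
    pose w (g : Cinf L) := \sum_(i < m) b 0 i * vat (E i) q g.
    have tw : tangent q w by apply: tangent_sum => i; exact: vat_tangent.
    have pw0 : pushv io w = pushv io (fun=> 0).
      apply/funext => g; rewrite (zM _ (pushv_tangent tw)) big1// => a _.
      have /matrixP/(_ 0 a) := bB; rewrite !mxE => Ea.
      have -> : pushv io w (z a) = 0.
        by rewrite -[RHS]Ea; apply: eq_bigr => i _; rewrite [B _ _]mxE.
      by rewrite mul0r.
    have w0 := pushv_inj tw (tangent0 q) pw0.
    apply/rowP => j; rewrite [RHS]mxE -[RHS]/((fun=> 0) (y j)) -w0 /w (bigD1 j)//=.
    rewrite /vat Ey eqxx mulr1 big1 ?addr0// => i /negPf ij.
    by rewrite Ey ij mulr0.
  (* A right inverse of [B] selects functions [h j] on [M] whose pullbacks are dual to the frame [E]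
     at [q]. The matrix [P] is then the identity at [q], and invertible nearby. *)
  have /row_freeP[C BC] := fB.
  pose h j : Cinf M := \sum_(a < n) C a j *: z a.
  pose P : 'M[Cinf L]_m := \matrix_(i, j) E i (pull io (h j)).
  have Eh r j (w : Cinf L -> R) : tangent r w -> w (pull io (h j)) =
      \sum_(a < n) C a j * w (pull io (z a)).
    move=> tw; have := tangent_fsum (fun a => C a j *: z a) (pushv_tangent tw).
    rewrite /pushv => ->; apply: eq_bigr => a _.
    exact: (tangentZ _ _ (pushv_tangent tw)).
  have P1 i j : P i j q = (i == j)%:R.
    rewrite mxE -[LHS]/(vat (E i) q (pull io (h j))) (Eh q)//; last exact: vat_tangent.
    have /matrixP/(_ i j) := BC; rewrite !mxE => <-.
    by apply: eq_bigr => a _; rewrite mxE mulrC.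
  have detP : (\det P) q = 1.
    rewrite Cinf_det (_ : \matrix_(i, j) P i j q = 1%:M) ?det1//.
    by apply/matrixP => i j; rewrite [RHS]mxE -P1 [LHS]mxE.
  have [k hk] : exists k : Cinf L, \forall r \near q, (\det P) r * k r = 1.
    by apply: Cinf_local_inverse; rewrite detP oner_neq0.
  exists (\sum_(i < m) (\sum_(j < m) pull io (X (h j)) * (\adj P) j i * k) * E i f).
  apply: filterS (filterI nE hk) => r [[_ _ _ sp] kr].
  rewrite (sp _ (tv r)) Cinf_sum; apply: eq_bigr => i _.
  rewrite CinfM Cinf_sum; congr (_ * _).
  have W j : (pull io (X (h j))) r = \sum_(l < m) v r (y l) * P l j r.
    have -> : pull io (X (h j)) r = pushv io (v r) (h j) by rewrite pv.
    by rewrite /pushv (sp _ (tv r)); apply: eq_bigr => l _; rewrite mxE.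
  under eq_bigr => j _ do rewrite !CinfM W.
  rewrite -big_distrl /=.
  under eq_bigr => j _ do rewrite big_distrl /=.
  rewrite exchange_big /=.
  have A l : \sum_(j < m) P l j r * (\adj P) j i r = (\det P) r *+ (l == i).
    have /matrixP/(_ l i) := mul_mx_adj P; rewrite !mxE => /(congr1 (fun f : Cinf L => f r)).
    rewrite Cinf_sum => E1; transitivity ((\det P *+ (l == i)) r).
      by rewrite -E1; apply: eq_bigr => j _; rewrite CinfM mxE.
    by case: (l == i).
  under eq_bigr => l _.
    under eq_bigr => j _ do rewrite -mulrA.
    rewrite -big_distrr /= A.
    over.
  rewrite (bigD1 i)//= eqxx big1 ?addr0 => [|l /negPf ->]; last by rewrite mulr0.
  by rewrite mulr1n -mulrA kr mulr1.
have dX : (fun f => MkCinf (sm f)) \in @deriv_pred R m L.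
  apply/asboolP; split=> [a f g|f g]; apply: Cinf_eqP => q; have [l mm] := tv q.
    by rewrite !CinfE /= l.
  by rewrite !CinfE /= mm.
exists (MkVfield dX) => q; rewrite -pv; exact/funext.
Qed.

End Pushforward.

(** * The induced structure on a leaf *)

(** The three covectors of even index (counted from 0) are pulled back to [L]. On [ker K] the odd
    coordinates vanish, so these three separate the tangent vectors of the leaf. *)
Lemma leaf_spanned (R : realType) (M : manifold R 6) (om : dform M 2) (phi : dform M 3)
    (K : vfield M -> vfield M) (L : manifold R 3) (io : smap L M) :
  (forall p, exists e, cotangent_basis p e /\ normal_at om phi K p (cov_coord p e)) ->
  integral_leaf K io -> forall q : L, spanned q.
Proof.
move=> nfe [_ _ _ inj im] q c Sc dq.
have [e [be N]] := nfe (io q).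
have nf p : exists cd, normal_at om phi K p cd by have [e' []] := nfe p; exists (cov_coord p e').
apply: (partials_span (e := fun (i : 'I_3) w => e (inord i.*2) (pushv io w)) Sc dq).
  by move=> i a v w tv tw; apply: (be.1 (inord i.*2) a); exact: pushv_tangent.
move=> w tw w0.
have [X wX KX0] : leafdist K (io q) (pushv io w) by rewrite -im; exists w.
apply: (pushv_inj inj tw (tangent0 q)).
have X0 : vat X (io q) = (fun=> 0).
  apply: (cd_inj N) => i i6; have [oi|ei] := boolP (odd i).
    exact: (ker_odd_coord N KX0).
  have := w0 (inord i./2); rewrite wX inordK; last first.
    by move: i6 ei; case: i => [|[|[|[|[|[|]]]]]].
  by rewrite even_halfK.
by rewrite wX X0.
Qed.

Section Leaf.
Variables (R : realType) (M : manifold R 6) (om : dform M 2) (phi : dform M 3).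
Variables (K : vfield M -> vfield M) (nB : vfield M -> vfield M -> vfield M).
Hypothesis nf : forall p, exists cd, normal_at om phi K p cd.
Hypothesis spanM : forall p : M, spanned p.
Hypotheses (dom : extd om = (fun=> 0)) (dphi : extd phi = (fun=> 0))
  (dF : extd (Fform K phi) = (fun=> 0)).
Hypothesis bott : is_Bott om K nB.
Variables (L : manifold R 3) (io : smap L M).
Hypothesis spanL : forall q : L, spanned q.
Hypothesis leafL : integral_leaf K io.
Variable gL : vfield L -> vfield L -> Cinf L.
Hypothesis gP : is_leaf_metric om K io gL.
Variable nBL : vfield L -> vfield L -> vfield L.
Hypothesis nBLP : induced_connection K io nB nBL.

Local Notation om2 X Y := (om (fam2 X Y)).
Implicit Types (A B C W : vfield M) (X Y Z : vfield L) (q : L).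

Let inj : forall q, {in tangent q &, injective (pushv io)}.
Proof. by case: leafL. Qed.

Lemma leaf_lift v q : tangent q v -> exists A, vat (K A) (io q) = pushv io v.
Proof.
move=> tv; have [_ _ _ _ im] := leafL.
have [X vX KX0] : leafdist K (io q) (pushv io v) by rewrite -im; exists v.
by have [A KA] := tangent_lift nf KX0; exists A; rewrite KA.
Qed.

Lemma leaf_related A : exists X, related io X (K A).
Proof.
apply: related_exists => // q; have [_ _ _ _ im] := leafL.
have : leafdist K (io q) (vat (K A) (io q)).
  by exists (K A) => //; rewrite (KK nf).
by rewrite -im => -[v tv vE]; exists v.
Qed.

Lemma leaf_related_at X q : exists A X', related io X' (K A) /\ vat X' q = vat X q.
Proof.
have [A KA] := leaf_lift (vat_tangent X q).
have [X' rX'] := leaf_related A; exists A, X'; split=> //.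
by apply: (pushv_inj inj (vat_tangent X' q) (vat_tangent X q)); rewrite rX'.
Qed.

Definition tensor_lin (T : vfield L -> Cinf L) :=
  forall (h : Cinf L) X Y, T (h *: X + Y) = h * T X + T Y.

(** Fields related to some [K A] attain every tangent vector of the leaf, so a tensorial identity
    may be tested on them; no field on [L] has to be extended to [M]. *)
Lemma tensor1_eq0 (T : vfield L -> Cinf L) : tensor_lin T ->
  (forall X A, related io X (K A) -> T X = 0) -> forall X, T X = 0.
Proof.
move=> lT T0 X; apply: Cinf_eqP => q; have [A [X' [rX XX]]] := leaf_related_at X q.
by rewrite -(tensor_eq spanL lT XX) (T0 X' A).
Qed.

Lemma tensor2_eq0 (T : vfield L -> vfield L -> Cinf L) :
  (forall Y, tensor_lin (T^~ Y)) -> (forall X, tensor_lin (T X)) ->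
  (forall X Y A B, related io X (K A) -> related io Y (K B) -> T X Y = 0) ->
  forall X Y, T X Y = 0.
Proof.
move=> l1 l2 T0 X Y; apply: (tensor1_eq0 (T := T^~ Y)) => // X' A rX.
by apply: (tensor1_eq0 (T := T X')) => // Y' B; exact: T0.
Qed.

Lemma tensor3_eq0 (T : vfield L -> vfield L -> vfield L -> Cinf L) :
  (forall Y Z, tensor_lin (fun X => T X Y Z)) ->
  (forall X Z, tensor_lin (fun Y => T X Y Z)) -> (forall X Y, tensor_lin (T X Y)) ->
  (forall X Y Z A B C, related io X (K A) -> related io Y (K B) -> related io Z (K C) ->
     T X Y Z = 0) ->
  forall X Y Z, T X Y Z = 0.
Proof.
move=> l1 l2 l3 T0 X Y Z; apply: (tensor1_eq0 (T := fun X => T X Y Z)) => // X' A rX.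
apply: (tensor2_eq0 (T := T X')) => // Y' Z' B C; exact: T0.
Qed.

Lemma vfield_tensor2_eq0 (T : vfield L -> vfield L -> vfield L) :
  (forall Y (h : Cinf L) X X', T (h *: X + X') Y = h *: T X Y + T X' Y) ->
  (forall X (h : Cinf L) Y Y', T X (h *: Y + Y') = h *: T X Y + T X Y') ->
  (forall X Y A B, related io X (K A) -> related io Y (K B) -> T X Y = 0) ->
  forall X Y, T X Y = 0.
Proof.
move=> l1 l2 T0 X Y; apply/val_inj/funext => f.
apply: (tensor2_eq0 (T := fun X Y => T X Y f)) => [Z h U V|Z h U V|U V A B rU rV].
- by rewrite l1.
- by rewrite l2.
- by rewrite (T0 U V A B).
Qed.

Lemma gL_lift X Y q A B : vat (K A) (io q) = pushv io (vat X q) ->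
  vat (K B) (io q) = pushv io (vat Y q) -> gL X Y q = om2 A (K B) (io q).
Proof. by move=> hA hB; rewrite (gP hA hB) /eval2 -fam2_scons. Qed.

Lemma gL_related X Y A B : related io X (K A) -> related io Y (K B) ->
  gL X Y = pull io (om2 A (K B)).
Proof. by move=> rX rY; apply: Cinf_eqP => q; rewrite (@gL_lift X Y q A B). Qed.

Lemma gL_sym X Y : gL X Y = gL Y X.
Proof.
apply: Cinf_eqP => q; have [A hA] := leaf_lift (vat_tangent X q).
have [B hB] := leaf_lift (vat_tangent Y q).
by rewrite (gL_lift hA hB) (gL_lift hB hA) (om_K_sym nf).
Qed.

Lemma gL_linl (h : Cinf L) X X' Y : gL (h *: X + X') Y = h * gL X Y + gL X' Y.
Proof.
apply: Cinf_eqP => q; have [A hA] := leaf_lift (vat_tangent X q).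
have [A' hA'] := leaf_lift (vat_tangent X' q).
have [B hB] := leaf_lift (vat_tangent Y q).
have hW : vat (K ((h q *: (1 : Cinf M)) *: A + A')) (io q) =
    pushv io (vat (h *: X + X') q).
  apply/funext => f; rewrite (K_linear nf) /vat vf_addE vf_scaleE !CinfE mulr1.
  have := congr1 (@^~ f) hA; have := congr1 (@^~ f) hA'.
  by rewrite /vat /pushv => -> ->.
rewrite (gL_lift hW hB) !CinfE (gL_lift hA hB) (gL_lift hA' hB).
by rewrite (omDl nf) (omZl nf) !CinfE mulr1.
Qed.

Lemma gL_linr (h : Cinf L) X Y Y' : gL X (h *: Y + Y') = h * gL X Y + gL X Y'.
Proof. by rewrite gL_sym gL_linl ![gL _ X]gL_sym. Qed.

Lemma gLDl X X' Y : gL (X + X') Y = gL X Y + gL X' Y.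
Proof. by rewrite -{1}[X]scale1r gL_linl mul1r. Qed.

Lemma gL0l Y : gL 0 Y = 0.
Proof. by have := gLDl 0 0 Y; rewrite addr0 => /eqP; rewrite addrC -subr_eq subrr => /eqP. Qed.

Lemma gLZl (h : Cinf L) X Y : gL (h *: X) Y = h * gL X Y.
Proof. by rewrite -[h *: X]addr0 gL_linl gL0l addr0. Qed.

Lemma gLNl X Y : gL (- X) Y = - gL X Y.
Proof. by rewrite -scaleN1r gLZl mulN1r. Qed.

Lemma gLDr X Y Y' : gL X (Y + Y') = gL X Y + gL X Y'.
Proof. by rewrite gL_sym gLDl ![gL _ X]gL_sym. Qed.

Lemma gLZr (h : Cinf L) X Y : gL X (h *: Y) = h * gL X Y.
Proof. by rewrite gL_sym gLZl [gL Y X]gL_sym. Qed.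

(** The fields [K B] restrict to the leaf and suffice as test fields, by [K_eq0_om_at]. *)
Lemma gL_nondeg X : (forall Y, gL X Y = 0) -> X = 0.
Proof.
move=> X0; apply: vfield_eq => q; have [A hA] := leaf_lift (vat_tangent X q).
have KA0 : vat (K A) (io q) = (fun=> 0).
  apply: (K_eq0_om_at nf) => B; have [Y rY] := leaf_related B.
  by rewrite -(gL_lift hA (esym (rY q))) X0.
apply: (pushv_inj inj (vat_tangent X q) (tangent0 q)); by rewrite -hA KA0.
Qed.

Lemma connD (T : vfield L -> vfield L -> vfield L) : is_connection T ->
  forall (h : Cinf L) X Y Y', T X (h *: Y + Y') = X h *: Y + h *: T X Y + T X Y'.
Proof. by move=> [_ a s] h X Y Y'; rewrite a s. Qed.

Lemma lie_linl (h : Cinf L) X X' Y : lie (h *: X + X') Y = h *: lie X Y - Y h *: X + lie X' Y.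
Proof.
apply/val_inj/funext => f.
rewrite -[LHS]/(lie (h *: X + X') Y f) -[RHS]/((h *: lie X Y - Y h *: X + lie X' Y) f).
by rewrite !(vf_addE, vf_oppE, vf_scaleE, lieE) vfD vfM; ring.
Qed.

Lemma lie_anti X Y : lie X Y = - lie Y X.
Proof.
apply/val_inj/funext => f; rewrite -[LHS]/(lie X Y f) -[RHS]/((- lie Y X) f).
by rewrite vf_oppE !lieE opprB.
Qed.

(* Torsion is tensorial, so it may be computed on fields related to [K A]. *)
Lemma torsion_free_related (T : vfield L -> vfield L -> vfield L) : is_connection T ->
  (forall X Y A B, related io X (K A) -> related io Y (K B) -> T X Y - T Y X = lie X Y) ->
  torsion_free T.
Proof.
move=> cT H X Y; apply/subr0_eq.
have lT U h X1 X2 : T (h *: X1 + X2) U = h *: T X1 U + T X2 U by have [l _ _] := cT.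
pose tor X Y := T X Y - T Y X - lie X Y.
rewrite -/(tor X Y).
have l1 U (h : Cinf L) V V' : tor (h *: V + V') U = h *: tor V U + tor V' U.
  apply/val_inj/funext => f.
  rewrite -[LHS]/(tor (h *: V + V') U f) -[RHS]/((h *: tor V U + tor V' U) f) /tor.
  rewrite lT (connD cT) lie_linl !(vf_addE, vf_oppE, vf_scaleE); ring.
have anti U V : tor U V = - tor V U.
  apply/val_inj/funext => f.
  rewrite -[LHS]/(tor U V f) -[RHS]/((- tor V U) f) /tor.
  by rewrite !(vf_addE, vf_oppE, lieE); ring.
apply: (vfield_tensor2_eq0 (T := tor)) => [//|U h V V'|U V A B rU rV].
  by rewrite anti l1 ![tor _ U]anti scalerN -opprD opprK.
by rewrite /tor (H _ _ A B)// subrr.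
Qed.

Let cB : is_connection nBL := nBLP.1.

Lemma nBL_related X Y A B : related io X (K A) -> related io Y (K B) ->
  related io (nBL X Y) (nB (K A) (K B)).
Proof. by move=> rX rY; apply: nBLP.2 => //; rewrite /tangent_to /= (KK nf). Qed.

Lemma nBL_torsion_free : torsion_free nBL.
Proof.
apply: torsion_free_related => // X Y A B rX rY.
apply: (related_eq inj); last exact: (related_lie rX rY).
rewrite -(bott_torsion nf dom bott).
by apply: related_add; [|apply: related_opp]; exact: nBL_related.
Qed.

Lemma nBLDl X X' Y : nBL (X + X') Y = nBL X Y + nBL X' Y.
Proof. by have [l _ _] := cB; rewrite -{1}[X]scale1r l scale1r. Qed.

Lemma nBL0l Y : nBL 0 Y = 0.
Proof. by have := nBLDl 0 0 Y; rewrite addr0 => /eqP; rewrite addrC -subr_eq subrr => /eqP. Qed.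

Lemma nBLZl (h : Cinf L) X Y : nBL (h *: X) Y = h *: nBL X Y.
Proof. by have [l _ _] := cB; rewrite -[h *: X]addr0 l nBL0l addr0. Qed.

Lemma nBLNl X Y : nBL (- X) Y = - nBL X Y.
Proof. by rewrite -scaleN1r nBLZl scaleN1r. Qed.

(** Curvature is tensorial in all three arguments, hence may be tested on fields related to some
    [K A]. There the inner derivative and the bracket are again related to sections of [ker K], as
    [induced_connection] requires. *)
Lemma nBL_flat : flat nBL.
Proof.
pose C X Y Z := nBL X (nBL Y Z) - nBL Y (nBL X Z) - nBL (lie X Y) Z.
have [_ cd cz] := cB.
have l1 Y Z h X X' f : C (h *: X + X') Y Z f = h * C X Y Z f + C X' Y Z f.
  rewrite /C lie_linl !(nBLDl, nBLNl, nBLZl, cd, cz).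
  by rewrite !(vf_addE, vf_oppE, vf_scaleE); ring.
have anti X Y Z f : C X Y Z f = - C Y X Z f.
  by rewrite /C (lie_anti X Y) nBLNl !(vf_addE, vf_oppE); ring.
have l3 X Y h Z Z' f : C X Y (h *: Z + Z') f = h * C X Y Z f + C X Y Z' f.
  rewrite /C !(nBLDl, nBLNl, nBLZl, cd, cz).
  by rewrite !(vf_addE, vf_oppE, vf_scaleE, lieE); ring.
move=> X Y Z; apply/subr0_eq; rewrite -/(C X Y Z).
apply/val_inj/funext => f.
apply: (tensor3_eq0 (T := fun X Y Z => C X Y Z f)).
- by move=> U V h W W'; exact: l1.
- by move=> U V h W W'; rewrite anti l1 ![C _ U V f]anti; ring.
- by move=> U V h W W'; exact: l3.
move=> U V W A B B' rU rV rW.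
have F X1 Y1 A1 B1 : related io X1 (K A1) -> related io Y1 (K B1) ->
    related io (nBL X1 (nBL Y1 W)) (nB (K A1) (nB (K B1) (K B'))).
  move=> rX rY; apply: nBLP.2 => //; last exact: nBL_related.
    by rewrite /tangent_to /= (KK nf).
  exact: (bott_tangent nf dphi dF bott).
have G : related io (nBL (lie U V) W) (nB (lie (K A) (K B)) (K B')).
  apply: nBLP.2 => //; last exact: related_lie.
    exact: (lie_tangent nf dphi dF).
  by rewrite /tangent_to /= (KK nf).
have E : nBL U (nBL V W) - nBL V (nBL U W) = nBL (lie U V) W.
  apply: (related_eq inj); last exact: G.
  rewrite -(bott_flat nf dphi dF bott).
  by apply: related_add; [|apply: related_opp]; exact: F.
by rewrite /C E subrr.
Qed.

Lemma pull_related X A f : related io X A -> X (pull io f) = pull io (A f).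
Proof. by move=> /relatedP. Qed.

Definition cubL X Y Z : Cinf L := X (gL Y Z) - gL (nBL X Y) Z - gL Y (nBL X Z).

(** Two connections are allowed because both [nBL] with itself (the cubic form) and [DL] with [nBL]
    (duality) occur. *)
Lemma gL_dual_tensor (T S : vfield L -> vfield L -> vfield L) :
  is_connection T -> is_connection S ->
  let C X Y Z := X (gL Y Z) - gL (T X Y) Z - gL Y (S X Z) in
  [/\ forall Y Z, tensor_lin (fun X => C X Y Z),
      forall X Z, tensor_lin (fun Y => C X Y Z) & forall X Y, tensor_lin (C X Y)].
Proof.
move=> [tl tD tZ] [sl sD sZ] C; split=> [Y Z h X X'|X Z h Y Y'|X Y h Z Z']; rewrite /C.
- rewrite vf_addE vf_scaleE tl sl gL_linl gL_linr; ring.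
- rewrite !gL_linl vfD vfM tD tZ !gLDl !gLZl; ring.
- rewrite !gL_linr vfD vfM sD sZ !gLDr !gLZr; ring.
Qed.

(** The second field is [B] rather than [K B], to cover the values of [nB], which lie in [ker K] but
    are not given as [K] of a field. *)
Lemma gL_tangent X Y A B : related io X (K A) -> related io Y B ->
  gL X Y = pull io (om2 A B).
Proof.
move=> rX rY; apply: Cinf_eqP => q.
by rewrite (gP (esym (rX q)) (esym (rY q))) /eval2 -fam2_scons.
Qed.

Lemma cubL_related X Y Z A B C : related io X (K A) -> related io Y (K B) ->
  related io Z (K C) -> cubL X Y Z = pull io (cubic om K nB A B C).
Proof.
move=> rX rY rZ; rewrite /cubL (gL_related rY rZ) (pull_related _ rX).
rewrite [gL (nBL _ _) _]gL_sym (gL_tangent rZ (nBL_related rX rY)).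
rewrite (gL_tangent rY (nBL_related rX rZ)) (bott_duality nf bott) /cubic.
by rewrite !(pullD, pullN); ring.
Qed.

Lemma cubL_tensor : 
  [/\ forall Y Z, tensor_lin (fun X => cubL X Y Z),
      forall X Z, tensor_lin (fun Y => cubL X Y Z) & forall X Y, tensor_lin (cubL X Y)].
Proof. exact: gL_dual_tensor. Qed.

Lemma cubL_sym12 X Y Z : cubL X Y Z = cubL Y X Z.
Proof.
have [l1 l2 l3] := cubL_tensor; apply/subr0_eq.
apply: (tensor3_eq0 (T := fun X Y Z => cubL X Y Z - cubL Y X Z)).
- by move=> U V h W W'; rewrite l1 l2; ring.
- by move=> U V h W W'; rewrite l1 l2; ring.
- by move=> U V h W W'; rewrite !l3; ring.
move=> U V W A B C rU rV rW; rewrite (cubL_related rU rV rW) (cubL_related rV rU rW).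
by rewrite (cubic_sym nf dom dphi dF bott) subrr.
Qed.

(** * Duality of the Bott connection with [D] on a leaf *)

Section Dual.
Variables (D : vfield M -> vfield M -> vfield M) (DL nabla : vfield L -> vfield L -> vfield L).
Hypotheses (DP : is_D K D) (DLP : induced_connection K io D DL).
Hypothesis nablaP : is_LeviCivita gL nabla.

Lemma D_image A B : D (K A) (K B) = K (lie (K A) B).
Proof.
apply: vfield_eq => p; apply: (DP (X := K A) (Y := K B)); rewrite /tangent_to /= ?(KK nf)//.
exact: filterE.
Qed.

Lemma DL_related X Y A B : related io X (K A) -> related io Y (K B) ->
  related io (DL X Y) (K (lie (K A) B)).
Proof.
by move=> rX rY; rewrite -D_image; apply: DLP.2; rewrite /tangent_to /= ?(KK nf).
Qed.

Lemma DL_torsion_free : torsion_free DL.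
Proof.
apply: torsion_free_related => [|X Y A B rX rY]; first exact: DLP.1.
apply: (related_eq inj); last exact: (related_lie rX rY).
rewrite (nijenhuis nf dphi dF).
by apply: related_add; [|apply: related_opp]; exact: DL_related.
Qed.

Lemma gL_duality X Y Z : X (gL Y Z) = gL (DL X Y) Z + gL Y (nBL X Z).
Proof.
apply/subr0_eq; rewrite opprD addrA.
have [l1 l2 l3] := gL_dual_tensor DLP.1 cB.
apply: (tensor3_eq0 l1 l2 l3) => U V W A B C rU rV rW.
rewrite (gL_related rV rW) (pull_related _ rU) (gL_related (DL_related rU rV) rW).
rewrite (gL_tangent rV (nBL_related rU rW)) (bott_duality nf bott).
by rewrite !(pullD, pullN); ring.
Qed.

(** The expression [gL (E X Y) Z] is symmetric in [X, Y], as all three connections are torsion-free,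
    and skew in [Y, Z], by duality and metric compatibility. As in the uniqueness of the Levi-Civita
    connection, the two together force [E = 0]. *)
Lemma nBL_dual X Y : nBL X Y = nabla X Y *+ 2 - DL X Y.
Proof.
have [cn tn mn] := nablaP.
pose E X Y := nBL X Y + DL X Y - (nabla X Y + nabla X Y).
suff E0 : E X Y = 0.
  rewrite mulr2n; apply/subr0_eq; rewrite -[RHS]E0 /E opprB.
  by rewrite addrA.
have Esym U V : E U V = E V U.
  apply/val_inj/funext => f; rewrite -[LHS]/(E U V f) -[RHS]/(E V U f) /E.
  have T (C : vfield L -> vfield L -> vfield L) : torsion_free C -> C U V f = C V U f + lie U V f.
    by move=> /(_ U V) <-; rewrite vf_addE vf_oppE; ring.
  rewrite !(vf_addE, vf_oppE) (T nBL nBL_torsion_free) (T DL DL_torsion_free) (T nabla tn).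
  ring.
have tanti U V (W : vfield L) : gL (E U V) W = - gL (E U W) V.
  apply: Cinf_eqP => q.
  have H1 := Cinf_at q (mn U V W); have H2 := Cinf_at q (gL_duality U V W).
  have H3 := Cinf_at q (gL_duality U W V).
  have S1 := Cinf_at q (gL_sym V (nBL U W)); have S2 := Cinf_at q (gL_sym W (nBL U V)).
  have S3 := Cinf_at q (gL_sym V (nabla U W)).
  rewrite (gL_sym W V) in H3.
  move: H1 H2 H3 S1 S2 S3.
  by rewrite /E !(gLDl, gLNl) !CinfE; lra.
apply: gL_nondeg => Z; apply: Cinf_eqP => q.
have A1 := Cinf_at q (tanti X Y Z); have A2 := Cinf_at q (tanti Y X Z).
have A3 := Cinf_at q (tanti Z X Y).
move: A1 A2 A3; rewrite (Esym Y X) (Esym Z X) (Esym Z Y) !CinfE; lra.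
Qed.

End Dual.


(** * Affine coordinates: potentials and the Monge-Ampere equation *)

Lemma chart_frame (c : chart R 3 L) q : smooth_chart c -> ch_dom c q ->
  exists E : 'I_3 -> vfield L,
    \forall r \near q, forall i, ch_dom c r /\ coord_at c i (E i) r.
Proof.
move=> Sc dq.
have /choice[E hE] : forall i : 'I_3, exists E : vfield L,
    \forall r \near q, ch_dom c r /\ coord_at c i E r.
  by move=> i; exact: coordinate_field.
by exists E; exact: filter_forall.
Qed.

Lemma gL_eq X X' Y Y' q : vat X q = vat X' q -> vat Y q = vat Y' q ->
  gL X Y q = gL X' Y' q.
Proof.
move=> XX YY.
rewrite (tensor_eq spanL (T := gL^~ Y) _ XX); last by move=> h U V; exact: gL_linl.
by rewrite (tensor_eq spanL (T := gL X') _ YY)// => h U V; exact: gL_linr.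
Qed.

Lemma cubL_eq X X' Y Y' Z Z' q : vat X q = vat X' q -> vat Y q = vat Y' q ->
  vat Z q = vat Z' q -> cubL X Y Z q = cubL X' Y' Z' q.
Proof.
move=> XX YY ZZ; have [l1 l2 l3] := cubL_tensor.
rewrite (tensor_eq spanL (l1 Y Z) XX) (tensor_eq spanL (l2 X' Z) YY).
exact: (tensor_eq spanL (l3 X' Y') ZZ).
Qed.

Lemma coord_at_vat (c : chart R 3 L) i X Y q : coord_at c i X q -> coord_at c i Y q ->
  vat X q = vat Y q.
Proof. by move=> cX cY; apply/funext => f; rewrite /vat cX cY. Qed.

(** The Christoffel symbols vanish, so the partial derivatives of the metric coefficients are its
    covariant derivatives. *)
Lemma affine_cubL (c : chart R 3 L) (E : 'I_3 -> vfield L) q i j k :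
  affine_chart nBL c -> (\forall r \near q, forall i, ch_dom c r /\ coord_at c i (E i) r) ->
  E k (gL (E i) (E j)) q = cubL (E k) (E i) (E j) q.
Proof.
move=> [Sc aff] nE; have [dq _] := nbhs_singleton nE i.
have nEi l : \forall r \near q, coord_at c l (E l) r.
  by apply: filterS nE => r /(_ l)[].
have v0 l m : vat (nBL (E l) (E m)) q = (fun=> 0) by apply: (aff l m).
have g0 U V : vat U q = (fun=> 0) -> gL U V q = 0.
  by move=> U0; apply: (tensor_eq0 spanL (T := gL^~ V)) => // h X Y; exact: gL_linl.
by rewrite /cubL !CinfE [gL (E i) (nBL _ _)]gL_sym !(g0 _ _ (v0 _ _)) !subr0.
Qed.

(** The Poincare lemma is applied twice: each column of the metric is closed by symmetry of the
    cubic form, with potential [w j], and the family [w] is closed by symmetry of the metric, with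
    potential [u]. *)
Lemma gL_hessian (c : chart R 3 L) q : affine_chart nBL c -> ch_dom c q ->
  exists V u, V q /\ potential_on gL c V u.
Proof.
move=> affc dq; have [Sc _] := affc; have Cc := Sc.1.
have [E nE] := chart_frame Sc dq.
(* [near_join] provides the frame on a neighbourhood of each point of the ball, since [affine_cubL]
   differentiates there. *)
have nz := near_chart Cc dq (near_join nE).
have /nbhs_ballP[e /= e0 eB] := nz.
pose B := [set z : 'rV[R]_3 | `|z - ch_to c q| < e].
have oB : open B by exact: open_norm_ball.
have inB z : B z -> ch_img c z /\
    \forall s \near ch_from c z, forall i, ch_dom c s /\ coord_at c i (E i) s.
  by move=> Bz; apply: eB; rewrite -ball_normE /= distrC.
have BI : B `<=` ch_img c by move=> z /inB[].
pose g i j := gL (E i) (E j) \o ch_from c.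
have Cg k i j : Ck k B (g i j) by apply: Ck_sub BI _; exact: smooth_in_chart.
have Dg z i j k : B z -> 'D_(evec R k) (g i j) z = cubL (E k) (E i) (E j) (ch_from c z).
  move=> Bz; have [Iz nzE] := inB z Bz; have [_ toK] := ch_fromK Cc Iz.
  rewrite -(affine_cubL i j k affc nzE); have [_ ->] := nbhs_singleton nzE k.
  by rewrite toK.
have gS i j z : g i j z = g j i z by rewrite /g /= gL_sym.
have /choice[w hw] : forall j, exists u : 'rV[R]_3 -> R,
    forall x, B x -> forall i, is_derive x (evec R i) u (g i j x).
  move=> j; apply: (@poincare_ball R 3 (ch_to c q) e (fun i => g i j)) => [i|x i k Bx].
    exact: Cg.
  by rewrite !Dg// cubL_sym12.
have Cw k j : Ck k B (w j).
  by apply: CkW; apply: (Ck_partials oB (h := fun i => g i j)) => // x i Bx; exact: hw.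
have [u hu] : exists u : 'rV[R]_3 -> R,
    forall x, B x -> forall j, is_derive x (evec R j) u (w j x).
  apply: (@poincare_ball R 3 (ch_to c q) e w) => [i|x i k Bx]; first exact: Cw.
  by have [_ ->] := hw k x Bx i; have [_ ->] := hw i x Bx k.
have Cu k : Ck k B u.
  by apply: CkW; apply: (Ck_partials oB (h := w)) => // x i Bx; exact: hu.
exists (ch_dom c `&` [set r | B (ch_to c r)]), u.
have [od _ Kc ct _] := Cc.
split; first by split=> //; rewrite /B /= subrr normr0.
split.
- rewrite openE => r [dr Br]; rewrite /interior.
  have n1 : nbhs r (ch_dom c) by exact: open_nbhs_nbhs.
  have n2 : nbhs (ch_to c r) B by exact: open_nbhs_nbhs.
  exact: filterI n1 (ct _ dr _ n2).
- by move=> r [].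
- by move=> k; apply: Ck_sub (Cu k) => z [r [dr Br] <-].
move=> r [dr Br] i j X Y cX cY; have [_ nzE] := inB _ Br.
have cE l : coord_at c l (E l) r.
  by move: nzE; rewrite Kc// => /nbhs_singleton/(_ l)[].
rewrite (gL_eq (coord_at_vat cX (cE i)) (coord_at_vat cY (cE j))) mxE.
have -> : 'D_(evec R i) ('D_(evec R j) u) (ch_to c r) = 'D_(evec R i) (w j) (ch_to c r).
  apply: near_eq_derive; apply: filterS (open_nbhs_nbhs (conj oB Br)) => z Bz.
  by have [_ ->] := hu z Bz j.
by have [_ ->] := hw j _ Br i; rewrite /g /= Kc.
Qed.

Lemma rows_det3_at (x y z : nat -> Cinf L) q : rows_det3 x y z q =
  rows_det3 (fun j => x j q) (fun j => y j q) (fun j => z j q).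
Proof. by rewrite /rows_det3 !CinfE. Qed.

(** Near each point [\det (hess u)] coincides with the Gram determinant [G] of the coordinate
    fields, which also makes it differentiable. Its derivative is the contraction of the cubic form
    with the adjugate of the metric, zero by [cubic_trace_free]. *)
Lemma gL_monge_ampere : monge_ampere gL nBL.
Proof.
move=> c V u affc cV [oV Vd _ pot]; have [Sc _] := affc; have Cc := Sc.1.
have [od oi Kc ct _] := Cc.
have [[q0 Vq0]|V0] := pselect (V !=set0); last first.
  by exists 0 => q Vq; case: V0; exists q.
exists (\det (hess u (ch_to c q0))) => q Vq.
pose W := ch_to c @` V.
have oW : open W.
  by rewrite /W -(setIidr Vd); exact: open_chart_image.
have cW : connected W.
  apply: connected_continuous_connected => //.
  apply: continuous_in_subspaceT => r; rewrite inE => Vr; exact/ct/Vd.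
apply: (zero_partials_const oW cW (f := fun z => \det (hess u z))); last 2 first.
- by exists q.
- by exists q0.
move=> _ [r Vr <-] k; have dr := Vd _ Vr.
have [E nE] := chart_frame Sc dr.
pose rr (i j : nat) := gL (E (inord i)) (E (inord j)).
pose G := rows_det3 (rr 0%N) (rr 1%N) (rr 2%N).
have nG : \forall z \near ch_to c r, (G \o ch_from c) z = \det (hess u z).
  have nV : \forall s \near r, V s by exact: open_nbhs_nbhs.
  apply: filterS (near_chart Cc dr (filterI nV nE)) => z [Iz [Vz cz]].
  have [dz toK] := ch_fromK Cc Iz.
  rewrite -[LHS]/(G (ch_from c z)).
  have -> : hess u z = \matrix_(i, j) (fun a b => rr a b (ch_from c z)) i j.
    apply/matrixP => i j; rewrite [RHS]mxE /rr !inord_val.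
    by rewrite (pot _ Vz i j _ _ (cz i).2 (cz j).2) toK.
  rewrite (det_cdet 3 (fun a b => rr a b (ch_from c z))) rows_det3_at /rows_det3 /= /bump /=; ring.
have dG : derivable (G \o ch_from c : 'rV[R]_3 -> R) (ch_to c r) (evec R k).
  have [_ /(_ k)[d _]] := smooth_in_chart G 1 Sc; apply: d; exact: ch_img_to.
split; first exact: near_eq_derivable nG dG.
rewrite -(near_eq_derive _ nG).
have [_ <-] := nbhs_singleton nE k.
have [A [X [rX XE]]] := leaf_related_at (E k) r.
(* [cubic_trace_free] concerns fields on [M]: at the single point [r], the frame is replaced by
   restrictions of fields [K (Wf i)] with the same values. *)
have /choice[Wf /choice[Y hY]] : forall i : nat, exists B, exists Y',
    related io Y' (K B) /\ vat Y' r = vat (E (inord i)) r.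
  by move=> i; exact: leaf_related_at.
have rE i j : rr i j r = om2 (Wf i) (K (Wf j)) (io r).
  have [[rY1 e1] [rY2 e2]] := (hY i, hY j).
  by rewrite /rr -(gL_eq e1 e2) (gL_related rY1 rY2).
have TE i j : E k (rr i j) r = cubic om K nB A (Wf i) (Wf j) (io r).
  have [[rY1 e1] [rY2 e2]] := (hY i, hY j).
  by rewrite (affine_cubL (inord i) (inord j) k affc nE) -(cubL_eq XE e1 e2) (cubL_related rX rY1 rY2).
have := Cinf_at (io r) (cubic_trace_free nf dF bott A Wf).
rewrite /G /rows_det3 !CinfE => <-.
rewrite !(vfD, vfN, vfM) !CinfE !rE !TE /cubic !CinfE; ring.
Qed.

End Leaf.

Theorem theorem5p3 (R : realType) (M : manifold R 6)
    (om : dform M 2) (phi0 : dform M 3) (K : vfield M -> vfield M)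
    (D nB : vfield M -> vfield M -> vfield M)
    (om_symplectic : symplectic om)
    (phi0_form : is_form phi0)
    (phi0_primitive : primitive_form om phi0)
    (K_phi0 : is_K om phi0 K)
    (phi0_harmonic : F_harmonic K phi0)
    (phi0_orbit : forall p : M, orbit_O0p om phi0 p)
    (D_spec : is_D K D)
    (nB_spec : is_Bott om K nB)
    (L : manifold R 3) (io : smap L M) (L_leaf : is_leaf K io)
    (gL : vfield L -> vfield L -> Cinf L)
    (gL_spec : is_leaf_metric om K io gL)
    (nBL : vfield L -> vfield L -> vfield L)
    (nBL_spec : induced_connection K io nB nBL) :
  (forall DL nabla : vfield L -> vfield L -> vfield L,
     induced_connection K io D DL -> is_LeviCivita gL nabla ->
     forall X Y : vfield L, nBL X Y = nabla X Y *+ 2 - DL X Y)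
  /\ hessian_metric gL nBL
  /\ monge_ampere gL nBL.
Proof.
have spanM (p : M) : spanned p by have [e [be _ _]] := phi0_orbit p; exact: basis_spanned be.
have nfe p : exists e, cotangent_basis p e /\ normal_at om phi0 K p (cov_coord p e).
  by have [e [be omE phiE]] := phi0_orbit p; exists e; split=> //; exact: normal_at_cov_coord.
have nf p : exists cd, normal_at om phi0 K p cd.
  by have [e [_ N]] := nfe p; exists (cov_coord p e).
have [_ dom _] := om_symplectic; have [dphi dF] := phi0_harmonic.
have leafL := L_leaf.1; have spanL := leaf_spanned nfe leafL.
split; first by move=> DL nabla DLP nablaP X Y; apply: nBL_dual nablaP X Y; eassumption.
split; last by apply: gL_monge_ampere; eassumption.
split; first exact: nBL_spec.1.
- by apply: nBL_torsion_free; eassumption.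
- by apply: nBL_flat; eassumption.
- by move=> c affc q; apply: gL_hessian affc; eassumption.
Qed.
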